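(* Let $(A,L)$ be an $LR_\infty[1]$ algebra and let $\Delta$ be a flat right $(A,L)$-connection in $A$. Then the operators $D_k^\Delta:S_A^\bullet L\to S_A^\bullet L$, $k\ge 1$, form a $BV_\infty$ algebra structure on $S_A^\bullet L$ generating the $P_\infty[1]$ brackets in $S_A^\bullet L$, i.e. $$\{u_1,\dots,u_k\}=[\cdots[[D_k^\Delta,\mu_{u_1}],\mu_{u_2}]\cdots,\mu_{u_k}]\,1$$ for all $u_1,\dots,u_k\in S_A^\bullet L$ and all $k$.
   Context: Conventions: $K$ is a field of characteristic $0$; graded means $\mathbb Z$-graded; $\bar v$ is the degree of a homogeneous element or map $v$, and bars are omitted in exponents of signs: $(-)^{v}=(-1)^{\bar v}$, $(-)^{vw}=(-1)^{\bar v\bar w}$. $[F,G]=F\circ G-(-)^{FG}G\circ F$ is the graded commutator. $S_{\ell,m}$ is the set of $(\ell,m)$-unshuffles, i.e. permutations $\pi$ of $\{1,\dots,\ell+m\}$ with $\pi(1)<\cdots<\pi(\ell)$ and $\pi(\ell+1)<\cdots<\pi(\ell+m)$ (sums over $S_{\ell,m}$ with $\ell<0$ or $m<0$ are zero). $\alpha(\pi,\boldsymbol v)$ is the Koszul sign: $v_{\pi(1)}\odot\cdots\odot v_{\pi(n)}=\alpha(\pi,\boldsymbol v)\,v_1\odot\cdots\odot v_n$ in the graded symmetric algebra. Multilinearity over a graded algebra and graded symmetry use the Koszul sign rule. $LR_\infty[1]$ algebra: let $A$ be an associative, graded commutative, unital $K$-algebra and $L$ a graded $A$-module. An $LR_\infty[1]$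 algebra structure on $(A,L)$ is a degree $1$ multiderivation $\mathbb X=\mathbb X_1+\mathbb X_2+\cdots$ (formal infinite sum, no $0$-entry component), $\mathbb X_k=(X_k,\sigma_k)$, where $X_k:L^{\times k}\to L$ is graded symmetric, $K$-multilinear, of degree $1$, and $\sigma_k:L^{\times(k-1)}\to\mathrm{Der}A$ is graded symmetric, $A$-multilinear, of degree $1$ (write $\sigma_k(\xi_1,\dots,\xi_{k-1}|a)$ for $\sigma_k(\xi_1,\dots,\xi_{k-1})(a)$), with $$X_k(\xi_1,\dots,\xi_{k-1},a\xi_k)=\sigma_k(\xi_1,\dots,\xi_{k-1}|a)\,\xi_k+(-)^{(1+\xi_1+\cdots+\xi_{k-1})a}a\,X_k(\xi_1,\dots,\xi_k),$$ and such that for all $k$: (J1) $\sum_{i+j=k}\sum_{\pi\in S_{i,j}}\alpha(\pi,\boldsymbol\xi)X_{j+1}(X_i(\xi_{\pi(1)},\dots,\xi_{\pi(i)}),\xi_{\pi(i+1)},\dots,\xi_{\pi(i+j)})=0$, and (J2) $\sum_{i+j=k}\sum_{\pi\in S_{i,j-1}}\alpha(\pi,\boldsymbol\xi)\big[\sigma_{j+1}(X_i(\xi_{\pi(1)},\dots,\xi_{\pi(i)}),\xi_{\pi(i+1)},\dots,\xi_{\pi(k-1)}|a)+(-)^{\xi_{\pi(1)}+\cdots+\xi_{\pi(i)}}\sigma_{i+1}(\xi_{\pi(1)},\dots,\xi_{\pi(i)}|\sigma_j(\xi_{\pi(i+1)},\dots,\xi_{\pi(k-1)}|a))\big]=0$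 (with $X_0=0$). Right connection: for a graded $A$-module $Q$ let $\mathrm{Der}^RQ$ be the set of pairs $(Z,\sigma_Z)$, with $Z:Q\to Q$ graded $K$-linear, $\sigma_Z\in\mathrm{Der}A$, $Z(aq)=(-)^{Za}aZ(q)+\sigma_Z(a)q$, with $A$-module structure $a\cdot(Z,\sigma_Z)=((-)^{aZ}Z\circ a,\,a\sigma_Z)$ ($a$ acting by multiplication). A right $(A,L)$-connection in $Q$ is $\Delta=\Delta_1+\Delta_2+\cdots$, with $\Delta_k:L^{\times(k-1)}\to\mathrm{Der}^RQ$ graded symmetric, $A$-multilinear, of degree $1$, such that the symbol of $\Delta_k(\xi_1,\dots,\xi_{k-1})$ is $-\sigma_k(\xi_1,\dots,\xi_{k-1})$. It is flat if its curvature $$J(\Delta)(\xi_1,\dots,\xi_{k-1}|q)=\sum_{i+j=k}\sum_{\pi\in S_{i,j-1}}\alpha(\pi,\boldsymbol\xi)\big[\Delta_{j+1}(X_i(\xi_{\pi(1)},\dots,\xi_{\pi(i)}),\xi_{\pi(i+1)},\dots,\xi_{\pi(k-1)}|q)-(-)^{\xi_{\pi(1)}+\cdots+\xi_{\pi(i)}}\Delta_{i+1}(\xi_{\pi(1)},\dots,\xi_{\pi(i)}|\Delta_j(\xi_{\pi(i+1)},\dots,\xi_{\pi(k-1)}|q))\big]$$ vanishes for all $k\ge1$. Here $Q=A$. Operators: $S_A^\bullet L$ is the graded symmetric algebra of $L$ over $A$, identified with $S_A^\bullet L\otimes_AA$; $\mu_u$ is left multiplication by $u\in S_A^\bullet L$.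 For $Q=A$, $$D_k^\Delta(\xi_1\cdots\xi_\ell\otimes q)=\sum_{\tau\in S_{k,\ell-k}}\alpha(\tau,\boldsymbol\xi)X_k(\xi_{\tau(1)},\dots,\xi_{\tau(k)})\xi_{\tau(k+1)}\cdots\xi_{\tau(\ell)}\otimes q-\sum_{\pi\in S_{\ell-k+1,k-1}}(-)^{\xi_{\pi(1)}+\cdots+\xi_{\pi(\ell-k+1)}}\alpha(\pi,\boldsymbol\xi)\xi_{\pi(1)}\cdots\xi_{\pi(\ell-k+1)}\otimes\Delta_k(\xi_{\pi(\ell-k+2)},\dots,\xi_{\pi(\ell)}|q).$$ $P_\infty[1]$ brackets: $\{u_1,\dots,u_k\}:=\Lambda_k(u_1,\dots,u_k)$, where $\Lambda_k$ is the unique graded symmetric, $K$-multilinear, degree $1$ map $(S_A^\bullet L)^{\times k}\to S_A^\bullet L$ that is a graded derivation in each argument, with $\Lambda_k(\xi_1,\dots,\xi_k)=X_k(\xi_1,\dots,\xi_k)$, $\Lambda_k(\xi_1,\dots,\xi_{k-1},a)=\sigma_k(\xi_1,\dots,\xi_{k-1}|a)$ for $\xi_i\in L$, $a\in A$, and vanishing when at least two arguments are in $A$. $BV_\infty$ algebra: an associative, graded commutative, unital algebra $\mathscr B$ with degree $1$ differential operators $\square_k:\mathscr B\to\mathscr B$ of order $k$, $k=1,2,\dots$, such that $\square_i1=0$ for all $i$ and $\sum_{i+j=k}[\square_i,\square_j]=0$ for all $k$. A $K$-linear map $\square$ of $\mathscr B$ is a differential operator of order $k$ if $[\cdots[[\square,b_1],b_2]\cdots,b_{k+1}]=0$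 for all $b_1,\dots,b_{k+1}\in\mathscr B$, the $b_i$ acting by multiplication.
   Formalization: The clause D_k 1 = 0 of the BV_∞ axioms fails in general, since D_1 1 = −Δ_1(1) may be nonzero; the theorem proves all other BV_∞ axioms and the bracket formula unconditionally, and that the full BV_∞ axioms hold exactly when Δ_1(1) = 0. *)

(* Defs.v *)
(* boolp only serves to form the quotient type sym. *)
From HB Require Import structures.
From mathcomp Require Import all_boot all_order all_algebra.
From mathcomp Require Import perm boolp.

Set Implicit Arguments.
Unset Strict Implicit.
Unset Printing Implicit Defensive.

Import GRing.Theory.
Local Open Scope ring_scope.
Local Open Scope quotient_scope.

(* A graded object is a module together with its family gr of homogeneous
   subgroups: gr n v says that v is homogeneous of degree n (so 0 has every
   degree).  Formulas with signs are stated on homogeneous arguments; degrees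
   of the arguments are passed explicitly. *)

(* (-)^n; signs act on every module by v *~ sgn n *)
Definition sgn (n : int) : int := (-1) ^+ `|n|%N.

Definition degsum (s : seq int) : int := \sum_(e <- s) e.

Definition homs (V : Type) (gr : int -> V -> Prop) n (d : n.-tuple int)
    (v : n.-tuple V) : Prop :=
  forall i, gr (tnth d i) (tnth v i).

Record is_grading (V : zmodType) (gr : int -> V -> Prop) : Prop := {
  grading0 : forall n, gr n 0;
  gradingB : forall n x y, gr n x -> gr n y -> gr n (x - y);
  grading_span : forall x, exists (m : nat) (d : m.-tuple int) (v : m.-tuple V),
    homs gr d v /\ x = \sum_(y <- v) y;
  grading_direct : forall (s : seq int) (v : int -> V), uniq s ->
    (forall n, gr n (v n)) -> \sum_(n <- s) v n = 0 ->
    forall n, n \in s -> v n = 0 }.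

Record graded_calg (K : fieldType) (B : algType K) (gr : int -> B -> Prop)
    : Prop := {
  calg_grading : is_grading gr;
  calgZ : forall n (c : K) b, gr n b -> gr n (c *: b);
  calg1 : gr 0 1;
  calgM : forall m n b c, gr m b -> gr n c -> gr (m + n) (b * c);
  calgC : forall m n b c, gr m b -> gr n c -> b * c = (c * b) *~ sgn (m * n) }.

Record graded_module (A : pzRingType) (gA : int -> A -> Prop) (L : lmodType A)
    (gL : int -> L -> Prop) : Prop := {
  gmod_grading : is_grading gL;
  gmodZ : forall m n a x, gA m a -> gL n x -> gL (m + n) (a *: x) }.

Definition permt n (T : Type) (p : 'S_n) (t : n.-tuple T) : n.-tuple T :=
  [tuple tnth t (p i) | i < n].

(* (l, m)-unshuffles; the set is empty unless l + m = n *)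
Definition unshuffle n (l m : nat) : {set 'S_n} :=
  [set p : 'S_n | (l + m == n)%N &&
    [forall i : 'I_n, forall j : 'I_n,
      [&& i < j & (j < l) || (l <= i)]%N ==> (p i < p j)%N]].

(* Koszul sign of p on arguments of degrees d: one factor for each inversion *)
Definition koszul n (d : n.-tuple int) (p : 'S_n) : int :=
  \prod_(i < n) \prod_(j < n | (i < j)%N && (p j < p i)%N)
    sgn (tnth d (p i) * tnth d (p j)).

(* A map f : seq V -> W encodes the family of its restrictions f_k to
   sequences of length k, k >= 0. *)

Definition graded_symmetric (V : Type) (gr : int -> V -> Prop) (W : zmodType)
    (f : seq V -> W) : Prop :=
  forall n (d : n.-tuple int) (v : n.-tuple V) (p : 'S_n), homs gr d v ->
    f (permt p v) = f v *~ koszul d p.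

Definition multiadditive (V W : zmodType) (f : seq V -> W) : Prop :=
  forall s1 s2 x y, f (s1 ++ (x + y) :: s2) = f (s1 ++ x :: s2) + f (s1 ++ y :: s2).

Section LRinfinity.
Variables (K : fieldType) (A : algType K) (gA : int -> A -> Prop).
Variables (L : lmodType A) (gL : int -> L -> Prop).

(* X s is X_k(s) with k = size s, and sg s a is sigma_k(s|a) with
   k = (size s).+1.  The field K acts on L through k%:A. *)
Record LR_infty (X : seq L -> L) (sg : seq L -> A -> A) : Prop := {
  LR_X0 : X [::] = 0;
  LR_Xsym : graded_symmetric gL X;
  LR_Xadd : multiadditive X;
  LR_Xscale : forall s1 s2 (c : K) x,
    X (s1 ++ c%:A *: x :: s2) = c%:A *: X (s1 ++ x :: s2);
  LR_Xdeg : forall n (d : n.-tuple int) (xi : n.-tuple L), homs gL d xi ->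
    gL (1 + degsum d) (X xi);
  LR_sgadd_der : forall s a b, sg s (a + b) = sg s a + sg s b;
  LR_sgscale_der : forall s (c : K) a, sg s (c *: a) = c *: sg s a;
  LR_sgder : forall n (d : n.-tuple int) (xi : n.-tuple L) da a b,
    homs gL d xi -> gA da a ->
    sg xi (a * b) = sg xi a * b + (a * sg xi b) *~ sgn ((1 + degsum d) * da);
  LR_sgsym : forall a, graded_symmetric gL (sg ^~ a);
  LR_sgadd : forall a, multiadditive (sg ^~ a);
  LR_sgscale : forall n (d : n.-tuple int) (xi : n.-tuple L) s x da a b,
    homs gL d xi -> gA da a ->
    sg (xi ++ a *: x :: s) b =
      (a * sg (xi ++ x :: s) b) *~ sgn (da * (1 + degsum d));
  LR_sgdeg : forall n (d : n.-tuple int) (xi : n.-tuple L) da a,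
    homs gL d xi -> gA da a -> gA (1 + degsum d + da) (sg xi a);
  LR_leibniz : forall n (d : n.-tuple int) (xi : n.-tuple L) x da a,
    homs gL d xi -> gA da a ->
    X (rcons xi (a *: x)) =
      sg xi a *: x + (a *: X (rcons xi x)) *~ sgn ((1 + degsum d) * da);
  LR_J1 : forall n (d : n.-tuple int) (xi : n.-tuple L), homs gL d xi ->
    \sum_(i < n.+1) \sum_(p in unshuffle n i (n - i))
      X (X (take i (permt p xi)) :: drop i (permt p xi)) *~ koszul d p = 0;
  (* here n = k - 1 is the number of arguments from L, and j - 1 = n - i *)
  LR_J2 : forall n (d : n.-tuple int) (xi : n.-tuple L) a, homs gL d xi ->
    \sum_(i < n.+1) \sum_(p in unshuffle n i (n - i))
      (sg (X (take i (permt p xi)) :: drop i (permt p xi)) a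
       + sg (take i (permt p xi)) (sg (drop i (permt p xi)) a)
           *~ sgn (degsum (take i (permt p d)))) *~ koszul d p = 0 }.

(* Z-component of a . (Z, sigma_Z) in Der^R A, for a, Z of degrees da, dZ *)
Definition derR_scale (da dZ : int) (a : A) (Z : A -> A) (q : A) : A :=
  Z (a * q) *~ sgn (da * dZ).

(* A right (A, L)-connection in A: De s q is Delta_k(s|q), k = (size s).+1;
   the symbol of De s is fixed to be - sg s. *)
Record right_connection (sg : seq L -> A -> A) (De : seq L -> A -> A)
    : Prop := {
  rc_add_op : forall s q r, De s (q + r) = De s q + De s r;
  rc_scale_op : forall s (c : K) q, De s (c *: q) = c *: De s q;
  rc_symbol : forall n (d : n.-tuple int) (xi : n.-tuple L) da a q,
    homs gL d xi -> gA da a ->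
    De xi (a * q) = (a * De xi q) *~ sgn ((1 + degsum d) * da) + (- sg xi a) * q;
  rc_sym : forall q, graded_symmetric gL (De ^~ q);
  rc_add : forall q, multiadditive (De ^~ q);
  rc_scale : forall m n (d : m.-tuple int) (xi : m.-tuple L)
      (e : n.-tuple int) (eta : n.-tuple L) dx x da a q,
    homs gL d xi -> gL dx x -> homs gL e eta -> gA da a ->
    De (xi ++ a *: x :: eta) q =
      derR_scale da (1 + degsum d + dx + degsum e) a (De (xi ++ x :: eta)) q
        *~ sgn (da * (1 + degsum d));
  rc_deg : forall n (d : n.-tuple int) (xi : n.-tuple L) dq q,
    homs gL d xi -> gA dq q -> gA (1 + degsum d + dq) (De xi q) }.

Definition curvature (X : seq L -> L) (De : seq L -> A -> A)
    n (d : n.-tuple int) (xi : n.-tuple L) (q : A) : A :=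
  \sum_(i < n.+1) \sum_(p in unshuffle n i (n - i))
    (De (X (take i (permt p xi)) :: drop i (permt p xi)) q
     - De (take i (permt p xi)) (De (drop i (permt p xi)) q)
         *~ sgn (degsum (take i (permt p d)))) *~ koszul d p.

Definition flat (X : seq L -> L) (De : seq L -> A -> A) : Prop :=
  forall n (d : n.-tuple int) (xi : n.-tuple L) q, homs gL d xi ->
    curvature X De d xi q = 0.

End LRinfinity.

(* The graded symmetric algebra of L over A, as the quotient of the terms in
   generators A and L by the congruence generated by the axioms of rings, the
   structures of A and L, and graded commutativity of homogeneous generators;
   see sym_lift and sym_gen for the universal property. *)
Inductive sterm (A L : Type) : Type :=
  | SA of A
  | SL of L
  | Sadd of sterm A L & sterm A L
  | Sopp of sterm A L
  | Smul of sterm A L & sterm A L.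

Arguments SA {A L}.
Arguments SL {A L}.

HB.instance Definition _ (A L : Type) := gen_eqMixin (sterm A L).
HB.instance Definition _ (A L : Type) := gen_choiceMixin (sterm A L).

Section Sym.
Variables (K : fieldType) (A : algType K) (gA : int -> A -> Prop).
Variables (L : lmodType A) (gL : int -> L -> Prop).

Inductive scong : sterm A L -> sterm A L -> Prop :=
  | sc_refl t : scong t t
  | sc_sym t u : scong t u -> scong u t
  | sc_trans t u v : scong t u -> scong u v -> scong t v
  | sc_add t t' u u' : scong t t' -> scong u u' -> scong (Sadd t u) (Sadd t' u')
  | sc_opp t t' : scong t t' -> scong (Sopp t) (Sopp t')
  | sc_mul t t' u u' : scong t t' -> scong u u' -> scong (Smul t u) (Smul t' u')
  | sc_addA t u v : scong (Sadd t (Sadd u v)) (Sadd (Sadd t u) v)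
  | sc_addC t u : scong (Sadd t u) (Sadd u t)
  | sc_add0 t : scong (Sadd (SA 0) t) t
  | sc_addN t : scong (Sadd (Sopp t) t) (SA 0)
  | sc_mulA t u v : scong (Smul t (Smul u v)) (Smul (Smul t u) v)
  | sc_mul1l t : scong (Smul (SA 1) t) t
  | sc_mul1r t : scong (Smul t (SA 1)) t
  | sc_mulDl t u v : scong (Smul (Sadd t u) v) (Sadd (Smul t v) (Smul u v))
  | sc_mulDr t u v : scong (Smul t (Sadd u v)) (Sadd (Smul t u) (Smul t v))
  | sc_SAD a b : scong (SA (a + b)) (Sadd (SA a) (SA b))
  | sc_SAM a b : scong (SA (a * b)) (Smul (SA a) (SA b))
  | sc_SLD x y : scong (SL (x + y)) (Sadd (SL x) (SL y))
  | sc_SLZ a x : scong (SL (a *: x)) (Smul (SA a) (SL x))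
  | sc_central (c : K) t : scong (Smul (SA c%:A) t) (Smul t (SA c%:A))
  | sc_commAL m n a x : gA m a -> gL n x ->
      scong (Smul (SA a) (SL x)) (Smul (SA (1 *~ sgn (m * n))) (Smul (SL x) (SA a)))
  | sc_commLL m n x y : gL m x -> gL n y ->
      scong (Smul (SL x) (SL y)) (Smul (SA (1 *~ sgn (m * n))) (Smul (SL y) (SL x))).

Definition scongb : rel (sterm A L) := fun t u => `[< scong t u >].

Lemma scongb_refl : reflexive scongb.
Proof. by move=> t; apply/asboolP; apply: sc_refl. Qed.
Lemma scongb_sym : symmetric scongb.
Proof. by move=> t u; apply/asboolP/asboolP; apply: sc_sym. Qed.
Lemma scongb_trans : transitive scongb.
Proof. by move=> u t v /asboolP h1 /asboolP h2; apply/asboolP; apply: sc_trans h1 h2. Qed.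

Canonical scong_equiv := EquivRel scongb scongb_refl scongb_sym scongb_trans.

Definition sym := {eq_quot scongb}.

HB.instance Definition _ := Choice.on sym.
HB.instance Definition _ := EqQuotient.on sym.

Local Notation cl := (\pi_sym)%qT.

Lemma sym_eqP t u : scong t u <-> cl t = cl u.
Proof.
split=> [h|/eqmodP/asboolP//].
by apply/eqmodP/asboolP.
Qed.

Lemma repr_scong t : scong (repr (cl t)) t.
Proof. by apply/sym_eqP; rewrite reprK. Qed.

Lemma cl_repr (u : sym) : cl (repr u) = u.
Proof. exact: reprK. Qed.

Definition symA (a : A) : sym := cl (SA a).
Definition symL (x : L) : sym := cl (SL x).
Definition sym_add (u v : sym) : sym := cl (Sadd (repr u) (repr v)).
Definition sym_opp (u : sym) : sym := cl (Sopp (repr u)).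
Definition sym_mul (u v : sym) : sym := cl (Smul (repr u) (repr v)).

Lemma sym_addE t u : sym_add (cl t) (cl u) = cl (Sadd t u).
Proof. by apply/sym_eqP; apply: sc_add; apply: repr_scong. Qed.
Lemma sym_oppE t : sym_opp (cl t) = cl (Sopp t).
Proof. by apply/sym_eqP; apply: sc_opp; apply: repr_scong. Qed.
Lemma sym_mulE t u : sym_mul (cl t) (cl u) = cl (Smul t u).
Proof. by apply/sym_eqP; apply: sc_mul; apply: repr_scong. Qed.

Lemma sym_addA : associative sym_add.
Proof.
move=> u v w; rewrite -(cl_repr u) -(cl_repr v) -(cl_repr w) !sym_addE.
by apply/sym_eqP; apply: sc_addA.
Qed.
Lemma sym_addC : commutative sym_add.
Proof. by move=> u v; apply/sym_eqP; apply: sc_addC. Qed.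
Lemma sym_add0 : left_id (symA 0) sym_add.
Proof. by move=> u; rewrite -(cl_repr u) sym_addE; apply/sym_eqP; apply: sc_add0. Qed.
Lemma sym_addN : left_inverse (symA 0) sym_opp sym_add.
Proof. by move=> u; rewrite -(cl_repr u) sym_oppE sym_addE; apply/sym_eqP; apply: sc_addN. Qed.

HB.instance Definition _ :=
  GRing.isZmodule.Build sym sym_addA sym_addC sym_add0 sym_addN.

Lemma sym_mulA : associative sym_mul.
Proof.
move=> u v w; rewrite -(cl_repr u) -(cl_repr v) -(cl_repr w) !sym_mulE.
by apply/sym_eqP; apply: sc_mulA.
Qed.
Lemma sym_mul1l : left_id (symA 1) sym_mul.
Proof. by move=> u; rewrite -(cl_repr u) sym_mulE; apply/sym_eqP; apply: sc_mul1l. Qed.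
Lemma sym_mul1r : right_id (symA 1) sym_mul.
Proof. by move=> u; rewrite -(cl_repr u) sym_mulE; apply/sym_eqP; apply: sc_mul1r. Qed.
Lemma sym_mulDl : left_distributive sym_mul +%R.
Proof.
move=> u v w; rewrite -(cl_repr u) -(cl_repr v) -(cl_repr w).
rewrite /GRing.add /= !(sym_addE, sym_mulE); apply/sym_eqP; apply: sc_mulDl.
Qed.
Lemma sym_mulDr : right_distributive sym_mul +%R.
Proof.
move=> u v w; rewrite -(cl_repr u) -(cl_repr v) -(cl_repr w).
rewrite /GRing.add /= !(sym_addE, sym_mulE); apply/sym_eqP; apply: sc_mulDr.
Qed.

Fixpoint sterm_aug (t : sterm A L) : A :=
  match t with
  | SA a => a
  | SL _ => 0
  | Sadd t u => sterm_aug t + sterm_aug u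
  | Sopp t => - sterm_aug t
  | Smul t u => sterm_aug t * sterm_aug u
  end.

Lemma sterm_aug_scong t u : scong t u -> sterm_aug t = sterm_aug u.
Proof.
elim=> {t u} //=.
- by move=> t u v _ -> _ ->.
- by move=> t t' u u' _ -> _ ->.
- by move=> t t' _ ->.
- by move=> t t' u u' _ -> _ ->.
- by move=> *; rewrite addrA.
- by move=> *; rewrite addrC.
- by move=> *; rewrite add0r.
- by move=> *; rewrite addNr.
- by move=> *; rewrite mulrA.
- by move=> *; rewrite mul1r.
- by move=> *; rewrite mulr1.
- by move=> *; rewrite mulrDl.
- by move=> *; rewrite mulrDr.
- by move=> *; rewrite addr0.
- by move=> *; rewrite mulr0.
- by move=> *; rewrite mulr_algl mulr_algr.
- by move=> *; rewrite mulr0 mul0r mulr0.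
- by move=> *; rewrite mulr0 mulr0.
Qed.

Lemma symA_inj : injective symA.
Proof. by move=> a b /sym_eqP/sterm_aug_scong. Qed.

Lemma sym_1neq0 : symA 1 != 0.
Proof. by apply/eqP=> /symA_inj/eqP; rewrite oner_eq0. Qed.

HB.instance Definition _ := GRing.Zmodule_isNzRing.Build sym
  sym_mulA sym_mul1l sym_mul1r sym_mulDl sym_mulDr sym_1neq0.

Lemma symAD a b : symA (a + b) = symA a + symA b.
Proof. by rewrite [RHS]sym_addE; apply/sym_eqP; apply: sc_SAD. Qed.
Lemma symAM a b : symA (a * b) = symA a * symA b.
Proof. by rewrite [RHS]sym_mulE; apply/sym_eqP; apply: sc_SAM. Qed.
Lemma symLD x y : symL (x + y) = symL x + symL y.
Proof. by rewrite [RHS]sym_addE; apply/sym_eqP; apply: sc_SLD. Qed.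
Lemma symLZ a x : symL (a *: x) = symA a * symL x.
Proof. by rewrite [RHS]sym_mulE; apply/sym_eqP; apply: sc_SLZ. Qed.
Lemma symA_central (c : K) u : symA c%:A * u = u * symA c%:A.
Proof.
rewrite -(cl_repr u) [LHS]sym_mulE [RHS]sym_mulE.
apply/sym_eqP; apply: sc_central.
Qed.

Definition sym_scale (c : K) (u : sym) : sym := symA c%:A * u.

Lemma sym_scaleA c d u : sym_scale c (sym_scale d u) = sym_scale (c * d) u.
Proof. by rewrite /sym_scale mulrA -symAM mulr_algl scalerA. Qed.
Lemma sym_scale1 : left_id 1 sym_scale.
Proof. by move=> u; rewrite /sym_scale scale1r [symA 1]/(1 : sym) mul1r. Qed.
Lemma sym_scaleDr : right_distributive sym_scale +%R.
Proof. by move=> c u v; rewrite /sym_scale mulrDr. Qed.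
Lemma sym_scaleDl u : {morph sym_scale^~ u : c d / c + d}.
Proof. by move=> c d; rewrite /sym_scale scalerDl symAD mulrDl. Qed.

HB.instance Definition _ := GRing.Zmodule_isLmodule.Build K sym
  sym_scaleA sym_scale1 sym_scaleDr sym_scaleDl.

Lemma sym_scaleAl (c : K) (u v : sym) : c *: (u * v) = (c *: u) * v.
Proof. by rewrite /GRing.scale /= /sym_scale mulrA. Qed.
HB.instance Definition _ := GRing.Lmodule_isLalgebra.Build K sym sym_scaleAl.

Lemma sym_scaleAr (c : K) (u v : sym) : c *: (u * v) = u * (c *: v).
Proof. by rewrite /GRing.scale /= /sym_scale !mulrA symA_central. Qed.
HB.instance Definition _ := GRing.Lalgebra_isAlgebra.Build K sym sym_scaleAr.

Inductive sym_deg : int -> sym -> Prop :=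
  | symdegA n a : gA n a -> sym_deg n (symA a)
  | symdegL n x : gL n x -> sym_deg n (symL x)
  | symdegD n u v : sym_deg n u -> sym_deg n v -> sym_deg n (u + v)
  | symdegM m n u v : sym_deg m u -> sym_deg n v -> sym_deg (m + n) (u * v).

Lemma sym_gen (P : sym -> Prop) :
  (forall a, P (symA a)) -> (forall x, P (symL x)) ->
  (forall u v, P u -> P v -> P (u + v)) ->
  (forall u v, P u -> P v -> P (u * v)) -> forall u, P u.
Proof.
move=> hA hL hD hM u; rewrite -(cl_repr u).
elim: (repr u) => {u} [a|x|t Pt u Pu|t Pt|t Pt u Pu]; [exact: hA|exact: hL| | |].
- by rewrite -[cl _]sym_addE; apply: hD.
- rewrite -[cl _]sym_oppE -[sym_opp _]/(- (cl t)) -mulN1r; apply: hM => //.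
  suff -> : (-1 : sym) = symA (-1) by [].
  by apply: (addIr (symA 1)); rewrite -symAD !addNr.
- by rewrite -[cl _]sym_mulE; apply: hM.
Qed.

Lemma sym_lift (B : algType K) (f : {lrmorphism A -> B}) (g : {additive L -> B}) :
  (forall a x, g (a *: x) = f a * g x) ->
  (forall m n a x, gA m a -> gL n x -> f a * g x = (g x * f a) *~ sgn (m * n)) ->
  (forall m n x y, gL m x -> gL n y -> g x * g y = (g y * g x) *~ sgn (m * n)) ->
  exists h : {lrmorphism sym -> B},
    (forall a, h (symA a) = f a) /\ (forall x, h (symL x) = g x).
Proof.
move=> hZ hAL hLL.
pose ev := fix ev (t : sterm A L) : B :=
  match t with
  | SA a => f a | SL x => g x
  | Sadd t u => ev t + ev u | Sopp t => - ev t | Smul t u => ev t * ev u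
  end.
have evP t u : scong t u -> ev t = ev u.
  elim=> {t u} //=.
  - by move=> t u v _ -> _ ->.
  - by move=> t t' u u' _ -> _ ->.
  - by move=> t t' _ ->.
  - by move=> t t' u u' _ -> _ ->.
  - by move=> *; rewrite addrA.
  - by move=> *; rewrite addrC.
  - by move=> *; rewrite rmorph0 add0r.
  - by move=> *; rewrite addNr rmorph0.
  - by move=> *; rewrite mulrA.
  - by move=> *; rewrite rmorph1 mul1r.
  - by move=> *; rewrite rmorph1 mulr1.
  - by move=> *; rewrite mulrDl.
  - by move=> *; rewrite mulrDr.
  - by move=> *; rewrite rmorphD.
  - by move=> *; rewrite rmorphM.
  - by move=> *; rewrite raddfD.
  - by move=> c t; rewrite linearZ /= rmorph1 mulr_algl mulr_algr.
  - by move=> m n a x ha hx; rewrite (hAL _ _ _ _ ha hx) rmorphMz rmorph1 mulrzl.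
  - by move=> m n x y hx hy; rewrite (hLL _ _ _ _ hx hy) rmorphMz rmorph1 mulrzl.
pose h (u : sym) : B := ev (repr u).
have hE t : h (cl t) = ev t by apply/evP/repr_scong.
have hB : zmod_morphism h.
  move=> u v.
  by rewrite -[RHS]/(ev (Sadd (repr u) (Sopp (repr v)))) -hE -sym_addE -sym_oppE !cl_repr.
have hM : monoid_morphism h.
  split=> [|u v]; first by rewrite -[RHS](rmorph1 f) -[RHS]/(ev (SA 1)) -hE.
  by rewrite -[RHS]/(ev (Smul (repr u) (repr v))) -hE -sym_mulE !cl_repr.
have hS : scalable h.
  move=> c u; rewrite [c *: u]/(symA c%:A * u) hM.2.
  by rewrite [h (symA _)]hE /= linearZ /= rmorph1 mulr_algl.
pose haM := GRing.isZmodMorphism.Build _ _ h hB.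
pose hmM := GRing.isMonoidMorphism.Build _ _ h hM.
pose hsM := GRing.isScalable.Build _ _ _ _ h hS.
pose hh : {lrmorphism sym -> B} := HB.pack h haM hmM hsM.
by exists hh; split=> [a|x] /=; rewrite [LHS]hE.
Qed.

End Sym.

Section Operators.
Variables (K : fieldType) (A : algType K) (gA : int -> A -> Prop).
Variables (L : lmodType A) (gL : int -> L -> Prop).
Local Notation S := (sym gA gL).
Local Notation gS := (@sym_deg K A gA L gL).
Variables (X : seq L -> L) (sg De : seq L -> A -> A).

Definition symprod (s : seq L) : S := \prod_(x <- s) symL gA gL x.

(* D k is the k-th operator, k >= 1; S (x)_A A is identified with S by
   u (x) q |-> u q. *)
Definition is_D (D : nat -> S -> S) : Prop :=
  forall k, (0 < k)%N ->
    (forall (c : K) u v, D k (c *: u + v) = c *: D k u + D k v) /\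
    forall l (d : l.-tuple int) (xi : l.-tuple L) (q : A), homs gL d xi ->
      D k (symprod xi * symA gA gL q) =
        \sum_(p in unshuffle l k (l - k))
           (symL gA gL (X (take k (permt p xi))) * symprod (drop k (permt p xi))
              * symA gA gL q) *~ koszul d p
        - \sum_(p in unshuffle l (l.+1 - k) k.-1)
           (symprod (take (l.+1 - k) (permt p xi))
              * symA gA gL (De (drop (l.+1 - k) (permt p xi)) q))
           *~ (sgn (degsum (take (l.+1 - k) (permt p d))) * koszul d p).

(* Lam s is Lambda_k(s) with k = size s *)
Record is_Lambda (Lam : seq S -> S) : Prop := {
  Lam_sym : graded_symmetric gS Lam;
  Lam_add : multiadditive Lam;
  Lam_scale : forall s1 s2 (c : K) u,
    Lam (s1 ++ c *: u :: s2) = c *: Lam (s1 ++ u :: s2);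
  Lam_deg : forall n (d : n.-tuple int) (u : n.-tuple S), homs gS d u ->
    gS (1 + degsum d) (Lam u);
  Lam_der : forall m n (d : m.-tuple int) (u : m.-tuple S)
      (e : n.-tuple int) (u' : n.-tuple S) dv v dw w,
    homs gS d u -> homs gS e u' -> gS dv v -> gS dw w ->
    Lam (u ++ v * w :: u') =
      (v * Lam (u ++ w :: u')) *~ sgn (dv * (1 + degsum d))
      + (Lam (u ++ v :: u') * w) *~ sgn (dw * degsum e);
  Lam_L : forall s, Lam (map (symL gA gL) s) = symL gA gL (X s);
  Lam_LA : forall s a,
    Lam (rcons (map (symL gA gL) s) (symA gA gL a)) = symA gA gL (sg s a);
  Lam_AA : forall s1 s2 s3 a b,
    Lam (s1 ++ symA gA gL a :: s2 ++ symA gA gL b :: s3) = 0 }.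

End Operators.

(* [F, G] for F, G of degrees dF, dG *)
Definition gcomm (V : zmodType) (dF dG : int) (F G : V -> V) (v : V) : V :=
  F (G v) - G (F v) *~ sgn (dF * dG).

(* [ .. [[F, b_1], b_2] .. , b_n], for F of degree dF and the list of the
   pairs (degree of b_i, b_i), each b_i acting by left multiplication *)
Fixpoint icomm (B : pzRingType) (dF : int) (F : B -> B) (s : seq (int * B))
    : B -> B :=
  if s is (e, b) :: s' then icomm (dF + e) (gcomm dF e F ( *%R b)) s' else F.

Section BVinfinity.
Variables (K : fieldType) (B : algType K) (gB : int -> B -> Prop).

(* degree 1 differential operator of order k *)
Definition diffop1 (k : nat) (F : B -> B) : Prop :=
  [/\ forall (c : K) u v, F (c *: u + v) = c *: F u + F v,
      forall n u, gB n u -> gB (1 + n) (F u)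
    & forall (d : (k.+1).-tuple int) (b : (k.+1).-tuple B), homs gB d b ->
        forall u, icomm 1 F (zip d b) u = 0].

(* All the axioms of a BV_infty algebra but BV_k 1 = 0. *)
Definition preBV_infty (BV : nat -> B -> B) : Prop :=
  [/\ graded_calg gB,
      forall k, (0 < k)%N -> diffop1 k (BV k)
    & forall k, (0 < k)%N -> forall u,
        \sum_(1 <= i < k) gcomm 1 1 (BV i) (BV (k - i)%N) u = 0].

Definition BV_infty (BV : nat -> B -> B) : Prop :=
  preBV_infty BV /\ forall k, (0 < k)%N -> BV k 1 = 0.

(* {b_1, .., b_k} = [ .. [[BV_k, b_1], b_2] .. , b_k] 1 for all k >= 1 *)
Definition generates (BV : nat -> B -> B) (brk : seq B -> B) : Prop :=
  forall k, (0 < k)%N -> forall (d : k.-tuple int) (b : k.-tuple B),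
    homs gB d b -> brk b = icomm 1 (BV k) (zip d b) 1.

End BVinfinity.

(* Main.v *)
(* Write D_k as an operator on S determined by the values phi_k(w) of its iterated
   commutators with words w of generators, applied to 1: for any operator D, the
   recursion D(g u) = +/- g D(u) + [D, g](u) reconstructs D from these values, and
   conversely a family phi defines an operator on S as soon as it is graded symmetric,
   additive, kills the scalars and satisfies the Leibniz rule
     phi(.., a g) = +/- a phi(.., g) +/- g phi(.., a) + phi(.., a, g),
   because then the recursion respects all the relations of S.  For D_k the values are
   X_k on words in L of length k, - Delta_k(..|1) on words in L of length k - 1, and
   sigma_k when one letter is in A; the Leibniz rule is the one of the LR structure and
   of the connection.  Since phi_k vanishes on words longer than k, D_k has order k, and
   its iterated commutators at 1 are the brackets Lambda_k on generators, hence
   everywhere as both sides are multiderivations.  Finally the sum of the D_i D_j with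
   i + j = n, evaluated on x_1 .. x_l q, splits into terms X X and X Delta which cancel
   in pairs and terms where one operator is nested in the other; these form the
   Jacobi identity (J1) and the curvature. *)
Require Import Defs.
From mathcomp Require Import all_boot all_order all_algebra.
From HB Require Import structures.
From mathcomp Require Import perm boolp zify ring.

Set Implicit Arguments.
Unset Strict Implicit.
Unset Printing Implicit Defensive.

Import GRing.Theory.
Local Open Scope ring_scope.

(** * Koszul signs *)

(** The axioms fix signs only for homogeneous arguments, and the degree is not a function of the
    element, as 0 has every degree. So computations run on words of pairs (degree, letter), and
    statements on arbitrary elements follow by additive extension. That the grading of S is direct
    is hidden by a presentation with generators and relations; it comes from an automorphism with
    distinct eigenvalues in distinct degrees, one of three uses of characteristic 0. The others are
    the factor 1/2 in the commutator with an inhomogeneous element, and that u = - u forces u = 0,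
    for the terms X X. As F(g u) involves [F, g](u), no operator can be built alone: the recursion
    carries the values for all words at once. The axiom D_k 1 = 0 can fail for k = 1, since D_1 1 =
    - Delta_1(|1): take L = 0, A = K[e] with e of degree 1 and e^2 = 0, and let Delta_1 be
    multiplication by e, which is flat. Hence this axiom is separated from the others and shown to
    be equivalent to Delta_1(|1) = 0. *)

Definition par (n : int) : bool := odd `|n|%N.

Lemma mulz_sgn (V : zmodType) (x : V) n : x *~ sgn n = if par n then - x else x.
Proof. by rewrite /sgn -signr_odd /par; case: odd; rewrite ?mulrNz. Qed.

Lemma parD m n : par (m + n) = par m (+) par n.
Proof.
rewrite /par; case: m n => m [] n; rewrite ?NegzE.
- by rewrite -PoszD !absz_nat oddD.
- rewrite abszN absz_nat; case: (leqP n.+1 m) => h.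
    by rewrite subzn // absz_nat oddB.
  by rewrite -opprB abszN subzn 1?ltnW // !absz_nat oddB 1?ltnW // addbC.
- rewrite abszN absz_nat addrC; case: (leqP m.+1 n) => h.
    by rewrite subzn // absz_nat oddB // addbC.
  by rewrite -opprB abszN subzn 1?ltnW // !absz_nat oddB 1?ltnW.
by rewrite -opprD abszN -PoszD !abszN !absz_nat oddD.
Qed.

Lemma parM m n : par (m * n) = par m && par n.
Proof. by rewrite /par abszM oddM. Qed.

Lemma parN n : par (- n) = par n.
Proof. by rewrite /par abszN. Qed.

Lemma sgnE n : sgn n = (-1) ^+ par n.
Proof. by rewrite /sgn -signr_odd. Qed.

Lemma sgnD m n : sgn (m + n) = sgn m * sgn n.
Proof. by rewrite !sgnE parD; case: par; case: par. Qed.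

Lemma par0 : par 0 = false. Proof. by []. Qed.

Lemma par1 : par 1 = true. Proof. by []. Qed.

Definition parE := (parD, parN, parM, par0, par1).

(* Reduces a goal whose terms carry Koszul signs to its sign-free instances,
   one for each choice of parities. *)
Ltac signs :=
  rewrite ?mulz_sgn ?parE;
  repeat match goal with |- context [par ?n] => case: (par n) end;
  rewrite ?(andbF, andbT, addbT, addbF) /= ?(mulNr, mulrN, opprK).

(** Plain lists of pairs (degree, letter) replace the tuples of the definitions: they can be cut,
    extended at either end and recursed on without casts. *)
Fixpoint homw (V : Type) (gr : int -> V -> Prop) (w : seq (int * V)) : Prop :=
  if w is g :: w' then gr g.1 g.2 /\ homw gr w' else True.

Definition deg (V : Type) (w : seq (int * V)) : int := degsum (unzip1 w).

Section HomogeneousWords.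
Variables (V : Type) (gr : int -> V -> Prop).
Implicit Types (v w : seq (int * V)) (g : int * V).

Lemma deg_nil : deg (Nil (int * V)) = 0.
Proof. by rewrite /deg /degsum big_nil. Qed.

Lemma deg_cons g w : deg (g :: w) = g.1 + deg w.
Proof. by rewrite /deg /degsum big_cons. Qed.

Lemma deg_cat v w : deg (v ++ w) = deg v + deg w.
Proof. by rewrite /deg /degsum /unzip1 map_cat big_cat. Qed.

Lemma deg_rcons w g : deg (rcons w g) = deg w + g.1.
Proof. by rewrite -cats1 deg_cat deg_cons deg_nil addr0. Qed.

Lemma homw_cat v w : homw gr (v ++ w) <-> homw gr v /\ homw gr w.
Proof. by elim: v => [|g v IH] /=; [tauto|rewrite IH; tauto]. Qed.

Lemma homw_rcons w g : homw gr (rcons w g) <-> homw gr w /\ gr g.1 g.2.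
Proof. by rewrite -cats1 homw_cat /=; tauto. Qed.

Lemma homs_zip n (d : n.-tuple int) (t : n.-tuple V) :
  homs gr d t -> homw gr (zip d t).
Proof.
elim: n d t => [|n IH] d t; first by rewrite (tuple0 d) (tuple0 t).
case/tupleP: d => d0 d; case/tupleP: t => t0 t h /=; split.
  by have := h ord0; rewrite !(tnth_nth d0) !(tnth_nth t0).
by apply: IH => i; have := h (lift ord0 i); rewrite !tnthS.
Qed.

Lemma homw_homs w : homw gr w ->
  homs gr (map_tuple fst (in_tuple w)) (map_tuple snd (in_tuple w)).
Proof.
move=> hw i; rewrite !tnth_map; elim: w hw i => [|g w IH] /=; first by move=> _ [].
move=> [hg hw] i; case: (unliftP ord0 i) => [j|] ->; last by rewrite !(tnth_nth g).
have := IH hw j; rewrite !(tnth_nth g) //.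
Qed.

End HomogeneousWords.

Lemma homwP (V : eqType) (gr : int -> V -> Prop) (w : seq (int * V)) :
  homw gr w <-> forall g, g \in w -> gr g.1 g.2.
Proof.
elim: w => [|h w IH] /=; first by split.
rewrite IH; split=> [[hh hw] g|H]; first by rewrite inE => /orP[/eqP->|/hw].
by split=> [|g gw]; apply: H; rewrite inE ?eqxx // gw orbT.
Qed.

(** * Reflexive decision of identities in abelian groups *)

Inductive zexp := Zvar of nat | Zadd of zexp & zexp | Zopp of zexp | Zzero.

Fixpoint zden (V : zmodType) (env : seq V) (e : zexp) : V :=
  match e with
  | Zvar i => env`_i
  | Zadd e f => zden env e + zden env f
  | Zopp e => - zden env e
  | Zzero => 0
  end.

Fixpoint zcoef (i : nat) (e : zexp) : int :=
  match e with
  | Zvar j => (i == j)%:R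
  | Zadd e f => zcoef i e + zcoef i f
  | Zopp e => - zcoef i e
  | Zzero => 0
  end.

Lemma zden_coef (V : zmodType) (env : seq V) e :
  zden env e = \sum_(i < size env) env`_i *~ zcoef i e.
Proof.
elim: e => [j|e IHe f IHf|e IH|] /=.
- case: (ltnP j (size env)) => lt.
    rewrite (bigD1 (Ordinal lt)) //= eqxx mulr1z big1 ?addr0 // => i.
    by rewrite -val_eqE /= => /negbTE ->; rewrite mulr0z.
  rewrite nth_default // big1 // => i _; case: eqP => [ij|]; last by rewrite mulr0z.
  by move: (ltn_ord i); rewrite ij ltnNge lt.
- by rewrite IHe IHf -big_split; apply: eq_bigr => i _; rewrite mulrzDr.
- by rewrite IH -sumrN; apply: eq_bigr => i _; rewrite mulrNz.
- by rewrite big1 // => i _; rewrite mulr0z.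
Qed.

(** The integer coefficients of the atoms decide the identity. Only indices below [size env] are
    compared: larger ones denote 0, the default of the lookup. *)
Lemma zden_eq (V : zmodType) (env : seq V) e f :
  all (fun i => zcoef i e == zcoef i f) (iota 0 (size env)) -> zden env e = zden env f.
Proof.
move/allP => h; rewrite !zden_coef; apply: eq_bigr => i _.
by rewrite (eqP (h i _)) // mem_iota /=.
Qed.

(* Syntactic comparison up to the ring instances: generic rewrite rules leave the
   same product in S with different, convertible, instances. *)
Ltac zmod_same x y :=
  lazymatch constr:((x, y)) with
  | (?z, ?z) => constr:(true)
  | (@GRing.mul _ ?a ?b, @GRing.mul _ ?c ?d) =>
      lazymatch zmod_same a c with true => zmod_same b d | false => constr:(false) end
  | (@intmul _ ?a ?n, @intmul _ ?c ?n) => zmod_same a c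
  | (@GRing.scale _ _ ?a ?x, @GRing.scale _ _ ?a ?y) => zmod_same x y
  | (?f ?a, ?f ?c) => zmod_same a c
  | _ => constr:(false)
  end.

Ltac zmod_find x env n :=
  lazymatch env with
  | cons ?y ?env' =>
      lazymatch zmod_same x y with true => n | false => zmod_find x env' (S n) end
  end.

Ltac zmod_mem x env :=
  lazymatch env with
  | cons ?y ?env' =>
      lazymatch zmod_same x y with true => constr:(true) | false => zmod_mem x env' end
  | _ => constr:(false)
  end.

Ltac zmod_atoms e env :=
  lazymatch e with
  | @GRing.add _ ?x ?y => let env' := zmod_atoms x env in zmod_atoms y env'
  | @GRing.opp _ ?x => zmod_atoms x env
  | @GRing.zero _ => env
  | ?x => lazymatch zmod_mem x env with true => env | false => constr:(cons x env) end
  end.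

Ltac zmod_reify e env :=
  lazymatch e with
  | @GRing.add _ ?x ?y =>
      let x' := zmod_reify x env in let y' := zmod_reify y env in constr:(Zadd x' y')
  | @GRing.opp _ ?x => let x' := zmod_reify x env in constr:(Zopp x')
  | @GRing.zero _ => constr:(Zzero)
  | ?x => let n := zmod_find x env O in constr:(Zvar n)
  end.

(* Decides equations between sums of signed atoms in an additive group. *)
Ltac zmod :=
  lazymatch goal with
  | |- @eq ?T ?x ?y =>
      let env0 := zmod_atoms x (@nil T) in
      let env := zmod_atoms y env0 in
      let ex := zmod_reify x env in
      let ey := zmod_reify y env in
      apply: (@zden_eq _ env ex ey); vm_compute; reflexivity
  end.

(** * Gradings *)

Section Grading.
Variables (V : zmodType) (gr : int -> V -> Prop).
Hypothesis hgr : is_grading gr.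

Lemma grN n x : gr n x -> gr n (- x).
Proof. by move=> hx; rewrite -[- x]add0r; apply: gradingB => //; apply: grading0. Qed.

Lemma grD n x y : gr n x -> gr n y -> gr n (x + y).
Proof. by move=> hx hy; rewrite -[y]opprK; apply: gradingB => //; apply: grN. Qed.

Lemma gr_sum n (I : eqType) (r : seq I) (P : pred I) (F : I -> V) :
  (forall i, i \in r -> P i -> gr n (F i)) -> gr n (\sum_(i <- r | P i) F i).
Proof.
move=> h; rewrite big_seq_cond; apply: big_ind => [|x y|i /andP[]].
- exact: grading0.
- exact: grD.
- exact: h.
Qed.

Lemma gr_sgn n x m : gr n x -> gr n (x *~ sgn m).
Proof. by move=> hx; rewrite mulz_sgn; case: par => //; apply: grN. Qed.

Lemma dec_ex x : exists w : seq (int * V), homw gr w /\ x = \sum_(g <- w) g.2.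
Proof.
have [m [d [v [h ->]]]] := grading_span hgr x.
exists (zip d v); split; first exact: homs_zip.
by rewrite -(big_map snd xpredT id) -/(unzip2 _) unzip2_zip ?size_tuple.
Qed.

(** The choice is not canonical: a degree may occur several times. [ext_eq] shows that extensions do
    not depend on it. *)
Definition dec x : seq (int * V) := sval (cid (dec_ex x)).

Lemma homw_dec x : homw gr (dec x).
Proof. by rewrite /dec; case: cid => w []. Qed.

Lemma dec_sum x : x = \sum_(g <- dec x) g.2.
Proof. by rewrite {1}/dec; case: cid => w []. Qed.

Lemma hom_ind (P : V -> Prop) :
  (forall n x, gr n x -> P x) -> (forall x y, P x -> P y -> P (x + y)) ->
  forall x, P x.
Proof.
move=> hP hD x; rewrite (dec_sum x); elim: (dec x) (homw_dec x) => [_|g w IH [hg hw]].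
  by rewrite big_nil; apply: hP (0 : int) _ _; apply: grading0.
by rewrite big_cons; apply: hD; [apply: hP hg|apply: IH].
Qed.

Section Extension.
Variables (M : zmodType) (f : int -> V -> M).
Hypothesis fD : forall n x y, gr n x -> gr n y -> f n (x + y) = f n x + f n y.

Lemma hom_add0 n : f n 0 = 0.
Proof.
have h := grading0 hgr n.
by apply: (addrI (f n 0)); rewrite -fD // !addr0.
Qed.

Lemma hom_addN n x : gr n x -> f n (- x) = - f n x.
Proof.
move=> hx; apply/eqP; rewrite -addr_eq0 -fD ?addNr ?hom_add0 //.
exact: grN.
Qed.

Lemma hom_add_sum n (I : eqType) (r : seq I) (P : pred I) (F : I -> V) :
  (forall i, i \in r -> P i -> gr n (F i)) ->
  f n (\sum_(i <- r | P i) F i) = \sum_(i <- r | P i) f n (F i).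
Proof.
elim: r => [|i r IH] h; first by rewrite !big_nil hom_add0.
have hr j : j \in r -> P j -> gr n (F j) by move=> jr; apply: h; rewrite inE jr orbT.
rewrite !big_cons; case: ifP => Pi; last exact: IH.
by rewrite fD ?IH //; [apply: h; rewrite ?mem_head|apply: gr_sum].
Qed.

(** Directness of the grading kills the sum of the letters of each degree n separately, and [f n] is
    additive on these. *)
Lemma ext_sum0 (w : seq (int * V)) : homw gr w -> \sum_(g <- w) g.2 = 0 ->
  \sum_(g <- w) f g.1 g.2 = 0.
Proof.
move=> hw w0.
(* Grouping by degree is needed in two groups, for the images under [f] and for the relation in [V]
   itself; hence the arbitrary [N]. *)
have part (N : zmodType) (F : int * V -> N) : \sum_(g <- w) F g =
    \sum_(n <- undup (unzip1 w)) \sum_(g <- w | g.1 == n) F g.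
  rewrite (exchange_big_dep xpredT) //= big_seq [RHS]big_seq; apply: eq_bigr => g gw.
  rewrite -big_filter (_ : filter _ _ = [:: g.1]) ?big_seq1 //.
  rewrite (eq_filter (a2 := pred1 g.1)) => [|n]; last exact: eq_sym.
  by rewrite filter_pred1_uniq ?undup_uniq // mem_undup map_f.
rewrite part big_seq big1 // => n nw.
have hn i : i \in w -> i.1 == n -> gr n i.2 by move=> iw /eqP <-; apply: (homwP _ _).1 iw.
rewrite (eq_bigr (fun g => f n g.2)) => [|g /eqP -> //].
rewrite -hom_add_sum //; rewrite part in w0.
rewrite (grading_direct hgr (undup_uniq _) _ w0) ?hom_add0 // => m.
by apply: gr_sum => g gw /eqP <-; apply: (homwP _ _).1 gw.
Qed.

Definition ext x : M := \sum_(g <- dec x) f g.1 g.2.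

Lemma ext_eq (w : seq (int * V)) x : homw gr w -> x = \sum_(g <- w) g.2 ->
  ext x = \sum_(g <- w) f g.1 g.2.
Proof.
move=> hw xw; apply/eqP; rewrite -subr_eq0; apply/eqP.
pose w' := [seq (g.1, - g.2) | g <- w].
have hw' : homw gr w'.
  by rewrite {}/w'; elim: w hw {xw} => //= g w IH [hg hw]; split; [apply: grN|apply: IH].
have := @ext_sum0 (dec x ++ w').
rewrite !big_cat /= !big_map /= !sumrN -dec_sum -xw subrr.
rewrite -/(ext x) [X in _ + X]big_seq (eq_bigr (fun g => - f g.1 g.2)); last first.
  by move=> g gw; apply: hom_addN; apply: (homwP _ _).1 gw.
rewrite -big_seq sumrN; apply=> //; apply/homw_cat; split=> //; exact: homw_dec.
Qed.

Lemma ext_hom n x : gr n x -> ext x = f n x.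
Proof.
by move=> hx; rewrite (@ext_eq [:: (n, x)]) ?big_seq1 //=; split.
Qed.

Lemma extD x y : ext (x + y) = ext x + ext y.
Proof.
rewrite (@ext_eq (dec x ++ dec y)) ?big_cat //=.
  by apply/homw_cat; split; apply: homw_dec.
by rewrite {1}(dec_sum x) {1}(dec_sum y).
Qed.
End Extension.

End Grading.

Section MultiadditiveExtensionality.
Variables (V : zmodType) (gr : int -> V -> Prop) (hgr : is_grading gr).
Variables (W : zmodType) (f : seq V -> W).
Hypothesis fadd : multiadditive f.

(** Keeping [s1] and [s2] lets the induction push homogeneous arguments into [s1], and lets several
    blocks of one argument list be reduced one after another. *)
Lemma multiadditive_hom_eq0 s1 s2 n :
  (forall w, homw gr w -> size w = n -> f (s1 ++ unzip2 w ++ s2) = 0) ->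
  forall s, size s = n -> f (s1 ++ s ++ s2) = 0.
Proof.
elim: n s1 => [|n IH] s1 h s; first by move/size0nil->; apply: (h [::]).
case: s => [//|x s] [sz].
elim/(hom_ind hgr): x => [m x hx|x y hx hy]; last by rewrite /= fadd hx hy addr0.
rewrite /= -cat_rcons; apply: IH => // w hw wn.
by rewrite cat_rcons; apply: (h ((m, x) :: w)) => //=; rewrite wn.
Qed.
End MultiadditiveExtensionality.

Lemma multiadditive0 (V W : zmodType) (f : seq V -> W) s1 s2 :
  multiadditive f -> f (s1 ++ 0 :: s2) = 0.
Proof. by move=> h; apply: (addrI (f (s1 ++ 0 :: s2))); rewrite -h !addr0. Qed.

(** * Koszul signs of permutations *)

(* koszul for a permutation given as a list of pairs (index, degree). *)
Fixpoint kz (t : seq (nat * int)) : int :=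
  if t is x :: t' then (\prod_(y <- t' | (y.1 < x.1)%N) sgn (x.2 * y.2)) * kz t' else 1.

Lemma kz_enum n (F : 'I_n -> nat * int) :
  kz [seq F i | i <- enum 'I_n] =
  \prod_(i < n) \prod_(j < n | (i < j)%N && ((F j).1 < (F i).1)%N)
     sgn ((F i).2 * (F j).2).
Proof.
elim: n F => [|n IH] F; first by rewrite enum_ord0 /= big_ord0.
rewrite enum_ordSl /= big_ord_recl -map_comp IH; congr (_ * _).
  rewrite big_map big_enum_cond /= [RHS]big_mkcond big_ord_recl /= mul1r -big_mkcond.
  exact: eq_bigl.
apply: eq_bigr => i _; rewrite [RHS]big_mkcond big_ord_recl /= mul1r -big_mkcond /=.
exact: eq_bigl.
Qed.

Lemma koszul_kz n (d : n.-tuple int) (p : 'S_n) :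
  koszul d p = kz [seq (val (p i), tnth d (p i)) | i <- enum 'I_n].
Proof. by rewrite kz_enum. Qed.

(** Graded symmetry tested on adjacent letters only. Unlike in [graded_symmetric], [f] may use the
    degrees, as [tau] and [phi] do. *)
Definition swapw (V : Type) (gr : int -> V -> Prop) (M : zmodType)
    (f : seq (int * V) -> M) : Prop :=
  forall w1 g h w2, homw gr (w1 ++ g :: h :: w2) ->
    f (w1 ++ g :: h :: w2) = f (w1 ++ h :: g :: w2) *~ sgn (g.1 * h.1).

Section Symmetry.
Variables (V : eqType) (gr : int -> V -> Prop) (M : zmodType).

Lemma graded_symmetric_swap (f : seq V -> M) :
  graded_symmetric gr f -> swapw gr (fun w => f (unzip2 w)).
Proof.
move=> fs w1 g h w2 hw.
pose s := w1 ++ h :: g :: w2.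
have hs : homw gr s by move: hw; rewrite /s !homw_cat /=; tauto.
have lt1 : (size w1 < size s)%N by rewrite /s size_cat /= -addSnnS leq_addr.
have lt2 : ((size w1).+1 < size s)%N by rewrite /s size_cat /= -!addSnnS leq_addr.
pose i0 := Ordinal lt1; pose j0 := Ordinal lt2.
have := fs _ _ _ (tperm i0 j0) (homw_homs hs).
set v := map_tuple snd _; set d := map_tuple fst _ => fE.
have -> : unzip2 (w1 ++ g :: h :: w2) = permt (tperm i0 j0) v :> seq V.
  have sz : size (unzip2 (w1 ++ g :: h :: w2)) = size s.
    by rewrite size_map /s !size_cat /=.
  apply: (@eq_from_nth _ g.2); rewrite ?size_tuple // => i; rewrite sz => lti.
  rewrite -[i]/(val (Ordinal lti)) -tnth_nth tnth_mktuple tnth_map (tnth_nth g).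
  rewrite (nth_map g) ?size_cat /=; last by move: lti; rewrite /s size_cat.
  congr (_.2); case: tpermP => [[->]|[->]|n1 n2] /=; rewrite /s !nth_cat ?ltnn ?subnn //=.
    by rewrite ltnNge leqnSn /= subSnn.
    by rewrite ltnNge leqnSn /= subSnn.
  case: ltnP => // le; case: i lti n1 n2 le => [|i] lti n1 n2 le.
    by case: n1; apply: val_inj => /=; move: le; rewrite leqn0 => /eqP.
  case: (eqVneq i.+1 (size w1)) => [e|ne]; first by case: n1; apply: val_inj.
  case: (eqVneq i (size w1)) => [e|ne']; first by case: n2; apply: val_inj; rewrite /= e.
  have {}le : (size w1 < i)%N.
    by rewrite ltn_neqAle eq_sym ne' -ltnS ltn_neqAle eq_sym ne.
  by case: i le {lti n1 n2 ne ne'} => // i le; rewrite !subSn // ltnW.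
rewrite fE; congr (_ *~ _).
(* A transposition of neighbours has the single inversion (i0, j0), so one factor of the Koszul sign
   remains. *)
rewrite /koszul pair_big_dep /= (big_pred1 (i0, j0)) /= => [|[i j] /=].
  rewrite tpermL tpermR !tnth_map !(tnth_nth g) /= /s !nth_cat ltnn subnn /=.
  by rewrite ltnNge leqnSn /= subSnn.
rewrite xpair_eqE -!val_eqE /=.
case: tpermP => [->|->|/eqP + /eqP]; case: tpermP => [->|->|/eqP + /eqP];
  rewrite -?val_eqE /=; lia.
Qed.

Lemma swapw_move (f : seq (int * V) -> M) v x a b :
  swapw gr f -> homw gr (v ++ x :: a ++ b) ->
  f (v ++ x :: a ++ b) = f (v ++ a ++ x :: b) *~ \prod_(y <- a) sgn (x.1 * y.1).
Proof.
move=> fs; elim: a v => [|y a IH] v h; first by rewrite big_nil.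
rewrite big_cons mulrC mulrzA /= fs // -cat_rcons IH ?cat_rcons //.
by move: h; rewrite /= !homw_cat /= !homw_cat; tauto.
Qed.

Lemma swapw_rcons (f : seq (int * V) -> M) x a :
  swapw gr f -> homw gr (x :: a) -> f (rcons a x) = f (x :: a) *~ sgn (x.1 * deg a).
Proof.
move=> fs h; have := @swapw_move f [::] x a [::] fs; rewrite cats0 /= cats1 => -> //.
have -> : \prod_(y <- a) sgn (x.1 * y.1) = sgn (x.1 * deg a).
  elim: a {h} => [|y a IH]; first by rewrite big_nil deg_nil mulr0.
  by rewrite big_cons IH deg_cons mulrDr sgnD.
by signs.
Qed.

(** The tail is sorted first; the head [x] then moves past the letters [a] that precede it in [t'].
    These are the letters of the tail with smaller index, so the sign is the factor of [x] in
    [kz]. *)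
Lemma swapw_sort (f : seq (int * V) -> M) (t t' : seq (nat * (int * V))) v :
  swapw gr f -> homw gr (v ++ unzip2 t) ->
  sorted ltn (unzip1 t') -> perm_eq t t' ->
  f (v ++ unzip2 t) = f (v ++ unzip2 t') *~ kz [seq (x.1, x.2.1) | x <- t].
Proof.
move=> fs; elim: t t' v => [|x t IH] t' v h st pt.
  by move: pt; rewrite perm_sym => /perm_nilP ->.
have xt' : x \in t' by rewrite -(perm_mem pt) mem_head.
case/splitPr: t' / xt' st pt => [a b] st pt.
have {}pt : perm_eq t (a ++ b).
  by rewrite -(perm_cons x) (perm_trans pt) // -cat1s perm_catCA.
have st' : sorted ltn (unzip1 (a ++ b)).
  move: st; rewrite /unzip1 !map_cat /=; apply: subseq_sorted => //.
    by move=> ? ? ?; apply: ltn_trans.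
  by apply: cat_subseq => //; apply: subseq_cons.
have := st; rewrite /unzip1 map_cat /= (sorted_pairwise) ?pairwise_cat /=; last first.
  by move=> ? ? ?; apply: ltn_trans.
rewrite allrel_consr => /and3P[/andP[ax _] _ /andP[xb _]].
rewrite /= -cat_rcons (IH _ _ _ st' pt) ?cat_rcons //.
rewrite /unzip2 !map_cat (@swapw_move f v x.2 (unzip2 a) (unzip2 b) fs); last first.
  move: h; rewrite /= !homw_cat /= => -[hv [hx ht]]; do 2!split=> //.
  rewrite -map_cat; apply/homwP => g; rewrite -(perm_mem (perm_map _ pt)).
  exact: (homwP _ _).1 ht _.
rewrite /= -mulrzA; congr (_ *~ (_ * _)).
rewrite big_map (perm_big _ pt) big_cat /= [X in _ * X]big1_seq ?mulr1.
  rewrite big_map big_seq_cond [RHS]big_seq_cond; apply: eq_bigl => y /=.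
  rewrite andbT; case ya: (y \in a) => //=; symmetry.
  by move/allP: ax; apply; rewrite map_f.
move=> y /andP[/= yx yb]; move/allP: xb => /(_ y.1); rewrite map_f //.
by move=> /(_ isT) /(ltn_trans yx); rewrite ltnn.
Qed.

(** Each letter is labelled by its position, so that undoing [p] becomes the sorting problem of
    [swapw_sort]. *)
Lemma swapw_symmetric (f : seq V -> M) :
  swapw gr (fun w => f (unzip2 w)) -> graded_symmetric gr f.
Proof.
move=> fs n d v p hv.
pose F (i : 'I_n) := (val i, (tnth d i, tnth v i)).
have E (q : 'S_n) : unzip2 (unzip2 [seq F (q i) | i <- enum 'I_n]) = permt q v.
  have perE : permt q v = [seq tnth v (q i) | i <- enum 'I_n] :> seq V by [].
  by rewrite perE /unzip2 -!map_comp.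
have hq (q : 'S_n) : homw gr (unzip2 [seq F (q i) | i <- enum 'I_n]).
  by elim: (enum _) => //= i s IH; split=> //; apply: hv.
have := @swapw_sort _ [seq F (p i) | i <- enum 'I_n] [seq F ((1%g : 'S_n) i) | i <- enum 'I_n]
  [::] fs (hq p).
rewrite !cat0s !E -map_comp => ->; first last.
- apply: (@perm_trans _ [seq F (p ((p^-1)%g i)) | i <- enum 'I_n]).
    have -> : [seq F (p ((p^-1)%g i)) | i <- enum 'I_n] =
       [seq F (p i) | i <- [seq (p^-1)%g i | i <- enum 'I_n]] by rewrite -map_comp.
    apply: perm_map; apply: uniq_perm; rewrite ?enum_uniq //.
      by rewrite map_inj_uniq ?enum_uniq //; apply: perm_inj.
    move=> i; rewrite mem_enum; symmetry; apply/mapP; exists (p i); rewrite ?mem_enum //.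
    by rewrite permK.
  by rewrite (eq_map (g := fun i => F ((1%g : 'S_n) i))) // => i; rewrite permKV perm1.
- rewrite /unzip1 -map_comp (eq_map (g := val)) => [|i]; last by rewrite /= perm1.
  by rewrite val_enum_ord iota_ltn_sorted.
rewrite koszul_kz -map_comp; congr (f _ *~ _).
by congr tval; apply: eq_from_tnth => i; rewrite tnth_mktuple perm1.
Qed.
End Symmetry.

(** * Sums over unshuffles *)

(* The sum of f over all unshuffles of w with Koszul signs (see unshuffle_spl), in a
   form suited to induction on w. *)
Fixpoint spl (V : Type) (M : zmodType) (f : seq (int * V) -> seq (int * V) -> M)
    (w : seq (int * V)) : M :=
  if w is g :: w' then
    spl (fun a b => f (g :: a) b) w'
    + spl (fun a b => f a (g :: b) *~ sgn (g.1 * deg a)) w'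
  else f [::] [::].

Section Splits.
Variables (V : Type) (M : zmodType).
Notation word := (seq (int * V)).
Implicit Types (w : word) (f g : word -> word -> M).

Lemma spl_hom_eq (gr : int -> V -> Prop) f g w :
  (forall a b, homw gr a -> homw gr b -> (size a + size b)%N = size w ->
     deg a + deg b = deg w -> f a b = g a b) ->
  homw gr w -> spl f w = spl g w.
Proof.
elim: w f g => [|x w IH] f g h /=; first by move=> _; apply: h; rewrite ?deg_nil.
move=> [hx hw]; congr (_ + _); apply: IH => // a b ha hb sz dg.
  by apply: h => //=; rewrite ?addSn ?sz // !deg_cons -addrA dg.
by rewrite h //= ?addnS ?sz // !deg_cons -dg addrCA.
Qed.

Lemma eq_spl f g w : (forall a b, (size a + size b)%N = size w ->
     deg a + deg b = deg w -> f a b = g a b) -> spl f w = spl g w.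
Proof.
move=> h; apply: (@spl_hom_eq (fun _ _ => True)) => [a b _ _|]; first exact: h.
by elim: w {h}.
Qed.

Lemma splD f g w : spl (fun a b => f a b + g a b) w = spl f w + spl g w.
Proof.
elim: w f g => //= x w IH f g; rewrite !IH addrACA; congr (_ + _).
by rewrite -IH; apply: eq_spl => a b _ _; rewrite mulrzDl.
Qed.

Lemma splN f w : spl (fun a b => - f a b) w = - spl f w.
Proof.
elim: w f => //= x w IH f; rewrite !IH opprD; congr (_ + _).
by rewrite -IH; apply: eq_spl => a b _ _; rewrite mulNrz.
Qed.

Lemma spl_sgn f w n : spl (fun a b => f a b *~ sgn n) w = spl f w *~ sgn n.
Proof.
rewrite mulz_sgn; case E: (par n); rewrite -?splN; apply: eq_spl => a b _ _;
  by rewrite mulz_sgn E.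
Qed.

Lemma spl0 w : spl (fun _ _ => 0 : M) w = 0.
Proof. by elim: w => //= x w IH; rewrite IH add0r -[RHS]IH; apply: eq_spl => *; rewrite mul0rz. Qed.

Lemma spl_sum (I : Type) (r : seq I) (F : I -> word -> word -> M) w :
  spl (fun a b => \sum_(i <- r) F i a b) w = \sum_(i <- r) spl (F i) w.
Proof.
elim: r => [|i r IH].
  by rewrite big_nil -[RHS](spl0 w); apply: eq_spl => *; rewrite big_nil.
by rewrite big_cons -IH -splD; apply: eq_spl => *; rewrite big_cons.
Qed.

(** Graded cocommutativity of the unshuffle coproduct. *)
Lemma spl_swap f w : spl f w = spl (fun a b => f b a *~ sgn (deg a * deg b)) w.
Proof.
elim: w f => [|x w IH] f /=; first by rewrite deg_nil mul0r mulr1z.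
rewrite addrC; congr (_ + _); rewrite IH; apply: eq_spl => a b _ _;
  by rewrite !deg_cons; signs.
Qed.

(** Coassociativity of the unshuffle coproduct: both sides run over the splittings into three
    subwords [c], [d], [b], and both nested signs are that of bringing [w] into the order c d b. *)
Lemma spl_assoc (f : word -> word -> word -> M) w :
  spl (fun a b => spl (fun c d => f c d b) a) w =
  spl (fun c e => spl (fun d b => f c d b) e) w.
Proof.
elim: w f => //= x w IH f; rewrite splD.
have -> : spl (fun a b => spl (fun c d => f (x :: c) d b) a) w =
  spl (fun c e => spl (fun d b => f (x :: c) d b) e) w by rewrite IH.
have -> : spl (fun a b => spl (fun c d => f c (x :: d) b *~ sgn (x.1 * deg c)) a) w =
  spl (fun c e => spl (fun d b => f c (x :: d) b) e *~ sgn (x.1 * deg c)) w.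
  by rewrite IH; apply: eq_spl => c e _ _; rewrite spl_sgn.
have -> : spl (fun a b => spl (fun c d => f c d (x :: b)) a *~ sgn (x.1 * deg a)) w =
  spl (fun c e => spl (fun d b => f c d (x :: b) *~ sgn (x.1 * deg d)) e
         *~ sgn (x.1 * deg c)) w.
  transitivity (spl (fun a b =>
      spl (fun c d => f c d (x :: b) *~ sgn (x.1 * (deg c + deg d))) a) w).
    apply: eq_spl => a b _ _; rewrite -spl_sgn; apply: eq_spl => c d _ dg.
    by rewrite dg.
  rewrite IH; apply: eq_spl => c e _ _; rewrite -spl_sgn; apply: eq_spl => d b _ _.
  by signs.
rewrite -addrA; congr (_ + _); rewrite -splD; apply: eq_spl => c e _ _.
by rewrite -mulrzDl.
Qed.
End Splits.

Lemma raddf_spl (V : Type) (M N : zmodType) (h : {additive M -> N})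
  (f : seq (int * V) -> seq (int * V) -> M) w :
  h (spl f w) = spl (fun a b => h (f a b)) w.
Proof.
elim: w f => //= x w IH f; rewrite raddfD !IH; congr (_ + _).
by apply: eq_spl => a b _ _; rewrite raddfMz.
Qed.

Lemma mulr_spll (V : Type) (R : pzRingType) (f : seq (int * V) -> seq (int * V) -> R) w u :
  u * spl f w = spl (fun a b => u * f a b) w.
Proof.
elim: w f => //= x w IH f; rewrite mulrDr !IH; congr (_ + _).
by apply: eq_spl => a b _ _; rewrite mulrzAr.
Qed.

Lemma mulr_splr (V : Type) (R : pzRingType) (f : seq (int * V) -> seq (int * V) -> R) w u :
  spl f w * u = spl (fun a b => f a b * u) w.
Proof.
elim: w f => //= x w IH f; rewrite mulrDl !IH; congr (_ + _).
by apply: eq_spl => a b _ _; rewrite mulrzAl.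
Qed.

(** * Unshuffles as bit masks *)

Fixpoint masks n : seq bitseq :=
  if n is n'.+1 then [seq true :: m | m <- masks n'] ++ [seq false :: m | m <- masks n']
  else [:: [::]].

(** The sign of moving the marked letters to the front: every unmarked letter is passed by the
    marked letters to its right. *)
Fixpoint msgn (V : Type) (m : bitseq) (w : seq (int * V)) : int :=
  match m, w with
  | b :: m', g :: w' => (if b then 1 else sgn (g.1 * deg (mask m' w'))) * msgn m' w'
  | _, _ => 1
  end.

Lemma mem_masks n m : (m \in masks n) = (size m == n).
Proof.
elim: n m => [|n IH] m /=; first by rewrite inE; case: m.
have no b m' : (b :: m' \in [seq ~~ b :: x | x <- masks n]) = false.
  by apply/negP => /mapP[x _ []]; case: b.
rewrite mem_cat; case: m => [|b m] /=; first by apply/negP => /orP[] /mapP[].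
rewrite eqSS -IH; case: b; rewrite mem_map; try by move=> ? ? [].
  by have := no true m => /= ->; rewrite orbF.
by have := no false m => /= ->.
Qed.

Lemma masks_uniq n : uniq (masks n).
Proof.
elim: n => //= n IH; have inj b : injective (cons b : bitseq -> bitseq) by move=> ? ? [].
rewrite cat_uniq (map_inj_uniq (inj true)) (map_inj_uniq (inj false)) IH /= andbT.
by apply/hasPn => x /mapP[m _ ->]; apply/negP => /mapP[].
Qed.

Lemma spl_masks (V : Type) (M : zmodType) (f : seq (int * V) -> seq (int * V) -> M) w :
  spl f w = \sum_(m <- masks (size w))
    f (mask m w) (mask (map negb m) w) *~ msgn m w.
Proof.
elim: w f => [|x w IH] f /=; first by rewrite big_seq1.
rewrite big_cat !big_map /= !IH; congr (_ + _); apply: eq_bigr => m _.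
  by rewrite mul1r.
by rewrite mulrzA.
Qed.

(** After the rearrangement both blocks are increasing, so the only inversions pair a marked letter
    with an unmarked one of smaller index. *)
Lemma kz_mask (V : eqType) (t : seq (nat * (int * V))) m :
  sorted ltn (unzip1 t) -> size m = size t ->
  kz [seq (x.1, x.2.1) | x <- mask m t ++ mask (map negb m) t] = msgn m (unzip2 t).
Proof.
elim: t m => [|x t IH] [|b m] //= st [sz].
have all_lt : all (ltn x.1) (unzip1 t).
  by apply: order_path_min st => ? ? ?; apply: ltn_trans.
have {}IH := IH _ (path_sorted st) sz.
have lt_mask m' : all (fun y => (x.1 < y.1)%N) (mask m' t).
  move: all_lt; rewrite /unzip1 all_map.
  by elim: (t) m' => [|y s IHs] [|[] m'] //= /andP[h /IHs {}IHs]; rewrite ?h IHs.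
case: b => /=.
  rewrite IH; congr (_ * _); rewrite big1_seq // => y /andP[/=].
  rewrite map_cat mem_cat => lt /orP[] /mapP[z zin yz]; move: lt; rewrite {}yz /=;
  by have /= := allP (lt_mask _) _ zin; move=> /ltnW; rewrite leqNgt => /negP.
rewrite -IH map_cat /= [in RHS]map_cat.
have -> : deg (mask m (unzip2 t)) = \sum_(y <- mask m t) y.2.1.
  by rewrite /deg /degsum /unzip2 -map_mask big_map big_map.
elim: (mask m t) (lt_mask m) => [|y s IHs] /=.
  rewrite big_nil mulr0 => _; congr (_ * _); rewrite big1_seq // => y /andP[/= lt].
  case/mapP=> z zin yz; move: lt; rewrite {}yz /=.
  by have /= := allP (lt_mask _) _ zin; move=> /ltnW; rewrite leqNgt => /negP.
case/andP => xy /IHs {}IHs; rewrite IHs big_cons mulrDr sgnD.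
rewrite !big_cat /= big_cons xy /= (mulrC y.2.1) -!mulrA; ring.
Qed.

Lemma perm_mask_negb (T : eqType) (m : bitseq) (s : seq T) : size m = size s ->
  perm_eq (mask m s ++ mask (map negb m) s) s.
Proof.
elim: s m => [|x s IH] [|[] m] //= [sz]; rewrite ?perm_cons ?IH //.
by rewrite (perm_catCA (mask m s) [:: x]) perm_cons IH.
Qed.

Section Unshuffles.
Variables (n : nat).
Implicit Types (p : 'S_n).

Let le_trans : transitive (relpre (@nat_of_ord n) ltn).
Proof. by move=> ? ? ?; apply: ltn_trans. Qed.

Let le_irr : irreflexive (relpre (@nat_of_ord n) ltn).
Proof. by move=> ?; apply: ltnn. Qed.

Lemma enum_ord_sorted : sorted (relpre (@nat_of_ord n) ltn) (enum 'I_n).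
Proof. by rewrite -sorted_map val_enum_ord iota_ltn_sorted. Qed.

(** Letter k is marked when [p] takes it into the first block: in [permt p t] it stands at the
    position given by the preimage of k. *)
Definition pmask (i : nat) p : bitseq :=
  [seq ((p^-1)%g k < i)%N | k <- enum 'I_n].

Lemma mem_take_enum i (k : 'I_n) : (k \in take i (enum 'I_n)) = (k < i)%N.
Proof.
case: (ltnP i n) => [lt|le].
  rewrite -(mem_map val_inj) map_take val_enum_ord take_iota mem_iota /=.
  by rewrite add0n (minn_idPl (ltnW lt)).
by rewrite take_oversize ?size_enum_ord // mem_enum (leq_trans (ltn_ord k) le).
Qed.

Lemma mem_drop_enum i (k : 'I_n) : (k \in drop i (enum 'I_n)) = (i <= k)%N.
Proof.
case: (ltnP i n) => [lt|le].
  rewrite -(mem_map val_inj) map_drop val_enum_ord drop_iota mem_iota /=.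
  by rewrite add0n subnKC ?(ltnW lt) // ltn_ord andbT.
by rewrite drop_oversize ?size_enum_ord // in_nil leqNgt (leq_trans (ltn_ord k) le).
Qed.

Lemma unshuffleP i j p : (i + j = n)%N -> reflect
  (forall a b : 'I_n, (a < b)%N -> (b < i)%N || (i <= a)%N -> (p a < p b)%N)
  (p \in unshuffle n i j).
Proof.
move=> ij; rewrite inE ij eqxx /=; apply: (iffP forallP) => h a.
  by move=> b ab hb; have /forallP/(_ b) := h a; rewrite ab hb => /implyP; apply.
by apply/forallP => b; apply/implyP => /andP[ab hb]; apply: h.
Qed.

Lemma sorted_perm (s : seq 'I_n) p : sorted (relpre (@nat_of_ord n) ltn) s ->
  {in s &, forall a b : 'I_n, (a < b)%N -> (p a < p b)%N} ->
  sorted (relpre (@nat_of_ord n) ltn) [seq p a | a <- s].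
Proof.
move=> st h; rewrite sorted_map; apply: (sub_in_sorted (P := mem s)) st; last exact/allP.
by move=> a b ha hb /=; apply: h.
Qed.

(** Both sides are increasing lists with the same elements. *)
Lemma unshuffle_take i j p : (i + j = n)%N -> p \in unshuffle n i j ->
  [seq p k | k <- take i (enum 'I_n)] = mask (pmask i p) (enum 'I_n).
Proof.
move=> ij /(unshuffleP _ ij) h; rewrite /pmask -filter_mask.
apply: (irr_sorted_eq le_trans le_irr).
- apply: sorted_perm; first by apply: take_sorted; apply: enum_ord_sorted.
  by move=> a b; rewrite !mem_take_enum => ha hb ab; apply: h; rewrite ?hb.
- by apply: sorted_filter => //; apply: enum_ord_sorted.
move=> k; rewrite mem_filter mem_enum andbT.
by rewrite -[in LHS](permKV p k) mem_map ?mem_take_enum //; apply: perm_inj.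
Qed.

Lemma unshuffle_drop i j p : (i + j = n)%N -> p \in unshuffle n i j ->
  [seq p k | k <- drop i (enum 'I_n)] = mask (map negb (pmask i p)) (enum 'I_n).
Proof.
move=> ij /(unshuffleP _ ij) h; rewrite /pmask -map_comp -filter_mask.
apply: (irr_sorted_eq le_trans le_irr).
- apply: sorted_perm; first by apply: drop_sorted; apply: enum_ord_sorted.
  by move=> a b; rewrite !mem_drop_enum => ha hb ab; apply: h; rewrite ?ha ?orbT.
- by apply: sorted_filter => //; apply: enum_ord_sorted.
move=> k; rewrite mem_filter mem_enum andbT /= -leqNgt.
by rewrite -[in LHS](permKV p k) mem_map ?mem_drop_enum //; apply: perm_inj.
Qed.

(** An unshuffle is determined by the subset of letters that it puts in front, and every subset of
    size i comes from one. *)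
Lemma unshuffle_masks i j : (i + j = n)%N ->
  perm_eq [seq pmask i p | p <- enum (unshuffle n i j)]
          [seq m <- masks n | count id m == i].
Proof.
move=> ij; apply: uniq_perm.
- rewrite map_inj_in_uniq ?enum_uniq // => p q; rewrite !mem_enum => hp hq e.
  apply/permP => k.
  have : [seq p k | k <- enum 'I_n] = [seq q k | k <- enum 'I_n].
    by rewrite -(cat_take_drop i (enum 'I_n)) !map_cat (unshuffle_take ij hp)
      (unshuffle_take ij hq) (unshuffle_drop ij hp) (unshuffle_drop ij hq) e.
  by move/eq_in_map; apply; rewrite mem_enum.
- by rewrite filter_uniq ?masks_uniq.
move=> m; rewrite mem_filter mem_masks; apply/mapP/andP => [[p hp ->]|[/eqP cm /eqP sm]].
  rewrite size_map size_enum_ord eqxx; split=> //.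
  rewrite mem_enum in hp; have := congr1 size (unshuffle_take ij hp).
  rewrite size_map size_mask ?size_map ?size_enum_ord // => <-.
  by rewrite size_take size_enum_ord; case: ltnP => //; lia.
(* The unshuffle with mask [m] lists the marked positions, then the unmarked ones, each in
   increasing order. *)
pose l := mask m (enum 'I_n) ++ mask (map negb m) (enum 'I_n).
have sl1 : size (mask m (enum 'I_n)) = i by rewrite size_mask ?size_enum_ord.
have pl : perm_eq l (enum 'I_n).
  by apply: perm_mask_negb; rewrite size_enum_ord.
have sl : size l = n by rewrite (perm_size pl) size_enum_ord.
have s2 : (size (mask (map negb m) (enum 'I_n)) = n - i)%N.
    by move: sl; rewrite /l size_cat sl1; lia.
have ul : uniq l by rewrite (perm_uniq pl) enum_uniq.
have inj : injective (fun k : 'I_n => nth k l k).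
  move=> a b; rewrite (set_nth_default b) ?sl // => /eqP.
  by rewrite nth_uniq ?sl // => /eqP/val_inj.
pose p := perm inj.
have pE k x0 : p k = nth x0 l k by rewrite permE; apply: set_nth_default; rewrite sl.
have st m' : sorted (relpre (@nat_of_ord n) ltn) (mask m' (enum 'I_n)).
  apply: (subseq_sorted le_trans _ enum_ord_sorted); exact: mask_subseq.
have hp : p \in unshuffle n i j.
  apply/(unshuffleP _ ij) => a b ab /orP[bi|ia].
    rewrite (pE a a) (pE b a) /l !nth_cat sl1 bi (ltn_trans ab bi).
    by apply: (sorted_ltn_nth le_trans a (st m) _ _ _ _ ab); rewrite inE sl1 ?(ltn_trans ab).
  have ib : (i <= b)%N by apply: leq_trans ia (ltnW ab).
  rewrite (pE a a) (pE b a) /l !nth_cat sl1 [(a < i)%N]ltnNge [(b < i)%N]ltnNge ia ib /=.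
  have := ltn_ord a; have := ltn_ord b => hb ha.
  have lt : (a - i < b - i)%N by lia.
  by apply: (sorted_ltn_nth le_trans a (st (map negb m)) _ _ _ _ lt); rewrite inE s2; lia.
exists p; first by rewrite mem_enum.
apply: (@eq_from_nth _ false); first by rewrite sm size_map size_enum_ord.
rewrite sm => k lk.
rewrite (nth_map (Ordinal lk)) ?size_enum_ord //.
have -> : nth (Ordinal lk) (enum 'I_n) k = Ordinal lk by apply: val_inj; rewrite /= nth_enum_ord.
set o := Ordinal lk; set a := (p^-1)%g o.
have pa : p a = o by rewrite permKV.
have mE : (o \in mask m (enum 'I_n)) = nth false m k.
  rewrite in_mask ?enum_uniq // mem_enum /= index_enum_ord //.
have -> : (a < i)%N = (o \in mask m (enum 'I_n)); last by rewrite mE.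
rewrite -pa (pE a a) /l nth_cat sl1; case: ltnP => ai.
  by rewrite mem_nth // sl1.
symmetry; apply/negbTE/negP => h.
have : nth a (mask (map negb m) (enum 'I_n)) (a - i) \in mask (map negb m) (enum 'I_n).
  by apply: mem_nth; rewrite s2; have := ltn_ord a; lia.
by move: ul; rewrite /l cat_uniq => /and3P[_ /hasPn hn _] /hn /=; rewrite h.
Qed.

(** Testing both sizes makes the right side vanish, like the left one, when i + j differs from n. *)
Lemma unshuffle_spl (V : eqType) (M : zmodType) i j (t : n.-tuple (int * V))
    (F : seq (int * V) -> seq (int * V) -> M) :
  \sum_(p in unshuffle n i j)
     F (take i (permt p t)) (drop i (permt p t)) *~ koszul (map_tuple fst t) p =
  spl (fun a b => if (size a == i) && (size b == j) then F a b else 0) t.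
Proof.
have [ij|/eqP ij] := eqVneq (i + j)%N n; last first.
  rewrite big1 => [|p]; last by rewrite inE (negbTE (introN eqP ij)).
  rewrite -[LHS](spl0 _ t); apply: eq_spl => a b sz _; case: ifP => // /andP[/eqP ai /eqP bj].
  by case: ij; rewrite -ai -bj sz size_tuple.
rewrite spl_masks size_tuple.
have sizes m : size m = n -> (size (mask m t) = count id m) *
    (size (mask (map negb m) t) = n - count id m)%N.
  move=> sm; rewrite !size_mask ?size_map ?size_tuple //; split=> //.
  by rewrite -sm -(count_predC id m) addKn count_map; apply: eq_count.
rewrite [RHS]big_seq [RHS](bigID (fun m => count id m == i)) /= [RHS]addrC.
rewrite [X in _ = X + _]big1 ?add0r; last first.
  move=> m /andP[mm /negbTE h]; rewrite mem_masks in mm.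
  by rewrite sizes ?(eqP mm) // h mul0rz.
rewrite (eq_bigl (fun m => (m \in masks n) && (count id m == i))) //.
rewrite -big_seq_cond -[RHS]big_filter -(perm_big _ (unshuffle_masks ij)) /= big_map big_enum /=.
apply: eq_bigr => p hp.
have sp : size (pmask i p) = n by rewrite size_map size_enum_ord.
have tE : [seq tnth t k | k <- enum 'I_n] = t.
  by rewrite {2}(tuple_map_ord t).
have pE : permt p t = [seq tnth t (p k) | k <- enum 'I_n] :> seq _ by [].
have tkE : take i (permt p t) = mask (pmask i p) t.
  by rewrite pE -{1}tE -map_mask -(unshuffle_take ij hp) -map_take -map_comp.
have dpE : drop i (permt p t) = mask (map negb (pmask i p)) t.
  by rewrite pE -{1}tE -map_mask -(unshuffle_drop ij hp) -map_drop -map_comp.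
have c : count id (pmask i p) = i.
  have := congr1 size tkE; rewrite (sizes _ sp).1 => <-.
  by rewrite size_take size_tuple; case: ltnP => //; lia.
have s2 : size (mask (map negb (pmask i p)) t) = j by rewrite (sizes _ sp).2 c; lia.
rewrite (sizes _ sp).1 c s2 !eqxx /= tkE dpE; congr (_ *~ _).
(* Labelling the letters by their positions turns the Koszul sign of [p] into the sign [kz] of a
   masked list. *)
pose T := [seq (val k, tnth t k) | k <- enum 'I_n].
have zT : unzip2 T = t by rewrite /T /unzip2 -map_comp.
rewrite -[X in msgn _ X]zT -kz_mask; last 2 first.
- by rewrite /T /unzip1 -map_comp (eq_map (g := val)) // val_enum_ord iota_ltn_sorted.
- by rewrite sp /T size_map size_enum_ord.
rewrite koszul_kz /T -(map_mask _ (pmask i p) (enum 'I_n)).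
rewrite -(map_mask _ (map negb _) (enum 'I_n)) -(unshuffle_take ij hp) -(unshuffle_drop ij hp).
rewrite -!map_cat cat_take_drop -!map_comp; congr kz.
by apply: eq_map => k /=; rewrite tnth_map.
Qed.
End Unshuffles.

(** * The graded symmetric algebra *)

Section SymTheory.
Variables (K : fieldType) (A : algType K) (gA : int -> A -> Prop).
Variables (L : lmodType A) (gL : int -> L -> Prop).
Local Notation S := (sym gA gL).
Local Notation gS := (@sym_deg K A gA L gL).
Local Notation iA := (symA gA gL).
Local Notation iL := (symL gA gL).

Lemma symA_zmod : zmod_morphism iA.
Proof.
move=> a b; apply: (addIr (iA b)); rewrite subrK -symAD subrK //.
Qed.

HB.instance Definition _ := GRing.isZmodMorphism.Build A S (symA gA gL) symA_zmod.

Lemma symL_zmod : zmod_morphism iL.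
Proof.
move=> a b; apply: (addIr (iL b)); rewrite subrK -symLD subrK //.
Qed.

HB.instance Definition _ := GRing.isZmodMorphism.Build L S (symL gA gL) symL_zmod.

Lemma symMzl (u v : S) n : (u *~ n) * v = (u * v) *~ n.
Proof. exact: mulrzAl. Qed.

Lemma symMzr (u v : S) n : u * (v *~ n) = (u * v) *~ n.
Proof. exact: mulrzAr. Qed.

Lemma symA1 : iA 1 = 1. Proof. by []. Qed.

Lemma sym_scaleE (c : K) (u : S) : c *: u = iA c%:A * u. Proof. by []. Qed.

Hypothesis hA : graded_calg gA.
Hypothesis hL : graded_module gA gL.
Let grA := calg_grading hA.
Let grL := gmod_grading hL.

Lemma sym_deg0 n : gS n 0.
Proof. by rewrite -(raddf0 iA); apply: symdegA; apply: grading0. Qed.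

Lemma sym_degA0 n u : gS n u -> forall c : K, gS n (iA c%:A * u).
Proof.
move=> hu c; rewrite -[n]add0r; apply: symdegM => //; apply: symdegA.
by apply: calgZ => //; apply: calg1.
Qed.

Lemma sym_degZ n (c : K) u : gS n u -> gS n (c *: u).
Proof. by move=> hu; rewrite sym_scaleE; apply: sym_degA0. Qed.

Lemma sym_degN n u : gS n u -> gS n (- u).
Proof. by move=> hu; rewrite -scaleN1r; apply: sym_degZ. Qed.

Lemma sym_degB n u v : gS n u -> gS n v -> gS n (u - v).
Proof. by move=> hu hv; apply: symdegD => //; apply: sym_degN. Qed.

Lemma sym_deg1 : gS 0 1.
Proof. by rewrite -symA1; apply: symdegA; apply: calg1. Qed.

Lemma sym_deg_sgn n u m : gS n u -> gS n (u *~ sgn m).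
Proof. by move=> hu; rewrite mulz_sgn; case: par => //; apply: sym_degN. Qed.

Lemma sym_degS n m u : m = n -> gS n u -> gS m u. Proof. by move->. Qed.

(** Commutation with a fixed [v] passes from generators to sums and products in the other factor;
    [sym_comm] uses this in each argument in turn. *)
Lemma sym_comm_gen n v : (forall m a, gA m a -> iA a * v = (v * iA a) *~ sgn (m * n)) ->
  (forall m x, gL m x -> iL x * v = (v * iL x) *~ sgn (m * n)) ->
  forall m u, gS m u -> u * v = (v * u) *~ sgn (m * n).
Proof.
move=> ha hl m u; elim=> {m u} [m a|m x|m u w _ IH1 _ IH2|m k u w _ IH1 _ IH2].
- exact: ha.
- exact: hl.
- by rewrite mulrDl mulrDr IH1 IH2 mulrzDl.
by rewrite -mulrA IH2 mulrzAr [u * (v * w)]mulrA IH1 mulrzAl -mulrA; signs.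
Qed.

Lemma sym_comm_sym m n (u v : S) :
  u * v = (v * u) *~ sgn (m * n) -> v * u = (u * v) *~ sgn (n * m).
Proof. by move->; signs. Qed.

Lemma sym_commAL m n a x : gA m a -> gL n x ->
  iA a * iL x = (iL x * iA a) *~ sgn (m * n).
Proof.
move=> ha hx.
have : iA a * iL x = iA (1 *~ sgn (m * n)) * (iL x * iA a).
  rewrite [LHS]sym_mulE [iL x * _]sym_mulE [RHS]sym_mulE; apply/sym_eqP; exact: sc_commAL.
by move=> ->; rewrite raddfMz /= symA1 mulrzAl mul1r.
Qed.

Lemma sym_commLL m n x y : gL m x -> gL n y ->
  iL x * iL y = (iL y * iL x) *~ sgn (m * n).
Proof.
move=> ha hx.
have : iL x * iL y = iA (1 *~ sgn (m * n)) * (iL y * iL x).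
  rewrite [LHS]sym_mulE [iL y * _]sym_mulE [RHS]sym_mulE; apply/sym_eqP; exact: sc_commLL.
by move=> ->; rewrite raddfMz /= symA1 mulrzAl mul1r.
Qed.

Lemma sym_comm m n u v : gS m u -> gS n v -> u * v = (v * u) *~ sgn (m * n).
Proof.
move=> hu hv; apply: sym_comm_gen hu => {m u} [m a ha|m x hx]; apply: sym_comm_sym;
  apply: sym_comm_gen hv => {n v} [n b hb|n y hy].
- by rewrite -!symAM (calgC hA hb ha) raddfMz.
- exact/sym_comm_sym/sym_commAL.
- exact: sym_commAL.
- exact: sym_commLL.
Qed.

Lemma sym_hom_ind (P : S -> Prop) :
  (forall n u, gS n u -> P u) -> (forall u v, P u -> P v -> P (u + v)) -> forall u, P u.
Proof.
move=> hP hD u.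
suff [w [hw ->]] : exists w : seq (int * S), homw gS w /\ u = \sum_(g <- w) g.2.
  elim: w hw => [_|g w IH [hg hw]].
    by rewrite big_nil; apply: hP 0 _ (sym_deg0 0).
  by rewrite big_cons; apply: hD; [apply: hP hg|apply: IH].
elim/sym_gen: u => [a|x|u v [w [hw ->]] [w' [hw' ->]]|u v [w [hw ->]] [w' [hw' ->]]].
- elim/(hom_ind grA): a => [n a ha|a b [w [hw wE]] [w' [hw' wE']]].
    by exists [:: (n, iA a)]; rewrite big_seq1 /=; do 2!split=> //; apply: symdegA.
  by exists (w ++ w'); rewrite homw_cat big_cat /= raddfD /= wE wE'.
- elim/(hom_ind grL): x => [n a ha|a b [w [hw wE]] [w' [hw' wE']]].
    by exists [:: (n, iL a)]; rewrite big_seq1 /=; do 2!split=> //; apply: symdegL.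
  by exists (w ++ w'); rewrite homw_cat big_cat /= raddfD /= wE wE'.
- by exists (w ++ w'); rewrite homw_cat big_cat.
exists [seq (g.1 + h.1, g.2 * h.2) | g <- w, h <- w']; split; last first.
  rewrite big_allpairs_dep mulr_suml; apply: eq_bigr => g _.
  by rewrite mulr_sumr.
apply/homwP => _ /allpairsP[[g h] [/= gw hw2 ->]] /=.
by apply: symdegM; [apply: (homwP _ _).1 gw|apply: (homwP _ _).1 hw2].
Qed.

Lemma sym_homw_span (u : S) : exists n (d : n.-tuple int) (v : n.-tuple S),
  homs gS d v /\ u = \sum_(y <- v) y.
Proof.
elim/sym_hom_ind: u => [n u hu|u v [n [d [t [h ->]]]] [m [e [s [h' ->]]]]].
  exists 1%N, [tuple n], [tuple u]; rewrite big_seq1; split=> // i.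
  by rewrite (ord1 i) /tnth.
exists (n + m)%N, (cat_tuple d e), (cat_tuple t s); split; last by rewrite big_cat.
move=> i; rewrite -(splitK i); case: (split i) => j /=.
  by rewrite !(tnth_nth 0) /= !nth_cat !size_tuple ltn_ord -!tnth_nth; apply: h.
by rewrite !(tnth_nth 0) /= !nth_cat !size_tuple ltnNge leq_addr /= addKn -!tnth_nth; apply: h'.
Qed.

(* The automorphism acting by c^n in degree n: c = 2 separates the degrees and
   c = -1 is the parity involution. *)
Section Dilation.
Variable c : K.
Hypothesis c_neq0 : c != 0.

Let cA := ext grA (fun n a => c ^ n *: a).
Let cL := ext grL (fun n x => (c ^ n)%:A *: x).

Let fA n a b : gA n a -> gA n b -> c ^ n *: (a + b) = c ^ n *: a + c ^ n *: b.
Proof. by move=> _ _; rewrite scalerDr. Qed.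
Let fL n x y : gL n x -> gL n y ->
  (c ^ n)%:A *: (x + y) = (c ^ n)%:A *: x + (c ^ n)%:A *: y :> L.
Proof. by move=> _ _; rewrite scalerDr. Qed.

Let cAhom n a : gA n a -> cA a = c ^ n *: a. Proof. exact: ext_hom. Qed.
Let cLhom n x : gL n x -> cL x = (c ^ n)%:A *: x. Proof. exact: (ext_hom grL fL). Qed.

Let cA_lin : linear cA.
Proof.
have D := extD grA fA; rewrite -/cA in D.
move=> k a b; rewrite D; congr (_ + _).
elim/(hom_ind grA): a => [n a ha|a b' Ha Hb]; last by rewrite scalerDr !D Ha Hb scalerDr.
by rewrite (cAhom (calgZ hA k ha)) (cAhom ha) !scalerA mulrC.
Qed.

Let cA_mul : monoid_morphism cA.
Proof.
have D := extD grA fA; rewrite -/cA in D.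
split; first by rewrite (cAhom (calg1 hA)) expr0z scale1r.
move=> a b; elim/(hom_ind grA): a => [m a ha|a b' Ha Hb]; last by rewrite mulrDl !D mulrDl Ha Hb.
elim/(hom_ind grA): b => [n b hb|a' b' Ha Hb]; last by rewrite mulrDr !D mulrDr Ha Hb.
rewrite (cAhom (calgM hA ha hb)) (cAhom ha) (cAhom hb).
by rewrite -scalerAl -scalerAr scalerA expfzDr.
Qed.

Let cL_zmod : zmod_morphism cL.
Proof.
have D := extD grL fL; rewrite -/cL in D.
by move=> x y; apply: (addIr (cL y)); rewrite subrK -D subrK.
Qed.

Let cLZ a x : cL (a *: x) = cA a *: cL x.
Proof.
have D := extD grA fA; rewrite -/cA in D.
have DL := extD grL fL; rewrite -/cL in DL.
elim/(hom_ind grA): a => [m a ha|a b' Ha Hb]; last by rewrite scalerDl DL D scalerDl Ha Hb.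
elim/(hom_ind grL): x => [n b hb|a' b' Ha Hb]; last by rewrite scalerDr !DL scalerDr Ha Hb.
rewrite (cLhom (gmodZ hL ha hb)) (cAhom ha) (cLhom hb) !scalerA expfzDr //.
by congr (_ *: _); rewrite mulr_algr !mulr_algl !scalerA mulrC.
Qed.

(** The scalings of A and L are multiplicative and keep degrees, so the universal property
    [sym_lift] applies. *)
Lemma sym_dilation : exists h : {lrmorphism S -> S},
  forall n u, gS n u -> h u = c ^ n *: u.
Proof.
pose fS (a : A) : S := iA (cA a).
have fS_add : zmod_morphism fS.
  by move=> a b; rewrite /fS -raddfB addrC -scaleN1r cA_lin scaleN1r addrC.
have fS_mul : monoid_morphism fS.
  by split=> [|a b]; rewrite /fS ?cA_mul.1 // cA_mul.2 symAM.
have fS_scal : scalable fS.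
  move=> k a; rewrite /fS; have := cA_lin k a 0; rewrite !addr0.
  have -> : cA 0 = 0 by rewrite (cAhom (grading0 grA 0)) scaler0.
  by rewrite addr0 => ->; rewrite sym_scaleE -symAM mulr_algl.
pose haM := GRing.isZmodMorphism.Build _ _ fS fS_add.
pose hmM := GRing.isMonoidMorphism.Build _ _ fS fS_mul.
pose hsM := GRing.isScalable.Build _ _ _ _ fS fS_scal.
pose f : {lrmorphism A -> S} := HB.pack fS haM hmM hsM.
pose gS' (x : L) : S := iL (cL x).
have gS_add : zmod_morphism gS' by move=> x y; rewrite /gS' cL_zmod raddfB.
pose hgM := GRing.isZmodMorphism.Build _ _ gS' gS_add.
pose g : {additive L -> S} := HB.pack gS' hgM.
have gsA n a : gA n a -> gS n (f a).
  by move=> ha; rewrite /f /= /fS (cAhom ha); apply: symdegA; apply: calgZ.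
have gsL n x : gL n x -> gS n (g x).
  move=> hx; rewrite /g /= /gS' (cLhom hx); apply: symdegL.
  by have := gmodZ hL (calgZ hA (c ^ n) (calg1 hA)) hx; rewrite add0r.
have [||| h [hA1 hL1]] := @sym_lift K A gA L gL S f g.
- by move=> a x; rewrite /f /g /= /fS /gS' cLZ symLZ.
- by move=> m n a x ha hx; apply: sym_comm; [apply: gsA|apply: gsL].
- by move=> m n a x ha hx; apply: sym_comm; apply: gsL.
exists h => n u; elim=> {n u} [n a ha|n x hx|n u v _ IH1 _ IH2|m n u v _ IH1 _ IH2].
- by rewrite hA1 /f /= /fS (cAhom ha) sym_scaleE -symAM mulr_algl.
- by rewrite hL1 /g /= /gS' (cLhom hx) symLZ.
- by rewrite raddfD /= IH1 IH2 scalerDr.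
by rewrite rmorphM /= IH1 IH2 -scalerAl -scalerAr scalerA expfzDr.
Qed.
End Dilation.

Hypothesis charK : [pchar K] =i pred0.

(** Directness is the hard part: the dilation by 2 acts on degree n as 2^n, and in characteristic 0
    these eigenvalues are distinct. *)
Lemma sym_grading : is_grading gS.
Proof.
split.
- exact: sym_deg0.
- exact: sym_degB.
- by move=> u; have [n [d [v H]]] := sym_homw_span u; exists n, d, v.
have pw (k : nat) : (0 < k)%N -> (2 : K) ^+ k != 1.
  move=> k0; rewrite -natrX -subr_eq0 -(natrB _ (expn_gt0 2 k)) ((pcharf0P K).1 charK).
  by rewrite subn_eq0 -ltnNge -{1}(expn0 2) ltn_exp2l.
have two0 : (2 : K) != 0 by rewrite ((pcharf0P K).1 charK).
have [h hE] := sym_dilation two0.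
have sep (m n : int) : m != n -> (2 : K) ^ m - 2 ^ n != 0.
  move=> mn; rewrite subr_eq0; apply/eqP => e.
  have e1 : (2 : K) ^ (m - n) = 1 by rewrite expfzDr // e -expfzDr // subrr.
  have : m - n != 0 by rewrite subr_eq0.
  case: (m - n) e1 => k e1 k0.
    have k_gt0 : (0 < k)%N by case: (k) k0.
    by have := pw k k_gt0; rewrite -[_ ^+ k]/(2 ^ Posz k) e1 eqxx.
  have := pw k.+1 isT; rewrite -(inj_eq invr_inj) invr1.
  by rewrite -[_ ^-1]/(2 ^ Negz k) e1 eqxx.
move=> s; elim: s => [|m s IH] v //= /andP[ms us] hv.
rewrite big_cons => v0.
(* The dilated relation minus 2^m times the relation itself has no term of degree m, so the
   induction hypothesis applies to it. *)
have E : \sum_(n <- s) ((2 : K) ^ n - 2 ^ m) *: v n = 0.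
  have := congr1 h v0; rewrite raddf0 raddfD raddf_sum /= (hE _ _ (hv m)).
  rewrite (eq_bigr (fun n => (2 : K) ^ n *: v n)) => [E2|n _]; last exact: hE.
  under eq_bigr do rewrite scalerBl.
  rewrite sumrB -scaler_sumr; move/eqP: v0; rewrite addrC addr_eq0 => /eqP ->.
  by rewrite scalerN opprK addrC.
have vs n : n \in s -> v n = 0.
  move=> ns; have := IH _ us (fun k => sym_degZ _ (hv k)) E n ns.
  move/eqP; rewrite scaler_eq0 (negbTE (sep _ _ _)) //= => [/eqP //|].
  by apply: contraNneq ms => <-.
move=> n; rewrite inE => /orP[/eqP ->|]; last exact: vs.
by move: v0; rewrite big1_seq ?addr0 // => k /andP[_ /vs].
Qed.

Lemma sym_graded_calg : graded_calg gS.
Proof.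
split.
- exact: sym_grading.
- by move=> n c u; apply: sym_degZ.
- exact: sym_deg1.
- by move=> m n u v; apply: symdegM.
- exact: sym_comm.
Qed.
End SymTheory.

(** * Operators with prescribed iterated commutators *)

Section OperatorFamilies.
Variables (K : fieldType) (A : algType K) (gA : int -> A -> Prop).
Variables (L : lmodType A) (gL : int -> L -> Prop).
Hypothesis hA : graded_calg gA.
Hypothesis hL : graded_module gA gL.
Let grA := calg_grading hA.
Let grL := gmod_grading hL.
Local Notation S := (sym gA gL).
Local Notation gS := (@sym_deg K A gA L gL).
Local Notation iA := (symA gA gL).
Local Notation iL := (symL gA gL).

(* The pair (a, x) stands for the element a + x of S: working with A + L instead
   of the two kinds of generators avoids distinguishing cases. *)
Definition gen : zmodType := (A * L)%type.
Definition hgen (n : int) (g : gen) : Prop := gA n g.1 /\ gL n g.2.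
Definition gsym (g : gen) : S := iA g.1 + iL g.2.
Definition gA_gen (a : A) : gen := (a, 0).
Definition gL_gen (x : L) : gen := (0, x).
Definition gscale (a : A) (g : gen) : gen := (a * g.1, a *: g.2).
Local Notation word := (seq (int * gen)).
Implicit Types (v w : word) (P : word -> S).

Lemma gsym_deg n g : hgen n g -> gS n (gsym g).
Proof. by move=> [ha hx]; apply: symdegD; [apply: symdegA|apply: symdegL]. Qed.

Lemma hgenA n a : gA n a -> hgen n (gA_gen a).
Proof. by move=> ha; split=> //=; apply: grading0. Qed.

Lemma hgenL n x : gL n x -> hgen n (gL_gen x).
Proof. by move=> ha; split=> //=; apply: grading0. Qed.

Lemma hgenD n g h : hgen n g -> hgen n h -> hgen n (g + h).
Proof. by move=> [? ?] [? ?]; split; [apply: (grD grA)|apply: (grD grL)]. Qed.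

Lemma hgen_scale m n a g : gA m a -> hgen n g -> hgen (m + n) (gscale a g).
Proof. by move=> ha [hb hx]; split; [apply: (calgM hA)|apply: (gmodZ hL)]. Qed.

Lemma gsymA a : gsym (gA_gen a) = iA a.
Proof. by rewrite /gsym /= raddf0 addr0. Qed.

Lemma gsymL x : gsym (gL_gen x) = iL x.
Proof. by rewrite /gsym /= raddf0 add0r. Qed.

Lemma gsymE g : gsym g = iA g.1 + iL g.2. Proof. by []. Qed.

Lemma gsymD g h : gsym (g + h) = gsym g + gsym h.
Proof.
by rewrite /gsym -[(g + h).1]/(g.1 + h.1) -[(g + h).2]/(g.2 + h.2) !raddfD /= addrACA.
Qed.

Lemma gsym_scale a g : gsym (gscale a g) = iA a * gsym g.
Proof. by rewrite /gsym /= symAM symLZ mulrDr. Qed.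

(* The conditions on the values P w = [..[[F, w_1], w_2] .., w_n] 1 of the iterated
   commutators of a degree 1 operator F which make F well defined on S. *)
Record opdata P : Prop := {
  od_swap : swapw hgen P;
  od_add : forall w n g h, homw hgen w -> hgen n g -> hgen n h ->
    P (rcons w (n, g + h)) = P (rcons w (n, g)) + P (rcons w (n, h));
  od_one : forall w c, homw hgen w -> P (rcons w (0, gA_gen c%:A)) = 0;
  od_mul : forall w m a n g, homw hgen w -> gA m a -> hgen n g ->
    P (rcons w (m + n, gscale a g)) =
      (iA a * P (rcons w (n, g))) *~ sgn (m * (1 + deg w))
      + (gsym g * P (rcons w (m, gA_gen a))) *~ sgn (n * (1 + deg w + m))
      + P (rcons (rcons w (m, gA_gen a)) (n, g)) }.

(** With F_w the iterated commutator by the letters of w: if [P w] is F_w(u), then [act g P w] is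
    F_w(g u). *)
Definition act (g : int * gen) P w : S :=
  (gsym g.2 * P w) *~ sgn (g.1 * (1 + deg w)) + P (rcons w g).

Lemma od_swap_rcons P w g h : opdata P -> homw hgen w -> hgen g.1 g.2 -> hgen h.1 h.2 ->
  P (rcons (rcons w g) h) = P (rcons (rcons w h) g) *~ sgn (g.1 * h.1).
Proof.
move=> HP hw hg hh; rewrite -!cats1 -!catA /=; apply: (od_swap HP).
by apply/homw_cat.
Qed.

Lemma gsym_comm m n g h u : hgen m g -> hgen n h ->
  gsym g * (gsym h * u) = (gsym h * (gsym g * u)) *~ sgn (m * n).
Proof.
move=> hg hh; rewrite mulrA (sym_comm hA (gsym_deg hg) (gsym_deg hh)).
by rewrite mulrzAl mulrA.
Qed.

(** Modelled on F_w(g h u) = +/- F_w(h g u): the outer terms agree by commutativity in S and by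
    [od_swap], and the two mixed terms change places. *)
Lemma act_comm P g h w : opdata P -> homw hgen w -> hgen g.1 g.2 -> hgen h.1 h.2 ->
  act g (act h P) w = act h (act g P) w *~ sgn (g.1 * h.1).
Proof.
move=> HP hw hg hh; rewrite /act !deg_rcons (od_swap_rcons HP hw hh hg).
rewrite !mulrDr !mulrzAr (gsym_comm _ hg hh).
signs; zmod.
Qed.

(** The closure property that lets the recursion continue with another letter. *)
Lemma act_opdata P g : opdata P -> hgen g.1 g.2 -> opdata (act g P).
Proof.
move=> HP hg; split.
- move=> w1 x y w2 hw; rewrite /act !rcons_cat /= (od_swap HP hw).
  have hw2 : homw hgen (w1 ++ x :: y :: rcons w2 g).
    by move: hw; rewrite !homw_cat /= homw_rcons; tauto.
  rewrite (od_swap HP hw2) !deg_cat !deg_cons mulrzAr; signs; zmod.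
- move=> w n x y hw hx hy; rewrite /act !deg_rcons /=.
  have sw z : hgen n z -> P (rcons (rcons w (n, z)) g) =
      P (rcons (rcons w g) (n, z)) *~ sgn (n * g.1).
    by move=> hz; rewrite (od_swap_rcons HP).
  have hwg : homw hgen (rcons w g) by apply/homw_rcons.
  rewrite !sw //; last exact: hgenD.
  rewrite !(od_add HP) // mulrDr.
  signs; zmod.
- move=> w c hw; rewrite /act !deg_rcons /= (od_one HP) // mulr0 mul0rz add0r.
  have h1 : hgen 0 (gA_gen c%:A) by apply: hgenA; apply: (calgZ hA); apply: calg1.
  rewrite (od_swap_rcons HP) //= (od_one HP) ?mul0rz //.
  by apply/homw_rcons.
move=> w m a n x hw ha hx; rewrite /act !deg_rcons /=.
have hga := hgenA ha; have hax := hgen_scale ha hx.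
have hwg : homw hgen (rcons w g) by apply/homw_rcons.
have hwa : homw hgen (rcons w (m, gA_gen a)) by apply/homw_rcons.
(* The letter [g] stands at the end of the words; moving it before the last letters makes [od_mul]
   applicable to the word [rcons w g]. *)
have E1 := od_swap_rcons (g := (m + n, gscale a x)) HP hw hax hg.
have E2 := od_swap_rcons (g := (n, x)) HP hw hx hg.
have E3 := od_swap_rcons (g := (m, gA_gen a)) HP hw hga hg.
have E4 : P (rcons (rcons (rcons w (m, gA_gen a)) (n, x)) g) =
    P (rcons (rcons (rcons w g) (m, gA_gen a)) (n, x)) *~ sgn ((m + n) * g.1).
  rewrite (od_swap_rcons (g := (n, x)) HP hwa hx hg).
  have rc3 (p q r : int * gen) : rcons (rcons (rcons w p) q) r = w ++ [:: p; q; r].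
    by rewrite -!cats1 -!catA.
  rewrite !rc3 (od_swap HP) /=; first by signs.
  by apply/homw_cat.
rewrite E1 E2 E3 E4 !(od_mul HP) // deg_rcons.
rewrite !mulrDr !mulrzAr -!gsymA (gsym_comm _ hg hga) (gsym_comm _ hg hx).
signs; zmod.
Qed.

Lemma opdataD P Q : opdata P -> opdata Q -> opdata (fun w => P w + Q w).
Proof.
move=> HP HQ; split.
- by move=> w1 x y w2 hw; rewrite (od_swap HP hw) (od_swap HQ hw) mulrzDl.
- by move=> w n x y hw hx hy; rewrite (od_add HP) // (od_add HQ) // addrACA.
- by move=> w c hw; rewrite (od_one HP) // (od_one HQ) // addr0.
move=> w m a n x hw ha hx; rewrite (od_mul HP) // (od_mul HQ) //.
rewrite !mulrDr; signs; zmod.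
Qed.

Lemma opdataN P : opdata P -> opdata (fun w => - P w).
Proof.
move=> HP; split.
- by move=> w1 x y w2 hw; rewrite (od_swap HP hw) mulNrz.
- by move=> w n x y hw hx hy; rewrite (od_add HP) // opprD.
- by move=> w c hw; rewrite (od_one HP) // oppr0.
move=> w m a n x hw ha hx; rewrite (od_mul HP) //.
signs; zmod.
Qed.

End OperatorFamilies.

Section OperatorExistence.
Variables (K : fieldType) (A : algType K) (gA : int -> A -> Prop).
Variables (L : lmodType A) (gL : int -> L -> Prop).
Hypothesis hA : graded_calg gA.
Hypothesis hL : graded_module gA gL.
Let grA := calg_grading hA.
Let grL := gmod_grading hL.
Local Notation S := (sym gA gL).
Local Notation gS := (@sym_deg K A gA L gL).
Local Notation iA := (symA gA gL).
Local Notation iL := (symL gA gL).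
Local Notation word := (seq (int * gen L)).
Local Notation hgen := (hgen gA gL).
Local Notation gA_gen := (gA_gen L).
Implicit Types (v w : word) (P Q : word -> S).
Local Notation hgenA := (hgenA hL).
Local Notation hgenL := (hgenL hA).
Local Notation hgenD := (hgenD hA hL).
Local Notation hgen_scale := (hgen_scale hA hL).
Local Notation act_comm := (act_comm hA).
Local Notation act_opdata := (act_opdata hA hL).

(** If [P w] is F_w(u), then [ev t P w] is F_w(t u): a product of terms becomes a composition. As
    generators need not be homogeneous, [act] is extended additively. *)
Fixpoint ev (t : sterm A L) P : word -> S :=
  match t with
  | SA a => fun w => ext grA (fun n a => act (n, gA_gen a) P w) a
  | SL x => fun w => ext grL (fun n x => act (n, gL_gen x) P w) x
  | Sadd t u => fun w => ev t P w + ev u P w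
  | Sopp t => fun w => - ev t P w
  | Smul t u => ev t (ev u P)
  end.

Lemma act_add P w n g h : opdata P -> homw hgen w -> hgen n g -> hgen n h ->
  act (n, g + h) P w = act (n, g) P w + act (n, h) P w.
Proof.
move=> HP hw hg hh; rewrite /act /= gsymD mulrDl (od_add HP) //; signs; zmod.
Qed.

Lemma act_addA P w n a b : opdata P -> homw hgen w -> gA n a -> gA n b ->
  act (n, gA_gen (a + b)) P w = act (n, gA_gen a) P w + act (n, gA_gen b) P w.
Proof.
move=> HP hw ha hb; rewrite -act_add //; try exact: hgenA.
by congr (act (_, _)); rewrite /gA_gen; congr pair; rewrite addr0.
Qed.

Lemma act_addL P w n x y : opdata P -> homw hgen w -> gL n x -> gL n y ->
  act (n, gL_gen (x + y)) P w = act (n, gL_gen x) P w + act (n, gL_gen y) P w.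
Proof.
move=> HP hw ha hb; rewrite -act_add //; try exact: hgenL.
by congr (act (_, _)); rewrite /gL_gen; congr pair; rewrite addr0.
Qed.

Lemma act_eq g P Q w : (forall w, homw hgen w -> P w = Q w) -> homw hgen w ->
  hgen g.1 g.2 -> act g P w = act g Q w.
Proof. by move=> h hw hg; rewrite /act !h //; apply/homw_rcons. Qed.

Lemma ev_eq t P Q : (forall w, homw hgen w -> P w = Q w) ->
  forall w, homw hgen w -> ev t P w = ev t Q w.
Proof.
elim: t P Q => [a|x|t IHt u IHu|t IHt|t IHt u IHu] P Q h w hw /=.
- rewrite /ext !big_seq; apply: eq_bigr => g gw; apply: act_eq => //.
  by apply: hgenA; apply: (homwP _ _).1 gw; apply: homw_dec.
- rewrite /ext !big_seq; apply: eq_bigr => g gw; apply: act_eq => //.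
  by apply: hgenL; apply: (homwP _ _).1 gw; apply: homw_dec.
- by rewrite (IHt _ Q) // (IHu _ Q).
- by rewrite (IHt _ Q).
by apply: IHt => // w' hw'; apply: IHu.
Qed.

Lemma evA P a n w : opdata P -> homw hgen w -> gA n a ->
  ev (SA a) P w = act (n, gA_gen a) P w.
Proof. by move=> HP hw ha; apply: ext_hom => // *; apply: act_addA. Qed.

Lemma evL P x n w : opdata P -> homw hgen w -> gL n x ->
  ev (SL x) P w = act (n, gL_gen x) P w.
Proof. by move=> HP hw ha; apply: ext_hom => // *; apply: act_addL. Qed.

Lemma evAD P a b w : opdata P -> homw hgen w ->
  ev (SA (a + b)) P w = ev (SA a) P w + ev (SA b) P w.
Proof. by move=> HP hw; apply: extD => // *; apply: act_addA. Qed.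

Lemma evLD P a b w : opdata P -> homw hgen w ->
  ev (SL (a + b)) P w = ev (SL a) P w + ev (SL b) P w.
Proof. by move=> HP hw; apply: extD => // *; apply: act_addL. Qed.

Lemma opdata_eq P Q : (forall w, homw hgen w -> P w = Q w) -> opdata P -> opdata Q.
Proof.
move=> h HP; have R w g : homw hgen w -> hgen g.1 g.2 -> homw hgen (rcons w g).
  by move=> hw hg; apply/homw_rcons.
split.
- move=> w1 x y w2 hw; rewrite -!h ?(od_swap HP hw) //.
  by move: hw; rewrite !homw_cat /=; tauto.
- by move=> w n x y hw hx hy; rewrite -!h ?(od_add HP) //; apply: R => //=; apply: hgenD.
- move=> w c hw; rewrite -h ?(od_one HP) //; apply: R => //=.
  by apply: hgenA; apply: (calgZ hA); apply: calg1.
move=> w m a n x hw ha hx; have hga := hgenA ha; have hax := hgen_scale ha hx.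
by rewrite -!h ?(od_mul HP) //; do ?[apply: R => //=]; apply/homw_rcons.
Qed.

Lemma ev_opdata t P : opdata P -> opdata (ev t P).
Proof.
elim: t P => [a|x|t IHt u IHu|t IHt|t IHt u IHu] P HP /=.
- elim/(hom_ind grA): a => [n a ha|a b Ha Hb].
    by apply: opdata_eq (act_opdata (g := (n, gA_gen a)) HP (hgenA ha)) => w hw; rewrite -evA.
  by apply: opdata_eq (opdataD Ha Hb) => w hw; rewrite -[RHS]/(ev (SA (a + b)) P w) evAD.
- elim/(hom_ind grL): x => [n a ha|a b Ha Hb].
    by apply: opdata_eq (act_opdata (g := (n, gL_gen a)) HP (hgenL ha)) => w hw; rewrite -evL.
  by apply: opdata_eq (opdataD Ha Hb) => w hw; rewrite -[RHS]/(ev (SL (a + b)) P w) evLD.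
- by apply: opdataD; [apply: IHt|apply: IHu].
- by apply: opdataN; apply: IHt.
by apply: IHt; apply: IHu.
Qed.

Lemma evDr t P Q w : opdata P -> opdata Q -> homw hgen w ->
  ev t (fun w => P w + Q w) w = ev t P w + ev t Q w.
Proof.
elim: t P Q w => [a|x|t IHt u IHu|t IHt|t IHt u IHu] P Q w HP HQ hw.
- have HD := opdataD HP HQ.
  elim/(hom_ind grA): a => [n a ha|a b Ha Hb]; last by rewrite !evAD // Ha Hb addrACA.
  by rewrite !(evA _ hw ha) // /act mulrDr; signs; zmod.
- have HD := opdataD HP HQ.
  elim/(hom_ind grL): x => [n a ha|a b Ha Hb]; last by rewrite !evLD // Ha Hb addrACA.
  by rewrite !(evL _ hw ha) // /act mulrDr; signs; zmod.
- by rewrite /= IHt // IHu // addrACA.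
- by rewrite /= IHt // opprD.
rewrite /= -IHt //; try exact: ev_opdata.
by apply: ev_eq => // w' hw'; apply: IHu.
Qed.

Lemma act_eqD g P Q w : act g (fun w => P w + Q w) w = act g P w + act g Q w.
Proof. by rewrite /act mulrDr; signs; zmod. Qed.

Lemma act_eqN g P w : act g (fun w => - P w) w = - act g P w.
Proof. by rewrite /act mulrN; signs; zmod. Qed.

Lemma ev_central t c P w : opdata P -> homw hgen w ->
  ev t (act (0, gA_gen c%:A) P) w = act (0, gA_gen c%:A) (ev t P) w.
Proof.
have h1 : hgen 0 (gA_gen c%:A) by apply: hgenA; apply: (calgZ hA); apply: calg1.
have R v : homw hgen v -> homw hgen (rcons v (0, gA_gen c%:A)) by move=> hv; apply/homw_rcons.
elim: t P w => [a|x|t IHt u IHu|t IHt|t IHt u IHu] P w HP hw.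
- have HP' := act_opdata (g := (0, gA_gen c%:A)) HP h1.
  elim/(hom_ind grA): a => [n a ha|a b Ha Hb].
    rewrite (evA HP' hw ha) (act_comm (g := (n, _)) HP) //; last exact: hgenA.
    by rewrite mulr0 mulr1z; apply: act_eq => // v hv; rewrite (evA HP hv ha).
  by rewrite evAD // Ha Hb -act_eqD; apply: act_eq => // v hv; rewrite evAD.
- have HP' := act_opdata (g := (0, gA_gen c%:A)) HP h1.
  elim/(hom_ind grL): x => [n a ha|a b Ha Hb].
    rewrite (evL HP' hw ha) (act_comm (g := (n, _)) HP) //; last exact: hgenL.
    by rewrite mulr0 mulr1z; apply: act_eq => // v hv; rewrite (evL HP hv ha).
  by rewrite evLD // Ha Hb -act_eqD; apply: act_eq => // v hv; rewrite evLD.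
- by rewrite /= IHt // IHu // -act_eqD.
- by rewrite /= IHt // -act_eqN.
rewrite /= -IHt //; last exact: ev_opdata.
by apply: ev_eq => // w' hw'; apply: IHu.
Qed.

Lemma ev_one P w : opdata P -> homw hgen w -> ev (SA 1) P w = P w.
Proof.
move=> HP hw; rewrite (evA HP hw (calg1 hA)) /act /=.
by have := od_one HP 1 hw; rewrite scale1r => ->; rewrite gsymA mul0r addr0 symA1 mul1r.
Qed.

(** The Leibniz rule [od_mul] says that multiplication by a g is multiplication by g followed by
    that by a. The equation for [h] serves the cases g in A and g in L alike. *)
Lemma ev_mulA P a h w : opdata P -> homw hgen w ->
  forall g m n, gA m a -> hgen n g -> h = gscale a g ->
  act (m + n, h) P w = act (m, gA_gen a) (act (n, g) P) w.
Proof.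
move=> HP hw g m n ha hg ->.
rewrite /act /= (od_mul HP) // gsym_scale -mulrA !deg_rcons /= !mulrDr !mulrzAr gsymA.
signs; zmod.
Qed.

Lemma ev_sgn P w n : opdata P -> homw hgen w -> ev (SA (1 *~ sgn n)) P w = P w *~ sgn n.
Proof.
move=> HP hw; rewrite !mulz_sgn; case: par; last exact: ev_one.
apply/eqP; rewrite -addr_eq0 -(ev_one HP hw) -evAD // addNr.
by apply/eqP; apply: (addrI (ev (SA 0) P w)); rewrite -evAD // !addr0.
Qed.

(** Here the conditions on [P] meet the relations of S: [od_mul] yields those for a b and a x,
    [od_swap] through [act_comm] the commutation of letters, [od_one] the unit. *)
Lemma scong_ev t u P : scong gA gL t u -> opdata P ->
  forall w, homw hgen w -> ev t P w = ev u P w.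
Proof.
move=> tu; elim: tu P => {t u}.
- by [].
- by move=> t u _ IH P HP w hw; rewrite IH.
- by move=> t u v _ IH1 _ IH2 P HP w hw; rewrite IH1 ?IH2.
- by move=> t t' u u' _ IH1 _ IH2 P HP w hw /=; rewrite IH1 ?IH2.
- by move=> t t' _ IH P HP w hw /=; rewrite IH.
- move=> t t' u u' _ IH1 _ IH2 P HP w hw /=; rewrite IH1 //; last exact: ev_opdata.
  by apply: ev_eq => // w' hw'; apply: IH2.
- by move=> *; rewrite /= addrA.
- by move=> *; rewrite /= addrC.
- move=> t P HP w hw; rewrite -[ev (Sadd _ _) P w]/(ev (SA 0) P w + ev t P w).
  have -> : ev (SA 0) P w = 0; last by rewrite add0r.
  by apply: (addrI (ev (SA 0) P w)); rewrite -evAD // !addr0.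
- move=> t P HP w hw; rewrite -[ev (Sadd _ _) P w]/(- ev t P w + ev t P w) addNr.
  have -> // : ev (SA 0) P w = 0.
  by apply: (addrI (ev (SA 0) P w)); rewrite -evAD // !addr0.
- by [].
- move=> t P HP w hw; rewrite -[LHS]/(ev (SA 1) (ev t P) w).
  by apply: ev_one => //; apply: ev_opdata.
- move=> t P HP w hw; rewrite -[LHS]/(ev t (ev (SA 1) P) w).
  by apply: ev_eq => // v hv; apply: ev_one.
- by [].
- by move=> t u v P HP w hw /=; apply: evDr => //; apply: ev_opdata.
- by move=> a b P HP w hw; rewrite evAD.
- move=> a b P HP w hw; rewrite -[RHS]/(ev (SA a) (ev (SA b) P) w).
  elim/(hom_ind grA): a => [m a ha|a a' Ha Ha']; last first.
    by rewrite mulrDl !evAD ?Ha ?Ha' //; apply: ev_opdata.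
  elim/(hom_ind grA): b => [n b hb|b b' Hb Hb']; last first.
    rewrite mulrDr evAD // Hb Hb' -evDr //; try exact: ev_opdata.
    by apply: ev_eq => // v hv; rewrite evAD.
  rewrite (evA HP hw (calgM hA ha hb)).
  rewrite (ev_mulA HP hw ha (hgenA hb)); last by rewrite /gscale /gA_gen /= scaler0.
  rewrite (evA (ev_opdata _ HP) hw ha); apply: act_eq => //; last exact: hgenA.
  by move=> v hv; rewrite (evA HP hv hb).
- by move=> a b P HP w hw; rewrite evLD.
- move=> a x P HP w hw; rewrite -[RHS]/(ev (SA a) (ev (SL x) P) w).
  elim/(hom_ind grA): a => [m a ha|a a' Ha Ha']; last first.
    by rewrite scalerDl evLD // evAD ?Ha ?Ha' //; apply: ev_opdata.
  elim/(hom_ind grL): x => [n x hx|x x' Hx Hx']; last first.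
    rewrite scalerDr evLD // Hx Hx' -evDr //; try exact: ev_opdata.
    by apply: ev_eq => // v hv; rewrite evLD.
  rewrite (evL HP hw (gmodZ hL ha hx)).
  rewrite (ev_mulA HP hw ha (hgenL hx)); last by rewrite /gscale /gL_gen /= mulr0.
  rewrite (evA (ev_opdata _ HP) hw ha); apply: act_eq => //; last exact: hgenA.
  by move=> v hv; rewrite (evL HP hv hx).
- move=> c t P HP w hw; have hc : gA 0 c%:A by apply: (calgZ hA); apply: calg1.
  rewrite -[LHS]/(ev (SA c%:A) (ev t P) w) -[RHS]/(ev t (ev (SA c%:A) P) w).
  rewrite (evA (ev_opdata _ HP) hw hc) -ev_central //.
  by apply: ev_eq => // v hv; rewrite (evA HP hv hc).
- move=> m n a x ha hx P HP w hw.
  rewrite -[LHS]/(ev (SA a) (ev (SL x) P) w).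
  rewrite -[RHS]/(ev (SA (1 *~ sgn (m * n))) (ev (Smul (SL x) (SA a)) P) w).
  rewrite ev_sgn //; last exact: ev_opdata.
  rewrite (evA (ev_opdata _ HP) hw ha) -[ev (Smul _ _) P w]/(ev (SL x) (ev (SA a) P) w).
  rewrite (evL (ev_opdata _ HP) hw hx).
  rewrite (act_eq (Q := act (n, gL_gen x) P)) //; last 2 first.
  - by move=> v hv; rewrite (evL HP hv hx).
  - exact: hgenA.
  rewrite [in RHS](act_eq (Q := act (m, gA_gen a) P)) //; last 2 first.
  - by move=> v hv; rewrite (evA HP hv ha).
  - exact: hgenL.
  by rewrite (act_comm (g := (m, _)) HP) //; [apply: hgenA|apply: hgenL].
- move=> m n a x ha hx P HP w hw.
  rewrite -[LHS]/(ev (SL a) (ev (SL x) P) w).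
  rewrite -[RHS]/(ev (SA (1 *~ sgn (m * n))) (ev (Smul (SL x) (SL a)) P) w).
  rewrite ev_sgn //; last exact: ev_opdata.
  rewrite (evL (ev_opdata _ HP) hw ha) -[ev (Smul _ _) P w]/(ev (SL x) (ev (SL a) P) w).
  rewrite (evL (ev_opdata _ HP) hw hx).
  rewrite (act_eq (Q := act (n, gL_gen x) P)) //; last 2 first.
  - by move=> v hv; rewrite (evL HP hv hx).
  - exact: hgenL.
  rewrite [in RHS](act_eq (Q := act (m, gL_gen a) P)) //; last 2 first.
  - by move=> v hv; rewrite (evL HP hv ha).
  - exact: hgenL.
  by rewrite (act_comm (g := (m, _)) HP) //; apply: hgenL.
Qed.

(* Op w = [..[[Op [::], w_1], w_2] .., w_n] *)
Lemma operator_exists P : opdata P -> exists Op : word -> S -> S,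
  [/\ forall w, homw hgen w -> zmod_morphism (Op w),
      forall w, homw hgen w -> Op w 1 = P w
    & forall w g u, homw hgen w -> hgen g.1 g.2 ->
        Op w (gsym gA gL g.2 * u) =
          (gsym gA gL g.2 * Op w u) *~ sgn (g.1 * (1 + deg w)) + Op (rcons w g) u].
Proof.
move=> HP; pose Op w (u : S) := ev (repr u) P w.
have OpE w t : homw hgen w -> Op w (\pi_S%qT t) = ev t P w.
  by move=> hw; apply: scong_ev => //; apply: repr_scong.
move: Op OpE => Op OpE; exists Op; split=> [w hw u v|w hw|w g u hw hg].
- rewrite -(cl_repr u) -(cl_repr v); move: (repr u) (repr v) => t s.
  have -> : \pi_S%qT t - \pi_S%qT s = \pi_S%qT (Sadd t (Sopp s)).
    by rewrite -sym_addE -sym_oppE.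
  by rewrite !OpE.
- by rewrite -[LHS]/(Op w (\pi_S%qT (SA 1))) OpE // ev_one.
case: g hg => n [a x] hg; have [/= ha hx] := hg.
rewrite -(cl_repr u); move: (repr u) => t; have HQ := ev_opdata t HP.
rewrite /=; have -> : gsym gA gL (a, x) * \pi_S%qT t =
    \pi_S%qT (Sadd (Smul (SA a) t) (Smul (SL x) t)).
  by rewrite /gsym mulrDl -sym_addE -!sym_mulE.
rewrite !OpE //; last by apply/homw_rcons.
rewrite -[LHS]/(ev (SA a) (ev t P) w + ev (SL x) (ev t P) w).
rewrite (evA HQ hw ha) (evL HQ hw hx) -act_add //; [|exact: hgenA|exact: hgenL].
have -> : gA_gen a + gL_gen x = (a, x) by congr pair; rewrite ?addr0 ?add0r.
by [].
Qed.
End OperatorExistence.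

(** * Iterated commutators and order *)

Section IteratedCommutators.
Variables (K : fieldType) (A : algType K) (gA : int -> A -> Prop).
Variables (L : lmodType A) (gL : int -> L -> Prop).
Hypothesis hA : graded_calg gA.
Hypothesis hL : graded_module gA gL.
Local Notation S := (sym gA gL).
Local Notation gS := (@sym_deg K A gA L gL).
Local Notation word := (seq (int * gen L)).
Local Notation hgen := (hgen gA gL).
Local Notation gsym := (gsym gA gL).
Local Notation gA_gen := (gA_gen L).
Local Notation hgenA := (hgenA hL).
Local Notation hgenL := (hgenL hA).

Implicit Types (F G : S -> S).

Lemma sym_word_ind (Q : S -> Prop) : Q 1 ->
  (forall u v, Q u -> Q v -> Q (u + v)) ->
  (forall n g u, hgen n g -> Q u -> Q (gsym g * u)) -> forall u, Q u.
Proof.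
(* The factor 1 is generalized to any [z] with property [Q], so that in a product u v the factor v
   is absorbed first. *)
move=> Q1 QD QM u; rewrite -[u]mulr1; elim/sym_gen: u (1 : S) Q1 => [a|x|u v Hu Hv|u v Hu Hv] z Qz.
- elim/(hom_ind (calg_grading hA)): a => [n a ha|a b Ha Hb].
    by rewrite -(gsymA _ gL); apply: (QM n) => //; apply: hgenA.
  by rewrite symAD mulrDl; apply: QD.
- elim/(hom_ind (gmod_grading hL)): x => [n a ha|a b Ha Hb].
    by rewrite -(gsymL gA); apply: (QM n) => //; apply: hgenL.
  by rewrite symLD mulrDl; apply: QD.
- by rewrite mulrDl; apply: QD; [apply: Hu|apply: Hv].
by rewrite -mulrA; apply: Hu; apply: Hv.
Qed.

(** Order below n in Grothendieck's inductive sense, with commutators taken with generators only;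
    [dop_gcomm] extends them to all homogeneous elements. The degree [e] enters the signs. *)
Fixpoint dop (n : nat) (e : int) (F : S -> S) : Prop :=
  zmod_morphism F /\
  if n is n'.+1 then
    forall d g, hgen d g -> dop n' (e + d) (gcomm e d F ( *%R (gsym g)))
  else forall u, F u = 0.

Lemma zmorphD (F : S -> S) : zmod_morphism F -> {morph F : u v / u + v}.
Proof.
move=> HF u v; have F0 : F 0 = 0 by rewrite -[0 in LHS](subrr 0) HF subrr.
by rewrite -[v in LHS]opprK -[- v]add0r HF HF F0 sub0r opprK.
Qed.

Lemma zmorphN (F : S -> S) : zmod_morphism F -> {morph F : u / - u}.
Proof.
move=> HF u; have F0 : F 0 = 0 by rewrite -[0 in LHS](subrr 0) HF subrr.
by rewrite -[- u]add0r HF F0 sub0r.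
Qed.

Lemma zmorph_sgn (F : S -> S) u n : zmod_morphism F -> F (u *~ sgn n) = F u *~ sgn n.
Proof. by move=> HF; rewrite !mulz_sgn; case: par => //; apply: zmorphN. Qed.

Lemma dop_add n e F G : dop n e F -> dop n e G -> dop n e (fun u => F u + G u).
Proof.
elim: n e F G => [|n IH] e F G /= [aF hF] [aG hG].
  by split=> [u v|u]; rewrite ?aF ?aG ?hF ?hG ?addr0 //; zmod.
split=> [u v|d g hg]; first by rewrite aF aG; zmod.
have -> : gcomm e d (fun u => F u + G u) ( *%R (gsym g)) =
    (fun u => gcomm e d F ( *%R (gsym g)) u + gcomm e d G ( *%R (gsym g)) u).
  by apply/funext => u; rewrite /gcomm mulrDr; signs; zmod.
by apply: IH; [apply: hF|apply: hG].
Qed.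

Lemma dop_sgn n e F m : dop n e F -> dop n e (fun u => F u *~ sgn m).
Proof.
elim: n e F => [|n IH] e F /= [aF hF].
  by split=> [u v|u]; rewrite ?aF ?hF ?mul0rz //; signs; zmod.
split=> [u v|d g hg]; first by rewrite aF; signs; zmod.
have -> : gcomm e d (fun u => F u *~ sgn m) ( *%R (gsym g)) =
    (fun u => gcomm e d F ( *%R (gsym g)) u *~ sgn m).
  by apply/funext => u; rewrite /gcomm symMzr; signs; zmod.
by apply: IH; apply: hF.
Qed.

Lemma dop_mull n e F m v : gS m v -> dop n e F -> dop n (m + e) (fun u => v * F u).
Proof.
move=> hv; elim: n e F => [|n IH] e F /= [aF hF].
  by split=> [u w|u]; [rewrite aF mulrBr|rewrite hF mulr0].
split=> [u w|d g hg]; first by rewrite aF mulrBr.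
have -> : gcomm (m + e) d (fun u => v * F u) ( *%R (gsym g)) =
    (fun u => v * gcomm e d F ( *%R (gsym g)) u).
  apply/funext => u; rewrite /gcomm mulrBr mulrA (sym_comm hA (gsym_deg hg) hv).
  by rewrite symMzl symMzr -mulrA; signs; zmod.
by rewrite -addrA; apply: IH; apply: hF.
Qed.

Lemma dop_mulr n e F m v : gS m v -> dop n e F -> dop n (e + m) (fun u => F (v * u)).
Proof.
move=> hv; elim: n e F => [|n IH] e F /= [aF hF].
  by split=> [u w|u]; [rewrite mulrBr aF|rewrite hF].
split=> [u w|d g hg]; first by rewrite mulrBr aF.
have -> : gcomm (e + m) d (fun u => F (v * u)) ( *%R (gsym g)) =
    (fun u => gcomm e d F ( *%R (gsym g)) (v * u) *~ sgn (m * d)).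
  apply/funext => u; rewrite /gcomm mulrA (sym_comm hA hv (gsym_deg hg)).
  by rewrite symMzl (zmorph_sgn _ _ aF) -mulrA; signs; zmod.
by apply: dop_sgn; rewrite addrAC; apply: IH; apply: hF.
Qed.

Lemma gcommM e m n F (u v : S) : gS m u -> gS n v ->
  gcomm e (m + n) F ( *%R (u * v)) =
  (fun x => gcomm e m F ( *%R u) (v * x) + (u * gcomm e n F ( *%R v) x) *~ sgn (e * m)).
Proof.
move=> hu hv; apply/funext => x; rewrite /gcomm mulrBr symMzr -!mulrA.
signs; zmod.
Qed.

Lemma gcommD e n F (u v : S) : zmod_morphism F ->
  gcomm e n F ( *%R (u + v)) =
  (fun x => gcomm e n F ( *%R u) x + gcomm e n F ( *%R v) x).
Proof.
move=> aF; apply/funext => x; rewrite /gcomm !mulrDl (zmorphD aF).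
signs; zmod.
Qed.

(** [F, u v] is a combination of [F, u] v and u [F, v], and multiplications do not raise the
    order. *)
Lemma dop_gcomm n e F d u : dop n.+1 e F -> gS d u ->
  dop n (e + d) (gcomm e d F ( *%R u)).
Proof.
move=> [aF hF]; elim=> {d u} [m a ha|m x hx|m u v _ IH1 _ IH2|m k u v hu IH1 hv IH2].
- by rewrite -(gsymA _ gL); apply: hF; apply: hgenA.
- by rewrite -(gsymL gA); apply: hF; apply: hgenL.
- by rewrite gcommD //; apply: dop_add.
rewrite gcommM //; apply: dop_add.
  by rewrite addrA; apply: dop_mulr.
by apply: dop_sgn; rewrite addrCA; apply: dop_mull.
Qed.

Lemma dop_icomm n e F s : dop n e F -> homw gS s -> size s = n ->
  forall u, icomm e F s u = 0.
Proof.
elim: s n e F => [|[d u] s IH] [|n] e F //=; first by case.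
by move=> HF [hu hs] [sz] x; apply: (IH n) => //; apply: dop_gcomm.
Qed.

Lemma icomm_dop n e F s : dop (size s + n)%N e F -> homw gS s ->
  dop n (e + deg s) (icomm e F s).
Proof.
elim: s e F => [|[d u] s IH] e F /=; first by rewrite deg_nil addr0.
move=> HF [hu hs]; rewrite deg_cons addrA; apply: IH => //.
exact: dop_gcomm.
Qed.

Section OperatorFamily.
Variables (P : word -> S) (Op : word -> S -> S).
Hypothesis OpB : forall w, homw hgen w -> zmod_morphism (Op w).
Hypothesis Op1 : forall w, homw hgen w -> Op w 1 = P w.
Hypothesis OpM : forall w g u, homw hgen w -> hgen g.1 g.2 ->
  Op w (gsym g.2 * u) = (gsym g.2 * Op w u) *~ sgn (g.1 * (1 + deg w)) + Op (rcons w g) u.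

Lemma Op_eq0 w u : homw hgen w -> (forall v, homw hgen v -> P (w ++ v) = 0) -> Op w u = 0.
Proof.
elim/sym_word_ind: u w => [|u v Hu Hv|n g u hg Hu] w hw Hw.
- by rewrite Op1 // -[w]cats0 Hw.
- by rewrite (zmorphD (OpB hw)) Hu ?Hv ?addr0.
rewrite (OpM (g := (n, g))) // Hu // mulr0 mul0rz add0r Hu //; first exact/homw_rcons.
by move=> v hv; rewrite cat_rcons; apply: Hw.
Qed.

Lemma gcomm_Op w d g : homw hgen w -> hgen d g ->
  gcomm (1 + deg w) d (Op w) ( *%R (gsym g)) = Op (rcons w (d, g)).
Proof.
move=> hw hg; apply/funext => u; rewrite /gcomm (OpM (g := (d, g))) //=.
by rewrite mulrC addrC addKr.
Qed.

Lemma icomm_Op w v : homw hgen w -> homw hgen v ->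
  icomm (1 + deg w) (Op w) [seq (g.1, gsym g.2) | g <- v] = Op (w ++ v).
Proof.
elim: v w => [|[d g] v IH] w hw /=; first by rewrite cats0.
move=> [hg hv]; rewrite gcomm_Op // -cat_rcons -IH //; last exact/homw_rcons.
by rewrite deg_rcons addrA.
Qed.

Lemma dop_Op n w : homw hgen w ->
  (forall v, homw hgen v -> (n <= size v)%N -> P (w ++ v) = 0) ->
  dop n (1 + deg w) (Op w).
Proof.
elim: n w => [|n IH] w hw Hw; split; try exact: OpB.
  by move=> u; apply: Op_eq0 => // v hv; apply: Hw.
move=> d g hg; rewrite gcomm_Op //.
have -> : 1 + deg w + d = 1 + deg (rcons w (d, g)) by rewrite deg_rcons addrA.
apply: IH; first exact/homw_rcons.
by move=> v hv lv; rewrite cat_rcons; apply: Hw.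
Qed.

Hypothesis P_deg : forall w, homw hgen w -> gS (1 + deg w) (P w).

Lemma Op_deg w n u : homw hgen w -> gS n u -> gS (1 + deg w + n) (Op w u).
Proof.
have Hmul d u' : gS d u' -> forall m v,
    (forall w, homw hgen w -> gS (1 + deg w + m) (Op w v)) ->
    forall w, homw hgen w -> gS (1 + deg w + (d + m)) (Op w (u' * v)).
  have Hgen k g m v : hgen k g -> (forall w, homw hgen w -> gS (1 + deg w + m) (Op w v)) ->
      forall w, homw hgen w -> gS (1 + deg w + (k + m)) (Op w (gsym g * v)).
    move=> hg Hv w' hw; rewrite (OpM (g := (k, g))) //; apply: symdegD.
      apply: (sym_deg_sgn hA); rewrite addrCA; apply: symdegM; [exact: gsym_deg|exact: Hv].
    apply: sym_degS (Hv _ _); last exact/homw_rcons.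
    by rewrite deg_rcons /= !addrA.
  elim=> {d u'} [k a ha|k x hx|k u1 u2 _ H1 _ H2|k1 k2 u1 u2 _ H1 _ H2] m v Hv w' hw.
  - by rewrite -(gsymA _ gL); apply: Hgen => //; apply: hgenA.
  - by rewrite -(gsymL gA); apply: Hgen => //; apply: hgenL.
  - by rewrite mulrDl (zmorphD (OpB hw)); apply: symdegD; [apply: H1|apply: H2].
  rewrite -mulrA -[_ + _ + m]addrA; apply: H1 => //; exact: H2.
move=> hw hu; rewrite -[u]mulr1 -[n]addr0; apply: Hmul => // w' hw'.
by rewrite addr0 Op1 //; apply: P_deg.
Qed.

Definition gprod (v : word) : S := \prod_(g <- v) gsym g.2.

(** Iterated Leibniz rule: each letter of [v] either passes to the left of the operator, into [a],
    or enters it as a commutator, into [b]. *)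
Lemma Op_gprod w v u : homw hgen w -> homw hgen v ->
  Op w (gprod v * u) =
  spl (fun a b => (gprod a * Op (w ++ b) u) *~ sgn (deg a * (1 + deg w))) v.
Proof.
elim: v w => [|g v IH] w hw.
  by rewrite /= /gprod big_nil mul1r cats0 mul1r deg_nil mul0r.
move=> [hg hv]; rewrite /gprod big_cons -mulrA OpM // -/(gprod v) /=.
rewrite IH // IH //; last exact/homw_rcons.
congr (_ + _); rewrite ?mulr_spll -?spl_sgn; apply: eq_spl => a b _ _.
  by rewrite /gprod big_cons deg_cons -mulrA; signs.
by rewrite cat_rcons deg_rcons; signs.
Qed.
End OperatorFamily.
End IteratedCommutators.

(** * The iterated commutators of D_k *)

Section ListForms.
Variables (K : fieldType) (A : algType K) (gA : int -> A -> Prop).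
Variables (L : lmodType A) (gL : int -> L -> Prop).
Variables (X : seq L -> L) (sg De : seq L -> A -> A).
Hypothesis hLR : LR_infty gA gL X sg.
Hypothesis hDe : right_connection gA gL sg De.
Local Notation lword := (seq (int * L)).
Implicit Types (w v : lword).

Lemma X_swap : swapw gL (fun w => X (unzip2 w)).
Proof. exact: graded_symmetric_swap (LR_Xsym hLR). Qed.

Lemma sg_swap a : swapw gL (fun w => sg (unzip2 w) a).
Proof. exact: graded_symmetric_swap (LR_sgsym hLR a). Qed.

Lemma De_swap q : swapw gL (fun w => De (unzip2 w) q).
Proof. exact: graded_symmetric_swap (rc_sym hDe q). Qed.

Lemma X_deg w : homw gL w -> gL (1 + deg w) (X (unzip2 w)).
Proof. by move=> /homw_homs/(LR_Xdeg hLR). Qed.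

Lemma sg_deg w m a : homw gL w -> gA m a -> gA (1 + deg w + m) (sg (unzip2 w) a).
Proof. by move=> /homw_homs hw; apply: (LR_sgdeg hLR hw). Qed.

Lemma De_deg w m q : homw gL w -> gA m q -> gA (1 + deg w + m) (De (unzip2 w) q).
Proof. by move=> /homw_homs hw; apply: (rc_deg hDe hw). Qed.

Lemma sg_mul w m a b : homw gL w -> gA m a ->
  sg (unzip2 w) (a * b) =
    sg (unzip2 w) a * b + (a * sg (unzip2 w) b) *~ sgn ((1 + deg w) * m).
Proof. by move=> /homw_homs hw; apply: (LR_sgder hLR b hw). Qed.

Lemma sg_scale w s x m a b : homw gL w -> gA m a ->
  sg (unzip2 w ++ a *: x :: s) b =
    (a * sg (unzip2 w ++ x :: s) b) *~ sgn (m * (1 + deg w)).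
Proof. by move=> /homw_homs hw; apply: (LR_sgscale hLR s x b hw). Qed.

Lemma X_leibniz w x m a : homw gL w -> gA m a ->
  X (rcons (unzip2 w) (a *: x)) =
    sg (unzip2 w) a *: x + (a *: X (rcons (unzip2 w) x)) *~ sgn ((1 + deg w) * m).
Proof. by move=> /homw_homs hw; apply: (LR_leibniz hLR x hw). Qed.

Lemma De_mul w m a q : homw gL w -> gA m a ->
  De (unzip2 w) (a * q) =
    (a * De (unzip2 w) q) *~ sgn ((1 + deg w) * m) - sg (unzip2 w) a * q.
Proof. by move=> /homw_homs hw ha; rewrite -mulNr; apply: (rc_symbol hDe q hw). Qed.

Lemma De_scale w n x m a q : homw gL w -> gL n x -> gA m a ->
  De (rcons (unzip2 w) (a *: x)) q =
    De (rcons (unzip2 w) x) (a * q) *~ sgn (m * n).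
Proof.
move=> /homw_homs hw hx ha; rewrite -!cats1.
have h0 : homs gL [tuple] [tuple] by case.
have := rc_scale hDe q hw hx h0 ha; rewrite /derR_scale /= => ->.
have -> : degsum [tuple] = 0 by rewrite /degsum big_nil.
by rewrite -[degsum _]/(deg w); signs.
Qed.

Lemma X_add : multiadditive X. Proof. exact: LR_Xadd hLR. Qed.
Lemma sg_add a : multiadditive (sg ^~ a). Proof. exact: LR_sgadd hLR a. Qed.
Lemma De_add q : multiadditive (De ^~ q). Proof. exact: rc_add hDe q. Qed.

Lemma sg1 w : homw gL w -> gA 0 1 -> sg (unzip2 w) 1 = 0.
Proof.
move=> hw h1; have := sg_mul 1 hw h1; rewrite !mulr1 mul1r mulr0 mulr1z.
by move=> E; apply: (addrI (sg (unzip2 w) 1)); rewrite addr0 -E.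
Qed.

End ListForms.

Section BracketData.
Variables (K : fieldType) (A : algType K) (gA : int -> A -> Prop).
Variables (L : lmodType A) (gL : int -> L -> Prop).
Hypothesis hA : graded_calg gA.
Hypothesis hL : graded_module gA gL.
Local Notation S := (sym gA gL).
Local Notation gS := (@sym_deg K A gA L gL).
Local Notation iA := (symA gA gL).
Local Notation iL := (symL gA gL).
Local Notation word := (seq (int * gen L)).
Local Notation hgen := (hgen gA gL).
Local Notation gsym := (gsym gA gL).
Local Notation gA_gen := (gA_gen L).
Implicit Types (w v : word) (f : seq L -> A -> A).

Definition lword w : seq (int * L) := [seq (g.1, g.2.2) | g <- w].
Definition lpart w : seq L := unzip2 (lword w).

Lemma lword_hom w : homw hgen w -> homw gL (lword w).
Proof. by elim: w => //= g w IH [[_ hg] /IH hw]. Qed.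

Lemma deg_lword w : deg (lword w) = deg w.
Proof. by rewrite /deg /lword /unzip1 -map_comp. Qed.

Lemma lpart_rcons w g : lpart (rcons w g) = rcons (lpart w) g.2.2.
Proof. by rewrite /lpart /lword /unzip2 !map_rcons. Qed.

(* The sum over i of f(.. without i .. | a_i), with the sign of moving a_i to the
   end, for the word (a_1, x_1) .. (a_n, x_n). *)
Fixpoint tau f w : A :=
  if w is g :: w' then
    f (lpart w') g.2.1 *~ sgn (g.1 * deg w') + tau (fun s => f (g.2.2 :: s)) w'
  else 0.

Definition fswap f := forall a, swapw gL (fun s => f (unzip2 s) a).

Lemma fswap_cons f n x : gL n x -> fswap f -> fswap (fun s => f (x :: s)).
Proof. by move=> hx hf a w1 g h w2 hw; apply: (hf a ((n, x) :: w1) g h w2). Qed.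

Lemma tau_eq f f' w :
  (forall s a, homw gL s -> f (unzip2 s) a = f' (unzip2 s) a) ->
  homw hgen w -> tau f w = tau f' w.
Proof.
elim: w f f' => //= g w IH f f' h [[_ hx] hw]; congr (_ *~ _ + _).
  by apply: h; apply: lword_hom.
by apply: IH => // s a hs; apply: (h ((g.1, g.2.2) :: s)).
Qed.

Lemma tau_sgn f w n : tau (fun s a => f s a *~ sgn n) w = tau f w *~ sgn n.
Proof.
elim: w f => [|g w IH] f /=; first by rewrite mul0rz.
by rewrite (IH (fun s => f (g.2.2 :: s))); signs; zmod.
Qed.

Lemma tau_swap f : fswap f -> swapw hgen (tau f).
Proof.
move=> hf w1; elim: w1 f hf => [|k w1 IH] f hf g h w2 /=.
  move=> [[hga hgx] [[hha hhx] hw]].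
  have -> : tau (fun s => f [:: g.2.2, h.2.2 & s]) w2 =
      tau (fun s => f [:: h.2.2, g.2.2 & s]) w2 *~ sgn (g.1 * h.1).
    rewrite -tau_sgn; apply: tau_eq => // s a hs.
    exact: (hf a [::] (g.1, g.2.2) (h.1, h.2.2) s).
  have lp (k : int * gen L) : lpart (k :: w2) = k.2.2 :: lpart w2 by [].
  by rewrite !lp !deg_cons; signs; zmod.
move=> [[hka hkx] hw]; rewrite (IH _ (fswap_cons hkx hf)) //.
have -> : f (lpart (w1 ++ [:: g, h & w2])) k.2.1 =
    f (lpart (w1 ++ [:: h, g & w2])) k.2.1 *~ sgn (g.1 * h.1).
  rewrite /lpart /lword !map_cat; apply: (hf _ (lword w1) (g.1, g.2.2) (h.1, h.2.2)).
  by have := lword_hom hw; rewrite /lword map_cat.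
by rewrite !deg_cat !deg_cons; signs; zmod.
Qed.

Definition fadd f := (forall a, multiadditive (f ^~ a)) /\
  forall s a b, f s (a + b) = f s a + f s b.

Lemma fadd_cons f x : fadd f -> fadd (fun s => f (x :: s)).
Proof. by move=> [h1 h2]; split=> [a s1|s]; [apply: (h1 a (x :: s1))|apply: h2]. Qed.

Lemma fadd_rcons0 f s a : fadd f -> f (rcons s 0) a = 0.
Proof. by move=> [h _]; rewrite -cats1 (multiadditive0 _ _ (h a)). Qed.

Lemma tau_add f w n g h : fadd f ->
  tau f (rcons w (n, g + h)) = tau f (rcons w (n, g)) + tau f (rcons w (n, h)).
Proof.
elim: w f => [|k w IH] f hf /=.
  by rewrite deg_nil mulr0 !mulr1z !addr0; apply: hf.2.
rewrite IH; last exact: fadd_cons.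
rewrite !lpart_rcons -!cats1 hf.1 !deg_cat !deg_cons /=; signs; zmod.
Qed.

(** A letter from A has L-component 0, which annihilates every term except the one that removes this
    letter. *)
Lemma tau_rcons0 f w n a : fadd f ->
  tau f (rcons w (n, gA_gen a)) = f (lpart w) a.
Proof.
elim: w f => [|k w IH] f hf /=.
  by rewrite deg_nil mulr0 mulr1z addr0.
rewrite IH; last exact: fadd_cons.
by rewrite lpart_rcons /= (fadd_rcons0 _ _ hf) mul0rz add0r.
Qed.

Lemma tau_rcons2 f w m n a g : fadd f ->
  tau f (rcons (rcons w (m, gA_gen a)) (n, g)) =
  f (rcons (lpart w) g.2) a *~ sgn (m * n).
Proof.
elim: w f => [|k w IH] f hf /=.
  rewrite !deg_cons !deg_nil !addr0 mulr0 mulr1z.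
  by rewrite (fadd_rcons0 [::] _ hf) addr0.
rewrite IH; last exact: fadd_cons.
rewrite !lpart_rcons -!cats1 -catA /= (multiadditive0 _ _ (hf.1 _)).
by rewrite mul0rz add0r.
Qed.

Lemma lpart_cat v w : lpart (v ++ w) = lpart v ++ lpart w.
Proof. by rewrite /lpart /lword /unzip2 !map_cat. Qed.

Lemma tau_eq0 f w : (forall s a, f s a = 0) -> tau f w = 0.
Proof. by elim: w f => //= g w IH f h; rewrite h mul0rz add0r IH. Qed.

(** Whichever letter is removed, the 0 of one of the two letters from A remains among the
    arguments. *)
Lemma tau_AA f v1 v2 v3 m n a b : fadd f ->
  tau f (v1 ++ (m, gA_gen a) :: v2 ++ (n, gA_gen b) :: v3) = 0.
Proof.
elim: v1 f => [|g v1 IH] f hf /=.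
  rewrite tau_eq0; last by move=> s c; rewrite (multiadditive0 [::] s (hf.1 c)).
  by rewrite lpart_cat [lpart (_ :: v3)]/= (multiadditive0 _ _ (hf.1 _)) mul0rz addr0.
rewrite IH; last exact: fadd_cons.
by rewrite lpart_cat (multiadditive0 _ _ (hf.1 _)) mul0rz addr0.
Qed.

(** [e] stands for 1 plus the degrees of the letters already absorbed into [f] by the recursion. *)
Lemma tau_scale f w (e m n : int) a x : homw hgen w ->
  (forall s b, homw gL s -> f (rcons (unzip2 s) (a *: x)) b =
     (a * f (rcons (unzip2 s) x) b) *~ sgn (m * (e + deg s))) ->
  (forall s, f s 0 = 0) ->
  tau f (rcons w (m + n, gL_gen (a *: x))) =
  (a * tau f (rcons w (n, gL_gen x))) *~ sgn (m * (e + deg w)).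
Proof.
elim: w f e => [|k w IH] f e /=.
  by move=> _ _ h; rewrite !h !mul0rz !addr0 mulr0 mul0rz.
move=> [[hka hkx] hw] h h0; rewrite (IH _ (e + k.1)) //; last first.
  by move=> s b hs; have := h ((k.1, k.2.2) :: s) b (conj hkx hs); rewrite deg_cons addrA.
rewrite !lpart_rcons h; last exact: lword_hom.
by rewrite -/(lpart w) deg_lword !deg_rcons deg_cons !mulrDr !mulrzAr /=; signs; zmod.
Qed.

Lemma tau_deg f w e : homw hgen w ->
  (forall s m b, homw gL s -> gA m b -> gA (e + deg s + m) (f (unzip2 s) b)) ->
  gA (e + deg w) (tau f w).
Proof.
have grA := calg_grading hA.
elim: w f e => [|k w IH] f e /=; first by move=> *; apply: grading0.
move=> [[hka hkx] hw] h; apply: (grD grA).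
  apply: (gr_sgn grA); have := h _ _ _ (lword_hom hw) hka.
  by rewrite deg_lword deg_cons -!addrA [k.1 + _]addrC.
rewrite deg_cons addrA; apply: IH => // s m b hs hb.
by have := h ((k.1, k.2.2) :: s) _ _ (conj hkx hs) hb; rewrite deg_cons !addrA.
Qed.

Variables (X : seq L -> L) (sg De : seq L -> A -> A).
Hypothesis hLR : LR_infty gA gL X sg.
Hypothesis hDe : right_connection gA gL sg De.

Lemma sg_fadd : fadd sg.
Proof. by split=> [a|]; [apply: sg_add hLR _|exact: LR_sgadd_der hLR]. Qed.

(* The iterated commutators of D_k with the letters of w, applied to 1.  Only
   Delta_k(s|1) and sigma_k are needed, as Delta_k(s|q) is +/- q Delta_k(s|1) - sigma_k(s|q). *)
Definition phi (k : nat) w : S :=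
  (if size w == k then iL (X (lpart w)) + iA (tau sg w) else 0)
  - (if (size w).+1 == k then iA (De (lpart w) 1) else 0).

Lemma phi_opdata k : opdata (phi k).
Proof.
have X0 s : X (rcons s 0) = 0 by rewrite -cats1 multiadditive0 //; apply: X_add hLR.
have De0 s q : De (rcons s 0) q = 0.
  by rewrite -cats1 (multiadditive0 _ _ (De_add hDe q)).
have lw_cat w1 g h w2 : lword (w1 ++ [:: g, h & w2]) =
   lword w1 ++ [:: (g.1, g.2.2), (h.1, h.2.2) & lword w2] by rewrite /lword map_cat.
split.
- move=> w1 g h w2 hw; have := lword_hom hw; rewrite lw_cat => hlw.
  rewrite /phi /lpart !lw_cat !size_cat /=.
  rewrite (tau_swap (sg_swap hLR) hw) (X_swap hLR hlw) (De_swap hDe 1 hlw).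
  rewrite !raddfMz /=.
  by do 2!case: eqP => _; signs; zmod.
- move=> w n g h hw hg hh; rewrite /phi !lpart_rcons !size_rcons /=.
  rewrite tau_add; last exact: sg_fadd.
  rewrite -!cats1 (X_add hLR) (De_add hDe 1) !raddfD /=.
  by do 2!case: eqP => _; zmod.
- move=> w c hw; rewrite /phi !lpart_rcons !size_rcons /= X0 De0 !raddf0.
  rewrite tau_rcons0; last exact: sg_fadd.
  rewrite (LR_sgscale_der hLR) (sg1 hLR (lword_hom hw) (calg1 hA)) scaler0 raddf0.
  by do 2!case: eqP => _; rewrite ?addr0 ?subr0.
move=> w m a n g hw ha hg; rewrite /phi !lpart_rcons !size_rcons /=.
have hlw := lword_hom hw; have fsg := sg_fadd.
rewrite !(tau_rcons0 _ _ _ fsg) !(tau_rcons2 _ _ _ _ _ fsg) X0 !De0.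
have -> : X (rcons (rcons (lpart w) 0) g.2) = 0.
  by rewrite -!cats1 -catA /= multiadditive0 //; apply: X_add hLR.
have -> : De (rcons (rcons (lpart w) 0) g.2) 1 = 0.
  by rewrite -!cats1 -catA /= (multiadditive0 _ _ (De_add hDe 1)).
rewrite !raddf0 add0r.
have tau_split p h : tau sg (rcons w (p, h)) =
    sg (lpart w) h.1 + tau sg (rcons w (p, gL_gen h.2)).
  rewrite -(tau_rcons0 w p h.1 fsg) -tau_add //; congr (tau _ (rcons _ (_, _))).
  by case: h => b y; congr pair; rewrite /= ?addr0 ?add0r.
have sga : gS (1 + deg w + m) (iA (sg (lpart w) a)).
  by apply: symdegA; rewrite -deg_lword; apply: (sg_deg hLR).
(* Length k: the Leibniz rule of [X] and the derivation rule and linearity of [sg]; the longer word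
   contributes 0. *)
case: (eqVneq (size w).+1 k) => [<-|_].
  have -> : ((size w).+2 == (size w).+1) = false by lia.
  have -> : ((size w).+3 == (size w).+1) = false by lia.
  rewrite !subr0 addr0 (X_leibniz hLR _ hlw ha).
  rewrite (tau_split (m + n)) (tau_split n g) /= (sg_mul hLR _ hlw ha).
  rewrite (@tau_scale _ _ 1 _ _ _ _ hw); last 2 first.
  - by move=> s b hs; rewrite -!cats1 (sg_scale hLR [::] _ _ hs ha).
  - by move=> s; apply: (addrI (sg s 0)); rewrite -(LR_sgadd_der hLR) !addr0.
  rewrite -/(lpart w) deg_lword (sym_comm hA (gsym_deg hg) sga) gsymE.
  rewrite !raddfD !raddfMz /= !symLZ !symAM !mulrDr.
  by signs; zmod.
(* Length k - 1: [De_scale] moves a into the argument 1 of Delta. The symbol term that appears when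
   a is taken out again is the value on the longer word, where sigma acts on a. *)
case: (eqVneq (size w).+2 k) => [<-|_].
  have -> : ((size w).+3 == (size w).+2) = false by lia.
  have h1 : gA 0 1 := calg1 hA.
  rewrite !subr0 !sub0r add0r (De_scale hDe _ hlw hg.2 ha) mulr1 -[a in LHS]mulr1.
  have hlwx : homw gL (rcons (lword w) (n, g.2)) by apply/homw_rcons; split=> //; apply: hg.2.
  have -> : rcons (lpart w) g.2 = unzip2 (rcons (lword w) (n, g.2)).
    by rewrite /unzip2 map_rcons.
  rewrite (De_mul hDe _ hlwx ha) mulr1 deg_rcons deg_lword /=.
  rewrite !raddfMz raddfB /= raddfMz /= symAM mulr0; signs; zmod.
by rewrite if_same !subr0 !mulr0 !mul0rz !addr0.
Qed.

Lemma phi_deg k w : homw hgen w -> gS (1 + deg w) (phi k w).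
Proof.
move=> hw; have hlw := lword_hom hw; rewrite /phi; apply: (sym_degB hA).
  case: eqP => _; last exact: (sym_deg0 gL hA).
  rewrite -deg_lword; apply: symdegD; first by apply: symdegL; apply: (X_deg hLR).
  rewrite deg_lword; apply: symdegA; apply: tau_deg => // s m b; exact: (sg_deg hLR).
case: eqP => _; last exact: (sym_deg0 gL hA).
rewrite -deg_lword -[1 + _]addr0; apply: symdegA; apply: (De_deg hDe) => //.
exact: (calg1 hA).
Qed.

Lemma phi_eq0 k w : (k < size w)%N -> phi k w = 0.
Proof.
by move=> h; rewrite /phi !gtn_eqF ?subr0 // ltnW.
Qed.
End BracketData.

(** * The operators D_k *)

Lemma spl_map (V W : Type) (M : zmodType) (h : int * V -> int * W)
    (f : seq (int * W) -> seq (int * W) -> M) (w : seq (int * V)) :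
  (forall g, (h g).1 = g.1) ->
  spl f (map h w) = spl (fun a b => f (map h a) (map h b)) w.
Proof.
move=> hE; have degE s : deg (map h s) = deg s.
  by rewrite /deg /unzip1 -map_comp; congr degsum; apply: eq_map => g; apply: hE.
elim: w f => //= g w IH f; rewrite !IH; congr (_ + _).
by apply: eq_spl => a b _ _; rewrite hE degE.
Qed.

Lemma spl_rcons (V : Type) (M : zmodType) (f : seq (int * V) -> seq (int * V) -> M) w g :
  spl f (rcons w g) = spl (fun a b => f (rcons a g) b *~ sgn (g.1 * deg b)
                                    + f a (rcons b g)) w.
Proof.
elim: w f => [|x w IH] f /=; first by rewrite deg_nil !mulr0 !mulr1z.
rewrite !IH; congr (_ + _); apply: eq_spl => a b _ _.
by rewrite !deg_rcons !deg_cons; signs; zmod.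
Qed.

Lemma unshuffle_zip (V : eqType) (M : zmodType) n i j (d : n.-tuple int)
    (v : n.-tuple V) (F : seq (int * V) -> seq (int * V) -> M) :
  \sum_(p in unshuffle n i j)
     F (zip (take i (permt p d)) (take i (permt p v)))
       (zip (drop i (permt p d)) (drop i (permt p v))) *~ koszul d p =
  spl (fun a b => if (size a == i) && (size b == j) then F a b else 0) (zip d v).
Proof.
have tnthE (d' : n.-tuple int) (v' : n.-tuple V) k :
    tnth (zip_tuple d' v') k = (tnth d' k, tnth v' k).
  by rewrite (tnth_nth (0, tnth v' k)) /= nth_zip ?size_tuple // -!tnth_nth.
rewrite -[zip d v]/(tval (zip_tuple d v)) -unshuffle_spl; apply: eq_bigr => p _.
have take_zipE i0 (s : seq int) (t : seq V) :
    take i0 (zip s t) = zip (take i0 s) (take i0 t).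
  by elim: i0 s t => [|i' IH] [|x s] [|y t] //=; rewrite IH.
have drop_zipE i0 (s : seq int) (t : seq V) : size s = size t ->
    drop i0 (zip s t) = zip (drop i0 s) (drop i0 t).
  by elim: i0 s t => [|i' IH] [|x s] [|y t] //= [/IH].
have -> : permt p (zip_tuple d v) = zip (permt p d) (permt p v) :> seq _.
  rewrite -[RHS]/(tval (zip_tuple (permt p d) (permt p v))); congr tval.
  apply: eq_from_tnth => k; rewrite !tnth_mktuple !tnthE.
  by rewrite !tnth_mktuple.
rewrite take_zipE drop_zipE ?size_tuple //; congr (_ *~ koszul _ _).
by apply: eq_from_tnth => k; rewrite tnth_map tnthE.
Qed.

Lemma unshuffles_spl (V : eqType) (M : zmodType) n (d : n.-tuple int) (v : n.-tuple V)
    (F : seq (int * V) -> seq (int * V) -> M) :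
  \sum_(i < n.+1) \sum_(p in unshuffle n i (n - i))
     F (zip (take i (permt p d)) (take i (permt p v)))
       (zip (drop i (permt p d)) (drop i (permt p v))) *~ koszul d p =
  spl F (zip d v).
Proof.
under eq_bigr do rewrite unshuffle_zip.
rewrite -(spl_sum (index_enum _) (fun (i : 'I_n.+1) a b =>
  if (size a == i) && (size b == n - i)%N then F a b else 0)).
apply: eq_spl => a b; rewrite size_zip !size_tuple minnn => sz _.
(* Each splitting is counted for exactly one i, the length of [a]. *)
have an : (size a < n.+1)%N by lia.
rewrite (bigD1 (Ordinal an)) //= eqxx -{1}sz addKn eqxx /= big1 ?addr0 // => i.
by rewrite -val_eqE /= => /negbTE; rewrite eq_sym => ->.
Qed.

Section Operators.
Variables (K : fieldType) (A : algType K) (gA : int -> A -> Prop).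
Variables (L : lmodType A) (gL : int -> L -> Prop).
Hypothesis hA : graded_calg gA.
Hypothesis hL : graded_module gA gL.
Variables (X : seq L -> L) (sg De : seq L -> A -> A).
Hypothesis hLR : LR_infty gA gL X sg.
Hypothesis hDe : right_connection gA gL sg De.
Local Notation S := (sym gA gL).
Local Notation gS := (@sym_deg K A gA L gL).
Local Notation iA := (symA gA gL).
Local Notation iL := (symL gA gL).
Local Notation word := (seq (int * gen L)).
Local Notation lword := (seq (int * L)).
Local Notation hgen := (hgen gA gL).
Local Notation gsym := (gsym gA gL).
Local Notation gA_gen := (gA_gen L).
Local Notation symprod := (symprod gA gL).
Local Notation phi := (phi gA gL X sg De).

Variable Op : nat -> word -> S -> S.
Hypothesis OpB : forall k w, homw hgen w -> zmod_morphism (Op k w).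
Hypothesis Op1 : forall k w, homw hgen w -> Op k w 1 = phi k w.
Hypothesis OpM : forall k w g u, homw hgen w -> hgen g.1 g.2 ->
  Op k w (gsym g.2 * u) =
    (gsym g.2 * Op k w u) *~ sgn (g.1 * (1 + deg w)) + Op k (rcons w g) u.

Definition gword (w : lword) : word := [seq (g.1, gL_gen g.2) | g <- w].

Lemma gword_hom w : homw gL w -> homw hgen (gword w).
Proof. by elim: w => //= g w IH [hg hw]; split; [apply: hgenL|apply: IH]. Qed.

Lemma deg_gword w : deg (gword w) = deg w.
Proof. by rewrite /deg /gword /unzip1 -map_comp. Qed.

Lemma lpart_gword w : lpart (gword w) = unzip2 w.
Proof. by rewrite /lpart /lword /gword /unzip2 -!map_comp. Qed.

Lemma tau_gword f w : (forall s, f s 0 = 0) -> tau f (gword w) = 0.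
Proof. by elim: w f => //= g w IH f h; rewrite h mul0rz add0r IH. Qed.

Lemma gprod_gword w : gprod gA gL (gword w) = symprod (unzip2 w).
Proof.
by rewrite /gprod /symprod /gword !big_map; apply: eq_bigr => g _; rewrite gsymL.
Qed.

Lemma symprod_deg w : homw gL w -> gS (deg w) (symprod (unzip2 w)).
Proof.
elim: w => [_|g w IH [hg hw]].
  by rewrite /symprod big_nil deg_nil; apply: (sym_deg1 gL hA).
rewrite /symprod big_cons deg_cons; apply: symdegM; last exact: IH.
exact: symdegL.
Qed.

(** The iterated commutator of D_k with the letters [b] of L, evaluated on q in A. *)
Definition Fop k (b : lword) q : S :=
  (if size b == k then iL (X (unzip2 b)) * iA q else 0)
  - (if (size b).+1 == k then iA (De (unzip2 b) q) else 0).

Lemma FopE k b q : Fop k b q =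
  (if size b == k then iL (X (unzip2 b)) * iA q else 0)
  - (if (size b).+1 == k then iA (De (unzip2 b) q) else 0).
Proof. by []. Qed.

(** Writing q as q 1 gives +/- q phi(b) + phi(b q); the sigma in the second term turns +/- q
    Delta(b|1) into Delta(b|q). *)
Lemma Op_A k b q : homw gL b -> Op k (gword b) (iA q) = Fop k b q.
Proof.
move=> hb; have hgb := gword_hom hb.
elim/(hom_ind (calg_grading hA)): q => [m q hq|q r Hq Hr]; last first.
  rewrite raddfD (zmorphD (OpB k hgb)) Hq Hr /Fop (rc_add_op hDe) !raddfD /= mulrDr.
  by do 2!case: eqP => _; zmod.
have := OpM k (g := (m, gA_gen q)) 1 hgb (hgenA hL hq); rewrite /= gsymA mulr1 => ->.
rewrite !Op1 //; last by apply/homw_rcons; split=> //; apply: hgenA.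
have s0 s : sg s 0 = 0 by apply: (addrI (sg s 0)); rewrite -(LR_sgadd_der hLR) !addr0.
rewrite /phi tau_gword // raddf0 addr0 tau_rcons0; last exact: sg_fadd hLR.
rewrite lpart_rcons lpart_gword size_rcons /gword size_map -/(gword b) deg_gword /=.
rewrite -!cats1 (multiadditive0 _ _ (De_add hDe 1)) (multiadditive0 _ _ (X_add hLR)).
rewrite !raddf0 add0r if_same subr0 /Fop.
have hX : gS (1 + deg b) (iL (X (unzip2 b))) by apply: symdegL; apply: (X_deg hLR hb).
case: (eqVneq (size b) k) => [<-|_].
  rewrite (eq_sym (size b).+1) (ltn_eqF (ltnSn _)) !subr0 addr0.
  by rewrite (sym_comm hA hX (symdegA gL hq)); signs.
rewrite !sub0r; case: eqP => _; last by rewrite oppr0 mulr0 mul0rz addr0.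
rewrite -[q in RHS]mulr1 (De_mul hDe _ hb hq) mulr1 raddfB raddfMz /= symAM.
signs; zmod.
Qed.

Lemma D_list k w q : homw gL w ->
  Op k [::] (symprod (unzip2 w) * iA q) =
  spl (fun a b => (symprod (unzip2 a) * Fop k b q) *~ sgn (deg a)) w.
Proof.
move=> hw; rewrite -gprod_gword.
rewrite (Op_gprod (OpM k)) //; last exact: gword_hom.
rewrite spl_map //; apply: spl_hom_eq hw => a b ha hb _ _.
rewrite -!/(gword _) gprod_gword Op_A // deg_gword deg_nil addr0 mulr1 //.
Qed.

Lemma symprod_ind (Q : S -> Prop) : (forall u v, Q u -> Q v -> Q (u + v)) ->
  (forall w q, homw gL w -> Q (symprod (unzip2 w) * iA q)) -> forall u, Q u.
Proof.
move=> QD Qw u; move: Q QD Qw.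
elim/(sym_word_ind hA hL): u => [|u v Hu Hv|n g u [hga hgx] Hu] Q QD Qw.
- by rewrite -symA1 -[iA 1]mul1r; have := Qw [::] 1 I; rewrite /symprod big_nil.
- exact: QD (Hu Q QD Qw) (Hv Q QD Qw).
(* The letter is absorbed into the predicate. Its part in L then lengthens the product; its part in
   A is commuted to the right and merged with q. *)
apply: (Hu (fun v => Q (gsym g * v))) => [v v' Qv Qv'|w q hw].
  by rewrite mulrDr; exact: QD Qv Qv'.
rewrite gsymE mulrDl; apply: QD; last first.
  have := Qw ((n, g.2) :: w) q (conj hgx hw).
  by rewrite /= /Defs.symprod big_cons mulrA.
rewrite mulrA (sym_comm hA (symdegA gL hga) (symprod_deg hw)) symMzl -mulrA -symAM.
rewrite mulz_sgn; case: par; last exact: Qw.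
by rewrite -mulrN -raddfN; apply: Qw.
Qed.
End Operators.

(** * The square of the sum of the D_k *)

Section SquareZero.
Variables (K : fieldType) (A : algType K) (gA : int -> A -> Prop).
Variables (L : lmodType A) (gL : int -> L -> Prop).
Hypothesis charK : [pchar K] =i pred0.
Hypothesis hA : graded_calg gA.
Hypothesis hL : graded_module gA gL.
Variables (X : seq L -> L) (sg De : seq L -> A -> A).
Hypothesis hLR : LR_infty gA gL X sg.
Hypothesis hDe : right_connection gA gL sg De.
Hypothesis hflat : flat gL X De.
Local Notation S := (sym gA gL).
Local Notation gS := (@sym_deg K A gA L gL).
Local Notation iA := (symA gA gL).
Local Notation iL := (symL gA gL).
Local Notation lword := (seq (int * L)).
Local Notation symprod := (symprod gA gL).
Implicit Types (w a b d : lword).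

Let zip1 (s : seq int) (t : seq L) : size s = size t -> unzip1 (zip s t) = s.
Proof. by move=> e; apply: unzip1_zip; rewrite e. Qed.

Let zip2 (s : seq int) (t : seq L) : size s = size t -> unzip2 (zip s t) = t.
Proof. by move=> e; apply: unzip2_zip; rewrite e. Qed.

Lemma J1_spl w : homw gL w ->
  spl (fun a b => X (X (unzip2 a) :: unzip2 b)) w = 0.
Proof.
move=> hw; have := LR_J1 hLR (homw_homs hw).
set d := map_tuple fst _; set v := map_tuple snd _ => E.
have -> : w = zip d v by rewrite /d /v /= zip_unzip.
rewrite -unshuffles_spl -[RHS]E; apply: eq_bigr => i _; apply: eq_bigr => p _.
by congr (X (X _ :: _) *~ _); apply: zip2; rewrite ?size_take ?size_drop !size_tuple.
Qed.

Lemma flat_spl w q : homw gL w ->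
  spl (fun a b => De (X (unzip2 a) :: unzip2 b) q
        - De (unzip2 a) (De (unzip2 b) q) *~ sgn (deg a)) w = 0.
Proof.
move=> hw; have := hflat q (homw_homs hw); rewrite /curvature.
set d := map_tuple fst _; set v := map_tuple snd _ => E.
have -> : w = zip d v by rewrite /d /v /= zip_unzip.
rewrite -unshuffles_spl -[RHS]E; apply: eq_bigr => i _; apply: eq_bigr => p _.
have sz1 : size (take i (permt p d)) = size (take i (permt p v)).
  by rewrite !size_take !size_tuple.
have sz2 : size (drop i (permt p d)) = size (drop i (permt p v)).
  by rewrite !size_drop !size_tuple.
congr ((De (X _ :: _) q - De _ (De _ q) *~ sgn (degsum _)) *~ _);
  by [apply: zip2|apply: zip1].
Qed.

Lemma half_eq0 (u : S) : u = - u -> u = 0.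
Proof.
move=> E; have : (2 : K) *: u == 0 by rewrite scaler_nat mulr2n {1}E addNr.
by rewrite scaler_eq0 ((pcharf0P K).1 charK) => /eqP.
Qed.

Lemma X_rcons a b : homw gL a -> homw gL b ->
  X (rcons (unzip2 b) (X (unzip2 a))) =
  X (X (unzip2 a) :: unzip2 b) *~ sgn ((1 + deg a) * deg b).
Proof.
move=> ha hb; have hX := X_deg hLR ha.
have := swapw_rcons (x := (1 + deg a, X (unzip2 a))) (X_swap hLR) (conj hX hb).
by rewrite /unzip2 map_rcons.
Qed.

Lemma De_rcons a b q : homw gL a -> homw gL b ->
  De (rcons (unzip2 b) (X (unzip2 a))) q =
  De (X (unzip2 a) :: unzip2 b) q *~ sgn ((1 + deg a) * deg b).
Proof.
move=> ha hb; have hX := X_deg hLR ha.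
have := swapw_rcons (x := (1 + deg a, X (unzip2 a))) (De_swap hDe q) (conj hX hb).
by rewrite /unzip2 map_rcons.
Qed.

Local Notation Fop := (Fop gA gL X De).

(* D_i (D_j (c d b q)), for a word w split into c, d and b, contributes
   +/- c * comp_term i j q d b; the letters of c are untouched (see D_comp). *)
Definition comp_term (i j : nat) (q : A) (a b : lword) : S :=
  (if size b == j then
     (iL (X (unzip2 b)) * Fop i a q) *~ sgn ((1 + deg b) * (1 + deg a))
     + Fop i (rcons a (1 + deg b, X (unzip2 b))) q else 0)
  - (if (size b).+1 == j then Fop i a (De (unzip2 b) q) else 0).

(** In [comp_XX], [comp_XD] and [comp_DX] each operator consumes its own letters; in [comp_X] and
    [comp_D] one operator receives the output of the other. *)
Definition comp_XX q a b : S :=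
  (iL (X (unzip2 b)) * (iL (X (unzip2 a)) * iA q)) *~ sgn ((1 + deg b) * (1 + deg a)).

Definition comp_XD q a b : S :=
  (iL (X (unzip2 b)) * iA (De (unzip2 a) q)) *~ sgn ((1 + deg b) * (1 + deg a)).

Definition comp_DX q a b : S := iL (X (unzip2 a)) * iA (De (unzip2 b) q).

Definition comp_X q a b : S := iL (X (rcons (unzip2 a) (X (unzip2 b)))) * iA q.

Definition comp_D q a b : S :=
  iA (De (rcons (unzip2 a) (X (unzip2 b))) q) - iA (De (unzip2 a) (De (unzip2 b) q)).

(** The range of j excludes the index 0 for both factors, hence the two positivity tests. *)
Lemma sum_diag n (x y : nat) (Y : S) :
  \sum_(1 <= j < n) (if (x == j) && (y == n - j)%N then Y else 0) =
  if [&& (x + y)%N == n, (0 < x)%N & (0 < y)%N] then Y else 0.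
Proof.
case: ifP => [/and3P[/eqP e x0 y0]|h].
  have xn : (x < n)%N by lia.
  rewrite (big_cat_nat x0 (ltnW xn)) /= big_nat big1 ?add0r; last first.
    by move=> j /andP[_ jx]; rewrite gtn_eqF.
  rewrite big_ltn // eqxx big_nat big1 ?addr0; last first.
    by move=> j /andP[jx _]; rewrite ltn_eqF.
  by rewrite (_ : (y == n - x)%N = true) //; lia.
rewrite big_nat big1 // => j /andP[j1 jn]; case: ifP => // /andP[/eqP xj /eqP yj].
by move: h; lia.
Qed.

Lemma X_nil : X [::] = 0. Proof. exact: LR_X0 hLR. Qed.

(** The tests that remain compare n with the total length of [a] and [b], which is the same for all
    splittings of a word; so complete unshuffle sums appear. *)
Lemma sum_comp_term n q a b :
  \sum_(1 <= j < n) comp_term (n - j) j q a b =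
  (if (size a + size b == n)%N then comp_XX q a b else 0)
  + (if ((size a + size b).+1 == n)%N then
       comp_X q a b - comp_XD q a b - comp_DX q a b else 0)
  - (if ((size a + size b).+2 == n)%N then comp_D q a b else 0).
Proof.
have E j : comp_term (n - j) j q a b =
    (if (size b == j) && (size a == n - j)%N then comp_XX q a b else 0)
    - (if (size b == j) && ((size a).+1 == n - j)%N then comp_XD q a b else 0)
    + (if (size b == j) && ((size a).+1 == n - j)%N then comp_X q a b else 0)
    - (if (size b == j) && ((size a).+2 == n - j)%N then
         iA (De (rcons (unzip2 a) (X (unzip2 b))) q) else 0)
    - (if ((size b).+1 == j) && (size a == n - j)%N then comp_DX q a b else 0)
    + (if ((size b).+1 == j) && ((size a).+1 == n - j)%N then
         iA (De (unzip2 a) (De (unzip2 b) q)) else 0).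
  rewrite /comp_term !FopE size_rcons /unzip2 map_rcons -!/(unzip2 _) /=.
  rewrite /comp_XX /comp_XD /comp_X /comp_DX.
  case: (size b == j); case: ((size b).+1 == j); case: (size a == _);
    case: ((size a).+1 == _); case: ((size a).+2 == _);
    rewrite /= ?(mulrBr, subr0, sub0r, mulr0, mul0rz, mulrN); signs; zmod.
under eq_bigr do rewrite E.
rewrite !(big_split, sumrN) /= !sum_diag !ltn0Sn !andbT /=.
have nil0 (c : lword) : size c = 0%N -> X (unzip2 c) = 0.
  by move/size0nil ->; apply: X_nil.
have c1 : [&& (size b + size a == n)%N, (0 < size b)%N & (0 < size a)%N] =
    [&& (size a + size b == n)%N, (0 < size b)%N & (0 < size a)%N] by rewrite addnC.
have c2 : (size b + (size a).+1 == n)%N = ((size a + size b).+1 == n)%N by lia.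
have c4 : (size b + (size a).+2 == n)%N = ((size a + size b).+2 == n)%N by lia.
have c5 : ((size b).+1 + size a == n)%N = ((size a + size b).+1 == n)%N by lia.
have c6 : ((size b).+1 + (size a).+1 == n)%N = ((size a + size b).+2 == n)%N by lia.
rewrite c1 c2 c4 c5 c6 {c1 c2 c4 c5 c6}.
have bE (Y : S) c : (size b = 0%N -> Y = 0) ->
    (if c && (0 < size b)%N then Y else 0) = if c then Y else 0.
  by case: c => //=; case: posnP => // e /(_ e).
have aE (Y : S) c : (size a = 0%N -> Y = 0) ->
    (if c && (0 < size a)%N then Y else 0) = if c then Y else 0.
  by case: c => //=; case: posnP => // e /(_ e).
rewrite andbA !aE ?bE /comp_XX /comp_XD /comp_DX /comp_X /comp_D.
- by do 3!case: eqP => _; zmod.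
- by move/nil0 ->; rewrite -cats1 (multiadditive0 _ _ (De_add hDe q)) raddf0.
- by move/nil0 ->; rewrite -cats1 (multiadditive0 _ _ (X_add hLR)) raddf0 mul0r.
- by move/nil0 ->; rewrite raddf0 mul0r mul0rz.
- by move/nil0 ->; rewrite raddf0 mul0r mul0rz.
- by move/nil0 ->; rewrite raddf0 mul0r.
by move/nil0 ->; rewrite raddf0 mul0r mulr0 mul0rz.
Qed.

Let degX a : homw gL a -> gS (1 + deg a) (iL (X (unzip2 a))).
Proof. by move=> ha; apply: symdegL; apply: (X_deg hLR ha). Qed.

(** Exchanging the two blocks reverses the sign, as both operators are odd; the sum is its own
    opposite. *)
Lemma spl_comp_XX q e : homw gL e ->
  spl (fun a b => comp_XX q a b *~ sgn (deg a)) e = 0.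
Proof.
move=> he; apply: half_eq0; rewrite [LHS]spl_swap -splN.
apply: spl_hom_eq he => a b ha hb _ _; rewrite /comp_XX !mulrA.
rewrite (sym_comm hA (degX ha) (degX hb)) symMzl; signs; zmod.
Qed.

(** Exchanging the blocks turns [comp_DX] into the opposite of [comp_XD]. *)
Lemma spl_comp_XD q e : homw gL e ->
  spl (fun a b => (comp_XD q a b + comp_DX q a b) *~ sgn (deg a)) e = 0.
Proof.
move=> he.
have -> : spl (fun a b => (comp_XD q a b + comp_DX q a b) *~ sgn (deg a)) e =
    spl (fun a b => comp_XD q a b *~ sgn (deg a)) e
    + spl (fun a b => comp_DX q a b *~ sgn (deg a)) e.
  by rewrite -splD; apply: eq_spl => a b _ _; rewrite mulrzDl.
rewrite [X in _ + X]spl_swap; apply/eqP; rewrite addr_eq0 -splN; apply/eqP.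
by apply: eq_spl => a b _ _; rewrite /comp_XD /comp_DX; signs; zmod.
Qed.

Lemma spl_comp_X q e : homw gL e -> spl (fun a b => comp_X q a b *~ sgn (deg a)) e = 0.
Proof.
move=> he; rewrite spl_swap.
transitivity (iL (spl (fun a b => X (X (unzip2 a) :: unzip2 b)) e) * iA q); last first.
  by rewrite J1_spl // raddf0 mul0r.
rewrite (raddf_spl iL) mulr_splr; apply: spl_hom_eq he => a b ha hb _ _.
rewrite /comp_X (X_rcons ha hb) raddfMz /= symMzl; signs; zmod.
Qed.

Lemma spl_comp_D q e : homw gL e -> spl (fun a b => comp_D q a b *~ sgn (deg a)) e = 0.
Proof.
move=> he.
have -> : spl (fun a b => comp_D q a b *~ sgn (deg a)) e =
    spl (fun a b => iA (De (rcons (unzip2 a) (X (unzip2 b))) q) *~ sgn (deg a)) e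
    + spl (fun a b => - iA (De (unzip2 a) (De (unzip2 b) q)) *~ sgn (deg a)) e.
  by rewrite -splD; apply: eq_spl => a b _ _; rewrite mulrzDl.
rewrite [X in X + _]spl_swap -splD -[RHS](raddf0 iA) -(flat_spl q he) (raddf_spl iA).
apply: spl_hom_eq he => a b ha hb _ _.
rewrite (De_rcons q ha hb) raddfB !raddfMz /=; signs; zmod.
Qed.

Lemma spl_comp_term n q e : homw gL e ->
  spl (fun a b => (\sum_(1 <= j < n) comp_term (n - j) j q a b) *~ sgn (deg a)) e = 0.
Proof.
(* The size tests become constants, since the lengths of [a] and [b] add up to that of [e]. *)
move=> he; pose c k := (size e + k)%N == n.
transitivity (spl (fun a b => (if c 0 then comp_XX q a b *~ sgn (deg a) else 0)
   + (if c 1 then comp_X q a b *~ sgn (deg a) else 0)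
   - (if c 1 then (comp_XD q a b + comp_DX q a b) *~ sgn (deg a) else 0)
   - (if c 2 then comp_D q a b *~ sgn (deg a) else 0)) e).
  apply: eq_spl => a b sz _; rewrite sum_comp_term /c -sz addn0 addn1 addn2.
  by do 3!case: eqP => _; signs; zmod.
rewrite !(splD, splN).
have ifE (c0 : bool) (f : lword -> lword -> S) :
    spl f e = 0 -> spl (fun a b => if c0 then f a b else 0) e = 0.
  by case: c0 => // _; apply: spl0.
rewrite !(ifE _ (fun a b => _)) ?subr0 ?addr0 //.
- exact: spl_comp_D.
- exact: spl_comp_XD.
- exact: spl_comp_X.
exact: spl_comp_XX.
Qed.

Variable Op : nat -> seq (int * gen L) -> S -> S.
Local Notation hgen := (hgen gA gL).
Local Notation gsym := (gsym gA gL).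
Hypothesis OpB : forall k (w : seq (int * gen L)), homw hgen w -> zmod_morphism (Op k w).
Hypothesis Op1 : forall k (w : seq (int * gen L)), homw hgen w -> Op k w 1 = phi gA gL X sg De k w.
Hypothesis OpM : forall k (w : seq (int * gen L)) g u, homw hgen w -> hgen g.1 g.2 ->
  Op k w (gsym g.2 * u) =
    (gsym g.2 * Op k w u) *~ sgn (g.1 * (1 + deg w)) + Op k (rcons w g) u.

Let DB k : zmod_morphism (Op k [::]). Proof. exact: (OpB k (w := [::]) I). Qed.
Let D_list := D_list hA hL hLR hDe OpB Op1 OpM.

Lemma zmorph_spl (F : S -> S) (f : lword -> lword -> S) w : zmod_morphism F ->
  F (spl f w) = spl (fun a b => F (f a b)) w.
Proof.
move=> HF; elim: w f => //= x w IH f; rewrite (zmorphD HF) !IH; congr (_ + _).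
by apply: eq_spl => a b _ _; rewrite (zmorph_sgn _ _ HF).
Qed.

Lemma zmorph0 (F : S -> S) : zmod_morphism F -> F 0 = 0.
Proof. by move=> HF; rewrite -[0 in LHS](subrr 0) HF subrr. Qed.

Lemma symprod_rcons (s : seq L) x : symprod (rcons s x) = symprod s * iL x.
Proof. by rewrite /Defs.symprod -cats1 big_cat big_seq1. Qed.

(** X(b) is treated as one more letter, of degree 1 + deg b, after [a]; the outer operator either
    leaves it or takes it as an argument. *)
Lemma D_letter i j q a b : homw gL a -> homw gL b ->
  Op i [::] (symprod (unzip2 a) * Fop j b q) =
  spl (fun c d => (symprod (unzip2 c) * comp_term i j q d b) *~ sgn (deg c)) a.
Proof.
move=> ha hb; rewrite FopE mulrBr DB.
have E1 : Op i [::] (symprod (unzip2 a) * (if size b == j then iL (X (unzip2 b)) * iA q else 0))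
   = spl (fun c d => (symprod (unzip2 c) * (if size b == j then
     (iL (X (unzip2 b)) * Fop i d q) *~ sgn ((1 + deg b) * (1 + deg d))
     + Fop i (rcons d (1 + deg b, X (unzip2 b))) q else 0)) *~ sgn (deg c)) a.
  case: eqP => _; last first.
    rewrite mulr0 zmorph0 //; symmetry; rewrite -[RHS](spl0 _ a).
    by apply: eq_spl => *; rewrite mulr0 mul0rz.
  rewrite mulrA -symprod_rcons.
  have -> : rcons (unzip2 a) (X (unzip2 b)) = unzip2 (rcons a (1 + deg b, X (unzip2 b))).
    by rewrite /unzip2 map_rcons.
  rewrite D_list; last by apply/homw_rcons; split=> //; apply: (X_deg hLR hb).
  rewrite spl_rcons; apply: eq_spl => c d _ _.
  rewrite deg_rcons /= {1}/unzip2 map_rcons symprod_rcons -/(unzip2 c) /= -mulrA.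
  rewrite [symprod (unzip2 c) * (_ *~ _ + _)]mulrDr symMzr.
  by signs; zmod.
have E2 : Op i [::] (symprod (unzip2 a) *
      (if (size b).+1 == j then iA (De (unzip2 b) q) else 0)) =
    spl (fun c d => (symprod (unzip2 c) *
       (if (size b).+1 == j then Fop i d (De (unzip2 b) q) else 0)) *~ sgn (deg c)) a.
  case: eqP => _; first exact: D_list.
  rewrite mulr0 zmorph0 //; symmetry; rewrite -[RHS](spl0 _ a).
  by apply: eq_spl => *; rewrite mulr0 mul0rz.
rewrite E1 E2 -splN -splD; apply: eq_spl => c d _ _.
rewrite /comp_term; move: (if size b == j then _ else _) => Y.
by move: (if (size b).+1 == j then _ else _) => Z; rewrite (mulrBr _ Y Z); signs; zmod.
Qed.

(** [spl_assoc] brings the untouched letters [c] outside, so that the sum over the pairs i, j can be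
    taken inside, for fixed [e]. *)
Lemma D_comp i j q w : homw gL w ->
  Op i [::] (Op j [::] (symprod (unzip2 w) * iA q)) =
  spl (fun c e => symprod (unzip2 c) *
     spl (fun d b => comp_term i j q d b *~ sgn (deg d)) e) w.
Proof.
move=> hw; rewrite D_list // (zmorph_spl _ _ (DB i)).
transitivity (spl (fun a b => spl (fun c d =>
    symprod (unzip2 c) * (comp_term i j q d b *~ sgn (deg d))) a) w).
  apply: spl_hom_eq hw => a b ha hb _ _; rewrite (zmorph_sgn _ _ (DB i)) D_letter //.
  rewrite -spl_sgn; apply: eq_spl => c d _ <-; rewrite symMzr; signs; zmod.
rewrite (spl_assoc (fun c d b => symprod (unzip2 c) * (comp_term i j q d b *~ sgn (deg d)))).
by apply: eq_spl => c e _ _; rewrite mulr_spll.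
Qed.

Lemma D_square n u : \sum_(1 <= j < n) Op (n - j) [::] (Op j [::] u) = 0.
Proof.
elim/(symprod_ind hA hL): u => [u v Hu Hv|w q hw].
  under eq_bigr do rewrite (zmorphD (DB _)) (zmorphD (DB _)).
  by rewrite big_split /= Hu Hv addr0.
under eq_bigr do rewrite D_comp //.
rewrite -spl_sum -[RHS](spl0 _ w); apply: spl_hom_eq hw => c e hc he _ _.
rewrite -mulr_sumr -spl_sum -[RHS](mulr0 (symprod (unzip2 c))); congr (_ * _).
apply: etrans (spl_comp_term n q he); apply: eq_spl => a b _ _.
rewrite (big_morph (fun x : S => x *~ sgn (deg a)) (id1 := 0) (op1 := +%R)) ?mul0rz //.
by move=> x y; rewrite mulrzDl.
Qed.
End SquareZero.

(** * Characterization of D_k *)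

Section ExistenceOfD.
Variables (K : fieldType) (A : algType K) (gA : int -> A -> Prop).
Variables (L : lmodType A) (gL : int -> L -> Prop).
Hypothesis hA : graded_calg gA.
Hypothesis hL : graded_module gA gL.
Variables (X : seq L -> L) (sg De : seq L -> A -> A).
Hypothesis hLR : LR_infty gA gL X sg.
Hypothesis hDe : right_connection gA gL sg De.
Local Notation S := (sym gA gL).
Local Notation gS := (@sym_deg K A gA L gL).
Local Notation iA := (symA gA gL).
Local Notation iL := (symL gA gL).
Local Notation symprod := (symprod gA gL).
Local Notation word := (seq (int * gen L)).
Local Notation hgen := (hgen gA gL).
Local Notation gsym := (gsym gA gL).
Local Notation gA_gen := (gA_gen L).

Lemma D_unique (D D' : nat -> S -> S) k u : is_D X De D -> is_D X De D' ->
  (0 < k)%N -> D k u = D' k u.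
Proof.
move=> HD HD' k0; have [lD fD] := HD k k0; have [lD' fD'] := HD' k k0.
elim/(symprod_ind hA hL): u => [u v Hu Hv|w q hw].
  by have := lD 1 u v; have := lD' 1 u v; rewrite !scale1r Hu Hv => -> ->.
have hw' := homw_homs hw.
by have := fD _ _ _ q hw'; have := fD' _ _ _ q hw' => /= -> ->.
Qed.

Variable Op : nat -> word -> S -> S.
Hypothesis OpB : forall k (w : word), homw hgen w -> zmod_morphism (Op k w).
Hypothesis Op1 : forall k (w : word), homw hgen w -> Op k w 1 = phi gA gL X sg De k w.
Hypothesis OpM : forall k (w : word) g u, homw hgen w -> hgen g.1 g.2 ->
  Op k w (gsym g.2 * u) =
    (gsym g.2 * Op k w u) *~ sgn (g.1 * (1 + deg w)) + Op k (rcons w g) u.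

Lemma D_scale k c u : Op k [::] (c *: u) = c *: Op k [::] u.
Proof.
have hc : gA 0 c%:A by apply: (calgZ hA); apply: calg1.
have hg : hgen 0 (gA_gen c%:A) := hgenA hL hc.
have := OpM k (w := [::]) (g := (0, gA_gen c%:A)) u I hg.
rewrite /= gsymA mul0r mulr1z !sym_scaleE => ->.
(* The commutator with a scalar is 0: its values vanish by [od_one], once the scalar is moved to the
   end of the word. *)
rewrite (@Op_eq0 _ _ _ _ _ hA hL _ _ (OpB k) (Op1 k) (OpM k) [:: (0, gA_gen c%:A)]) ?addr0 //.
move=> v hv.
have hP := phi_opdata hA hLR hDe k.
have := swapw_rcons (x := (0, gA_gen c%:A)) (od_swap hP) (conj hg hv).
by rewrite (od_one hP) // mul0r mulr1z => <-.
Qed.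

Lemma D_linear k c u v : Op k [::] (c *: u + v) = c *: Op k [::] u + Op k [::] v.
Proof. by rewrite (zmorphD (OpB k (w := [::]) I)) D_scale. Qed.

Lemma D_is_D : is_D X De (fun k => Op k [::]).
Proof.
move=> k k0; split=> [c u v|l d xi q hxi]; first exact: D_linear.
have hw := homs_zip hxi.
have zip1 n (s : n.-tuple int) (t : n.-tuple L) i :
    unzip1 (zip (take i s) (take i t)) = take i s.
  by apply: unzip1_zip; rewrite !size_take !size_tuple.
have zip2 n (s : n.-tuple int) (t : n.-tuple L) i :
    unzip2 (zip (take i s) (take i t)) = take i t.
  by apply: unzip2_zip; rewrite !size_take !size_tuple.
have zip3 n (s : n.-tuple int) (t : n.-tuple L) i :
    unzip2 (zip (drop i s) (drop i t)) = drop i t.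
  by apply: unzip2_zip; rewrite !size_drop !size_tuple.
have zip4 : unzip2 (zip d xi) = xi by apply: unzip2_zip; rewrite !size_tuple.
have size_w : size (zip d xi) = l by rewrite size_zip !size_tuple minnn.
pose F1 (a b : seq (int * L)) := iL (X (unzip2 a)) * symprod (unzip2 b) * iA q.
pose F2 (a b : seq (int * L)) :=
  (symprod (unzip2 a) * iA (De (unzip2 b) q)) *~ sgn (deg a).
rewrite -[X in symprod X]zip4 (D_list hA hL hLR hDe OpB Op1 OpM) //.
transitivity (spl (fun a b => if (size a == k) && (size b == l - k)%N then F1 a b else 0)
    (zip d xi) - spl (fun a b => if (size a == l.+1 - k)%N && (size b == k.-1)
      then F2 a b else 0) (zip d xi)); last first.
  rewrite -!unshuffle_zip; congr (_ - _); apply: eq_bigr => p _.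
    by rewrite /F1 zip2 zip3.
  by rewrite /F2 zip2 zip3 /deg zip1 mulrzA.
(* In [is_D] the bracket X takes the first block, in [D_list] the second one, whence the
   exchange. *)
rewrite [X in X - _]spl_swap -splN -splD; apply: spl_hom_eq hw => a b ha hb.
rewrite size_w => sz _; rewrite FopE mulrBr.
have -> : (size b == k) && (size a == l - k)%N = (size b == k) by lia.
have -> : (size a == l.+1 - k)%N && (size b == k.-1) = ((size b).+1 == k) by lia.
have hX : gS (1 + deg b) (iL (X (unzip2 b))) by apply: symdegL; apply: (X_deg hLR hb).
rewrite /F1 /F2 (sym_comm hA hX (symprod_deg hA ha)) !symMzl -mulrA.
by do 2!case: eqP => _; rewrite ?mulr0; signs; zmod.
Qed.

(** Of all values on the empty word only - Delta_1(|1) for k = 1 survives: the obstruction to the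
    unit axiom. *)
Lemma D_one k : Op k [::] 1 = if k == 1 then - iA (De [::] 1) else 0.
Proof.
rewrite Op1 // /phi /= raddf0 addr0 (LR_X0 hLR) raddf0 if_same sub0r eq_sym.
by case: eqP; rewrite ?oppr0.
Qed.

Lemma D_dop k : dop k.+1 1 (Op k [::]).
Proof.
have := @dop_Op K A gA L gL hA hL _ _ (OpB k) (Op1 k) (OpM k) k.+1 [::] I.
by rewrite deg_nil addr0; apply=> v _ hv; apply: phi_eq0.
Qed.

Lemma D_deg k n u : gS n u -> gS (1 + n) (Op k [::] u).
Proof.
move=> hu; have := Op_deg hA hL (OpB k) (Op1 k) (OpM k)
  (phi_deg hA hLR hDe k) (w := [::]) I hu.
by rewrite deg_nil addr0.
Qed.

Lemma D_icomm k (v : word) : homw hgen v ->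
  icomm 1 (Op k [::]) [seq (g.1, gsym g.2) | g <- v] 1 = phi gA gL X sg De k v.
Proof.
move=> hv; have := icomm_Op (OpM k) (w := [::]) I hv.
by rewrite deg_nil addr0 => ->; rewrite Op1.
Qed.
End ExistenceOfD.

(** * Commutators and brackets *)

Section HomogeneousBrackets.
Variables (K : fieldType) (A : algType K) (gA : int -> A -> Prop).
Variables (L : lmodType A) (gL : int -> L -> Prop).
Hypothesis hA : graded_calg gA.
Hypothesis hL : graded_module gA gL.
Local Notation S := (sym gA gL).
Local Notation gS := (@sym_deg K A gA L gL).
Implicit Types (F G : S -> S) (w : seq (int * S)).

Definition klin F := forall (c : K) u v, F (c *: u + v) = c *: F u + F v.
Definition hop (e : int) F := forall n u, gS n u -> gS (e + n) (F u).

Lemma klin_zmod F : klin F -> zmod_morphism F.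
Proof. by move=> h u v; rewrite addrC -scaleN1r h scaleN1r addrC. Qed.

Lemma icomm_cat e F w1 w2 :
  icomm e F (w1 ++ w2) = icomm (e + deg w1) (icomm e F w1) w2.
Proof.
elim: w1 e F => [|[d u] w IH] e F /=; first by rewrite deg_nil addr0.
by rewrite IH deg_cons addrA.
Qed.

Lemma gcomm_klin e d F u : klin F -> klin (gcomm e d F ( *%R u)).
Proof.
move=> h c x y; rewrite /gcomm h !mulrDr -!scalerAr h.
by rewrite !mulz_sgn; case: par; rewrite ?scalerBr ?scalerDr ?scalerN; zmod.
Qed.

Lemma gcomm_hop e d F u : hop e F -> gS d u -> hop (e + d) (gcomm e d F ( *%R u)).
Proof.
move=> h hu n x hx; apply: (sym_degB hA).
  by rewrite -addrA; apply: h; apply: symdegM.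
apply: (sym_deg_sgn hA); apply: sym_degS (symdegM hu (h _ _ hx)).
by rewrite addrA [d + e]addrC.
Qed.

Lemma icomm_klin e F w : klin F -> klin (icomm e F w).
Proof.
by elim: w e F => [|[d u] w IH] e F //= h; apply: IH; apply: gcomm_klin.
Qed.

Lemma icomm_hop e F w : hop e F -> homw gS w -> hop (e + deg w) (icomm e F w).
Proof.
elim: w e F => [|[d u] w IH] e F h /=; first by rewrite deg_nil addr0.
move=> [hu hw]; rewrite deg_cons addrA; apply: IH => //; exact: gcomm_hop.
Qed.

Lemma icommD e F G w :
  icomm e (fun x => F x + G x) w = (fun x => icomm e F w x + icomm e G w x).
Proof.
elim: w e F G => [|[d u] w IH] e F G //=; rewrite -IH; congr icomm.
by apply/funext => x; rewrite /gcomm mulrDr; signs; zmod.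
Qed.

Lemma icomm_sgn e F n w :
  icomm e (fun x => F x *~ sgn n) w = (fun x => icomm e F w x *~ sgn n).
Proof.
elim: w e F => [|[d u] w IH] e F //=; rewrite -IH; congr icomm.
by apply/funext => x; rewrite /gcomm symMzr; signs; zmod.
Qed.

Lemma icomm_mull e F m v w : gS m v -> homw gS w ->
  icomm (m + e) (fun x => v * F x) w = (fun x => v * icomm e F w x).
Proof.
move=> hv; elim: w e F => [|[d u] w IH] e F //= [hu hw].
rewrite -IH // addrA; congr icomm.
apply/funext => x; rewrite /gcomm mulrBr mulrA (sym_comm hA hu hv) symMzl symMzr.
by rewrite -mulrA; signs; zmod.
Qed.

Lemma icomm_mulr e F m v w : klin F -> gS m v -> homw gS w ->
  icomm (e + m) (fun x => F (v * x)) w =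
  (fun x => icomm e F w (v * x) *~ sgn (m * deg w)).
Proof.
move=> hF hv; elim: w e F hF => [|[d u] w IH] e F hF /=.
  by move=> _; apply/funext => x; rewrite deg_nil mulr0 mulr1z.
move=> [hu hw]; rewrite addrAC.
have -> : gcomm (e + m) d (fun x => F (v * x)) ( *%R u) =
    (fun x => gcomm e d F ( *%R u) (v * x) *~ sgn (m * d)).
  apply/funext => x; rewrite /gcomm mulrA (sym_comm hA hv hu) symMzl.
  by rewrite (zmorph_sgn _ _ (klin_zmod hF)) -mulrA; signs; zmod.
rewrite icomm_sgn IH //; last exact: gcomm_klin.
by apply/funext => x; rewrite deg_cons; signs.
Qed.

(** The multiplications by the two elements commute in the graded sense, so the Jacobi identity
    exchanges the two commutators. *)
Lemma icomm_swap e F w1 g h w2 : klin F -> homw gS (w1 ++ g :: h :: w2) ->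
  icomm e F (w1 ++ g :: h :: w2) =
  (fun x => icomm e F (w1 ++ h :: g :: w2) x *~ sgn (g.1 * h.1)).
Proof.
move=> hF; rewrite homw_cat /= => -[hw1 [hg [hh hw2]]]; rewrite !icomm_cat.
case: g h hg hh => [m u] [n v] /= hu hv.
rewrite [_ + n + m]addrAC -icomm_sgn; congr icomm; apply/funext => x.
set G := icomm e F w1; have aG : zmod_morphism G by apply/klin_zmod/icomm_klin.
have uv y : u * (v * y) = (v * (u * y)) *~ sgn (m * n).
  by rewrite mulrA (sym_comm hA hu hv) symMzl mulrA.
rewrite /gcomm !mulrBr !symMzr !uv (zmorph_sgn _ _ aG).
signs; zmod.
Qed.

(** The expansion of the commutator with u v leaves H(v), where H is a commutator with k elements.
    As [F] has order k, H has order 0 and H(v) = +/- v H(1), which is what makes the bracket a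
    derivation. *)
Lemma icomm_leibniz k F w1 m u n v w2 : klin F -> hop 1 F -> dop k.+1 1 F ->
  (size w1 + size w2).+1 = k ->
  homw gS w1 -> gS m u -> gS n v -> homw gS w2 ->
  icomm 1 F (w1 ++ (m + n, u * v) :: w2) 1 =
    (u * icomm 1 F (w1 ++ (n, v) :: w2) 1) *~ sgn (m * (1 + deg w1))
    + (icomm 1 F (w1 ++ (m, u) :: w2) 1 * v) *~ sgn (n * deg w2).
Proof.
move=> lF hF dF sz hw1 hu hv hw2; rewrite !icomm_cat /=.
set e := 1 + deg w1; set G := icomm 1 F w1.
have lG : klin G by apply: icomm_klin.
have hG : hop e G by apply: icomm_hop.
have dG : dop (size w2).+2 e G.
  by apply: icomm_dop => //; rewrite !addnS sz.
rewrite gcommM // icommD icomm_sgn [e + (m + n)]addrCA icomm_mull //.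
rewrite [m + (e + n)]addrCA addrA icomm_mulr //; last exact: gcomm_klin.
set H := icomm (e + m) _ w2; rewrite mulr1.
have dH : dop 1 (e + m + deg w2) H.
  by apply: icomm_dop => //; rewrite addn1; apply: dop_gcomm.
have hH : hop (e + m + deg w2) H.
  by apply: icomm_hop => //; apply: gcomm_hop.
have -> : H v = (v * H 1) *~ sgn ((e + m + deg w2) * n).
  have := (dop_gcomm hA hL dH hv).2 1; rewrite /gcomm mulr1 => /eqP.
  by rewrite subr_eq0 => /eqP.
have H1 : gS (e + m + deg w2) (H 1).
  by have := hH _ _ (sym_deg1 gL hA); rewrite addr0.
rewrite (sym_comm hA H1 hv); set Y := icomm (e + n) _ w2 1; signs; zmod.
Qed.
End HomogeneousBrackets.

(** * Commutators with inhomogeneous elements *)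

Section TotalCommutators.
Variables (K : fieldType) (A : algType K) (gA : int -> A -> Prop).
Variables (L : lmodType A) (gL : int -> L -> Prop).
Hypothesis charK : [pchar K] =i pred0.
Hypothesis hA : graded_calg gA.
Hypothesis hL : graded_module gA gL.
Local Notation S := (sym gA gL).
Local Notation gS := (@sym_deg K A gA L gL).
Variable theta : S -> S.
Hypothesis thetaD : forall u v, theta (u + v) = theta u + theta v.
Hypothesis thetaZ : forall c u, theta (c *: u) = c *: theta u.
Hypothesis thetaE : forall n u, gS n u -> theta u = u *~ sgn n.
Implicit Types (F G : S -> S).

(* [F, u] for F and u not necessarily homogeneous: the odd part of u picks up the
   parity of F, which is conjugation by theta. *)
Definition tcomm F (u v : S) : S :=
  F (u * v) - (2^-1 *: ((u + theta u) * F v + (u - theta u) * theta (F (theta v)))).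

(** [icomm] needs a degree for each argument; this version accepts any list in S and is additive in
    each entry when [F] is linear, as required of [Lam]. *)
Fixpoint ticomm F (s : seq S) : S -> S :=
  if s is u :: s' then ticomm (tcomm F u) s' else F.

Lemma tcomm_hom e d F u : klin F -> hop e F -> gS d u ->
  tcomm F u = gcomm e d F ( *%R u).
Proof.
move=> lF hF hu; apply/funext => v; rewrite /tcomm /gcomm (thetaE hu); congr (_ - _).
have half x : 2^-1 *: (x + x : S) = x.
  by rewrite -mulr2n -scaler_nat scalerA mulVf ?scale1r // ((pcharf0P K).1 charK).
have -> : theta (F (theta v)) = F v *~ sgn e.
  elim/(sym_hom_ind hA hL): v => [n v hv|v v' Hv Hv']; last first.
    have FD (x y : S) : F (x + y) = F x + F y := zmorphD (klin_zmod lF) x y.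
    by rewrite thetaD FD thetaD Hv Hv' FD mulrzDl.
  have theta_sgn u' m : theta (u' *~ sgn m) = theta u' *~ sgn m.
    by rewrite !mulz_sgn; case: par => //; rewrite -!scaleN1r thetaZ.
  by rewrite (thetaE hv) (zmorph_sgn _ _ (klin_zmod lF)) theta_sgn (thetaE (hF _ _ hv)); signs.
rewrite !mulz_sgn !parM; case: (par d); case: (par e);
  rewrite /= ?opprK ?subrr ?mul0r ?addr0 ?add0r ?mulrN ?mulrDl ?half //.
by rewrite scalerN half.
Qed.

Let halfC (c : K) (z : S) : 2^-1 *: (c *: z) = c *: (2^-1 *: z).
Proof. by rewrite !scalerA mulrC. Qed.

Lemma tcomm_klin F u : klin F -> klin (tcomm F u).
Proof.
move=> h c x y; rewrite /tcomm !mulrDr -!scalerAr h thetaD thetaZ !h thetaD thetaZ.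
by rewrite !mulrDr -!scalerAr !(scalerBr, scalerDr) !halfC; zmod.
Qed.

Lemma tcomm_lin F c u v : klin F ->
  tcomm F (c *: u + v) = (fun x => c *: tcomm F u x + tcomm F v x).
Proof.
move=> h; apply/funext => x; rewrite /tcomm thetaD thetaZ !(mulrBl, mulrDl) -!scalerAl h.
by rewrite !(scalerBr, scalerDr) !halfC; zmod.
Qed.

Lemma ticomm_lin F G c s :
  ticomm (fun x => c *: F x + G x) s = (fun x => c *: ticomm F s x + ticomm G s x).
Proof.
elim: s F G => [|u s IH] F G //=; rewrite -IH; congr ticomm.
apply/funext => x; rewrite /tcomm thetaD thetaZ !mulrDr -!scalerAr.
by rewrite !(scalerBr, scalerDr) !halfC; zmod.
Qed.

Lemma ticomm_argD F s1 c u v s2 : klin F ->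
  ticomm F (s1 ++ (c *: u + v) :: s2) =
  (fun x => c *: ticomm F (s1 ++ u :: s2) x + ticomm F (s1 ++ v :: s2) x).
Proof.
elim: s1 F => [|x s1 IH] F h /=; first by rewrite tcomm_lin // ticomm_lin.
by apply: IH; apply: tcomm_klin.
Qed.

Lemma ticomm_hom e F w : klin F -> hop e F -> homw gS w ->
  ticomm F (unzip2 w) = icomm e F w.
Proof.
elim: w e F => [|[d u] w IH] e F lF hF //= [hu hw].
rewrite (tcomm_hom lF hF hu); apply: IH => //; first exact: gcomm_klin.
exact: gcomm_hop.
Qed.
End TotalCommutators.

(** * Uniqueness and existence of the multiderivations Lambda *)

Section Brackets.
Variables (K : fieldType) (A : algType K) (gA : int -> A -> Prop).
Variables (L : lmodType A) (gL : int -> L -> Prop).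
Hypothesis charK : [pchar K] =i pred0.
Hypothesis hA : graded_calg gA.
Hypothesis hL : graded_module gA gL.
Variables (X : seq L -> L) (sg De : seq L -> A -> A).
Hypothesis hLR : LR_infty gA gL X sg.
Hypothesis hDe : right_connection gA gL sg De.
Local Notation S := (sym gA gL).
Local Notation gS := (@sym_deg K A gA L gL).
Local Notation iA := (symA gA gL).
Local Notation iL := (symL gA gL).
Local Notation word := (seq (int * gen L)).
Local Notation hgen := (hgen gA gL).
Local Notation gsym := (gsym gA gL).
Local Notation gA_gen := (gA_gen L).
Local Notation gsymw v := [seq gsym g.2 | g <- v].
Let grS := sym_grading hA hL charK.
Let grA := calg_grading hA.
Let grL := gmod_grading hL.

Lemma unzip2_zipt (T : Type) n (d : n.-tuple int) (t : n.-tuple T) : unzip2 (zip d t) = t.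
Proof. by apply: unzip2_zip; rewrite !size_tuple. Qed.

Lemma unzip1_zipt (T : Type) n (d : n.-tuple int) (t : n.-tuple T) : unzip1 (zip d t) = d.
Proof. by apply: unzip1_zip; rewrite !size_tuple. Qed.

Lemma gsymw_hom (v : word) : homw hgen v -> homw gS [seq (g.1, gsym g.2) | g <- v].
Proof. by elim: v => //= g v IH [hg hv]; split; [apply: gsym_deg|apply: IH]. Qed.

Lemma unzip2_gsymw (v : word) : unzip2 [seq (g.1, gsym g.2) | g <- v] = gsymw v.
Proof. by rewrite /unzip2 -map_comp. Qed.

Definition mder (f : seq S -> S) := forall w1 n v m u w2,
  homw gS w1 -> homw gS w2 -> gS m u -> gS n v ->
  f (unzip2 w1 ++ u * v :: unzip2 w2) =
    (u * f (unzip2 w1 ++ v :: unzip2 w2)) *~ sgn (m * (1 + deg w1))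
    + (f (unzip2 w1 ++ u :: unzip2 w2) * v) *~ sgn (n * deg w2).

(** The first argument is reduced to a generator by induction on its construction as a homogeneous
    element and then joins [w1]; in the product case the derivation rule applies. *)
Lemma mder_gen_eq0 f w1 w2 n : multiadditive f -> mder f ->
  homw gS w1 -> homw gS w2 ->
  (forall v, homw hgen v -> size v = n ->
     f (unzip2 w1 ++ gsymw v ++ unzip2 w2) = 0) ->
  forall s, size s = n -> f (unzip2 w1 ++ s ++ unzip2 w2) = 0.
Proof.
move=> fA fD hw1 hw2 hv; apply: (multiadditive_hom_eq0 grS fA) => w hw.
elim: w w1 hw1 n hv hw => [|[d u] w IH] w1 hw1 n hv /=.
  by move=> _ n0; apply: (hv [::] I).
move=> [hu hw] sn.
have hw' : homw gS (w ++ w2) by apply/homw_cat.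
suff H : forall m x, gS m x -> f (unzip2 w1 ++ x :: unzip2 (w ++ w2)) = 0.
  by have := H _ _ hu; rewrite /unzip2 map_cat.
have Hg m g : hgen m g -> f (unzip2 w1 ++ gsym g :: unzip2 (w ++ w2)) = 0.
  move=> hg; rewrite -cat_rcons.
  have -> : rcons (unzip2 w1) (gsym g) = unzip2 (rcons w1 (m, gsym g)).
    by rewrite /unzip2 map_rcons.
  rewrite /unzip2 map_cat -!/(unzip2 _); apply: (IH _ _ n.-1) => //.
  - by apply/homw_rcons; split=> //; apply: gsym_deg.
  - move=> v hgv sv; rewrite /unzip2 map_rcons cat_rcons.
    by apply: (hv ((m, g) :: v)) => //=; rewrite sv -sn.
  by rewrite -sn.
move=> m x; elim=> {m x} [m a ha|m x hx|m x y _ Hx _ Hy|m k x y hx Hx hy Hy].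
- by rewrite -(gsymA _ gL); apply: (Hg m); apply: hgenA.
- by rewrite -(gsymL gA); apply: (Hg m); apply: hgenL.
- by rewrite fA Hx Hy addr0.
by rewrite (fD _ k _ m) // Hx Hy mulr0 mul0r !mul0rz addr0.
Qed.

Lemma mder_sub f f' : mder f -> mder f' -> mder (fun s => f s - f' s).
Proof.
move=> hf hf' w1 n v m u w2 hw1 hw2 hu hv; rewrite (hf _ n _ m) // (hf' _ n _ m) //.
by rewrite mulrBr mulrBl; signs; zmod.
Qed.

Lemma multiadditive_sub (V W : zmodType) (f f' : seq V -> W) :
  multiadditive f -> multiadditive f' -> multiadditive (fun s => f s - f' s).
Proof. by move=> hf hf' s1 s2 x y; rewrite hf hf'; zmod. Qed.

Lemma Lambda_mder (Lam : seq S -> S) : is_Lambda X sg Lam -> mder Lam.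
Proof.
move=> HL w1 n v m u w2 hw1 hw2 hu hv.
exact: (Lam_der HL (homw_homs hw1) (homw_homs hw2) hu hv).
Qed.

(** The difference of two solutions is a symmetric multiderivation; it vanishes on letters a + x,
    which are expanded with their L-parts collected on the left. *)
Lemma Lambda_unique (Lam Lam' : seq S -> S) :
  is_Lambda X sg Lam -> is_Lambda X sg Lam' -> Lam = Lam'.
Proof.
move=> HL HL'; apply/funext => s; apply/eqP; rewrite -subr_eq0; apply/eqP.
pose f (s : seq S) := Lam s - Lam' s.
have fA : multiadditive f by apply: multiadditive_sub (Lam_add HL) (Lam_add HL').
have fD : mder f by apply: mder_sub; apply: Lambda_mder.
have fS : swapw gS (fun w => f (unzip2 w)).
  move=> w1 g h w2 hw; rewrite /f (graded_symmetric_swap (Lam_sym HL) hw).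
  by rewrite (graded_symmetric_swap (Lam_sym HL') hw); signs; zmod.
have f_AA s1 s2 s3 a b : f (s1 ++ iA a :: s2 ++ iA b :: s3) = 0.
  by rewrite /f (Lam_AA HL) (Lam_AA HL') subrr.
(* Once one argument lies in A, the A-parts of the other letters vanish by [f_AA], and their L-parts
   are exchanged with a until the form of [Lam_LA] is reached. *)
have f_A (w : seq (int * L)) m a v : homw gL w -> gA m a -> homw hgen v ->
    f (map iL (unzip2 w) ++ iA a :: gsymw v) = 0.
  move=> hw ha; elim: v w hw => [|[n [b y]] v IH] w hw /=.
    by move=> _; rewrite cats1 /f (Lam_LA HL) (Lam_LA HL') subrr.
  move=> [[/= hb hy] hv]; rewrite gsymE /=.
  rewrite -cat_rcons fA cat_rcons.
  rewrite (f_AA _ [::]) add0r cat_rcons.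
  pose wl := [seq (g.1, iL g.2) | g <- w].
  pose wr := [seq (g.1, gsym g.2) | g <- v].
  have E x z : map iL (unzip2 w) ++ x.2 :: z.2 :: gsymw v =
     unzip2 (wl ++ x :: (z : int * S) :: wr).
    by rewrite /unzip2 /wl /wr map_cat /= -!map_comp.
  rewrite (E (m, iA a) (n, iL y)) fS.
    rewrite -(E (n, iL y) (m, iA a)) /= -cat_rcons.
    have := IH (rcons w (n, y)); rewrite /unzip2 !map_rcons /= => -> //; first by rewrite mul0rz.
    by apply/homw_rcons.
  rewrite homw_cat /=; split.
    by rewrite /wl; elim: (w) hw => //= g w' IHw [hg hw']; split; [apply: symdegL|apply: IHw].
  by split; [apply: symdegA|split; [apply: symdegL|apply: gsymw_hom]].
have f_L (w : seq (int * L)) v : homw gL w -> homw hgen v ->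
    f (map iL (unzip2 w) ++ gsymw v) = 0.
  elim: v w => [|[n [b y]] v IH] w hw /=.
    by move=> _; rewrite cats0 /f (Lam_L HL) (Lam_L HL') subrr.
  move=> [[/= hb hy] hv]; rewrite gsymE /= fA (f_A w n) // add0r -cat_rcons.
  have := IH (rcons w (n, y)); rewrite /unzip2 !map_rcons /= => -> //.
  by apply/homw_rcons.
have := @mder_gen_eq0 f [::] [::] (size s) fA fD I I _ s erefl.
rewrite cats0; apply=> v hv _; rewrite cats0.
exact: (f_L [::]).
Qed.

Variable D : nat -> S -> S.
Hypothesis D_klin : forall k, klin (D k).
Hypothesis D_hop : forall k, hop 1 (D k).
Hypothesis D_ord : forall k, dop k.+1 1 (D k).
Hypothesis D_gen : forall k v, homw hgen v ->
  icomm 1 (D k) [seq (g.1, gsym g.2) | g <- v] 1 = phi gA gL X sg De k v.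

(** The iterated commutators of D_k at 1 themselves serve as Lambda_k, so that uniqueness of Lambda
    yields the generation statement. *)
Lemma Lambda_exists : exists Lam : seq S -> S, is_Lambda X sg Lam /\
  forall w, homw gS w -> Lam (unzip2 w) = icomm 1 (D (size w)) w 1.
Proof.
(* The dilation with c = -1 is the parity involution, used as [theta] in the commutators with
   arbitrary elements. *)
have [h hE] : exists h : {lrmorphism S -> S}, forall n u, gS n u -> h u = (-1) ^ n *: u.
  by apply: (sym_dilation hA hL); rewrite oppr_eq0 oner_eq0.
have hD u v : h (u + v) = h u + h v by rewrite rmorphD.
have hZ c u : h (c *: u) = c *: h u by rewrite linearZ.
have hS n u : gS n u -> h u = u *~ sgn n.
  move=> hu; rewrite (hE _ _ hu) mulz_sgn.
  have -> : (-1 : K) ^ n = (-1) ^+ par n.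
    case: n {hu} => k; first by rewrite /par absz_nat signr_odd.
    rewrite /par -signr_odd -[(-1) ^ Negz k]/((-1) ^+ k.+1)^-1 -signr_odd.
    by case: odd; rewrite ?invrN1 ?invr1.
  by case: par; rewrite ?scaleN1r ?scale1r.
pose Lam (s : seq S) := ticomm h (D (size s)) s 1.
have LamE w : homw gS w -> Lam (unzip2 w) = icomm 1 (D (size w)) w 1.
  move=> hw; rewrite /Lam /unzip2 size_map.
  by rewrite (ticomm_hom charK hA hL hD hZ hS (D_klin _) (D_hop _) hw).
have Lam_lin s1 c x y s2 : Lam (s1 ++ (c *: x + y) :: s2) =
    c *: Lam (s1 ++ x :: s2) + Lam (s1 ++ y :: s2).
  by rewrite /Lam !size_cat /= (ticomm_argD hD hZ).
have LamA : multiadditive Lam.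
  by move=> s1 s2 x y; rewrite -[x]scale1r Lam_lin !scale1r.
have Lam_swapw : swapw gS (fun w => Lam (unzip2 w)).
  move=> w1 g k w2 hw; rewrite LamE // (icomm_swap hA) // LamE; last first.
    by move: hw; rewrite !homw_cat /=; tauto.
  by rewrite !size_cat.
have LamD : mder Lam.
  move=> w1 n v m u w2 hw1 hw2 hu hv.
  have E x : unzip2 w1 ++ x.2 :: unzip2 w2 = unzip2 (w1 ++ (x : int * S) :: w2).
    by rewrite /unzip2 map_cat.
  rewrite (E (m + n, u * v)) (E (m, u)) (E (n, v)) !LamE.
  - rewrite !size_cat /=; apply: icomm_leibniz => //.
    by rewrite addnS.
  - by apply/homw_cat.
  - by apply/homw_cat.
  by apply/homw_cat; split=> //; split=> //; apply: symdegM.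
have Lam_gen v : homw hgen v -> Lam (gsymw v) = phi gA gL X sg De (size v) v.
  move=> hv; rewrite -unzip2_gsymw LamE; last exact: gsymw_hom.
  by rewrite size_map D_gen.
exists Lam; split; last exact: LamE.
split.
- exact: swapw_symmetric.
- exact: LamA.
- move=> s1 s2 c u; have := Lam_lin s1 c u 0 s2; rewrite addr0 => ->.
  by rewrite (multiadditive0 _ _ LamA) addr0.
- move=> n d u /homs_zip hu; rewrite -(unzip2_zipt d u) LamE //.
  have := icomm_hop hA (D_hop _) hu (sym_deg1 gL hA); rewrite addr0.
  by rewrite /deg unzip1_zipt; apply.
- move=> m n d u e u' dv v dw w /homs_zip hu /homs_zip hu' hv hw.
  have := LamD _ dw w dv v _ hu hu' hv hw.
  by rewrite /deg !unzip1_zipt !unzip2_zipt.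
- move=> s; apply/eqP; rewrite -subr_eq0; apply/eqP.
  pose f (s : seq L) := Lam (map iL s) - iL (X s).
  have fA : multiadditive f.
    move=> s1 s2 x y; rewrite /f !map_cat /= !raddfD /= LamA (X_add hLR) raddfD /=; zmod.
  have := @multiadditive_hom_eq0 _ _ grL _ _ fA [::] [::] (size s) _ s erefl.
  rewrite /= cats0; apply=> w hw _; rewrite cats0 /f.
  have -> : map iL (unzip2 w) = gsymw (gword w).
    rewrite /gword /unzip2 -!map_comp; apply: eq_map => g /=.
    by rewrite gsymL.
  rewrite Lam_gen; last exact: gword_hom.
  have s0 t : sg t 0 = 0 by apply: (addrI (sg t 0)); rewrite -(LR_sgadd_der hLR) !addr0.
  rewrite /phi eqxx gtn_eqF // tau_gword // raddf0 lpart_gword subr0; zmod.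
- move=> s a; apply/eqP; rewrite -subr_eq0; apply/eqP.
  pose f a (s : seq L) := Lam (rcons (map iL s) (iA a)) - iA (sg s a).
  have fD b c t : f (b + c) t = f b t + f c t.
    by rewrite /f -!cats1 raddfD /= LamA (LR_sgadd_der hLR) raddfD /=; zmod.
  rewrite -/(f a s); elim/(hom_ind grA): a => [m a ha|b c Hb Hc]; last by rewrite fD Hb Hc addr0.
  have fA : multiadditive (f a).
    move=> s1 s2 x y; rewrite /f !map_cat /= !rcons_cat /= raddfD /= LamA.
    by rewrite (sg_add hLR a) raddfD /=; zmod.
  have := @multiadditive_hom_eq0 _ _ grL _ _ fA [::] [::] (size s) _ s erefl.
  rewrite /= cats0; apply=> w hw _; rewrite cats0 /f.
  have -> : rcons (map iL (unzip2 w)) (iA a) = gsymw (rcons (gword w) (m, gA_gen a)).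
    rewrite map_rcons /= gsymA; congr rcons.
    rewrite /gword /unzip2 -!map_comp; apply: eq_map => g /=.
    by rewrite gsymL.
  rewrite Lam_gen; last by apply/homw_rcons; split; [apply: gword_hom|apply: hgenA].
  rewrite /phi eqxx gtn_eqF // subr0 lpart_rcons lpart_gword /=.
  rewrite tau_rcons0; last exact: sg_fadd hLR.
  rewrite lpart_gword -cats1 (multiadditive0 _ _ (X_add hLR)) raddf0 add0r subrr //.
have phi_AA v1 v2 v3 m n a b : homw hgen v1 -> homw hgen v2 -> homw hgen v3 ->
    gA m a -> gA n b ->
    Lam (gsymw v1 ++ iA a :: gsymw v2 ++ iA b :: gsymw v3) = 0.
  move=> h1 h2 h3 ha hb.
  have -> : gsymw v1 ++ iA a :: gsymw v2 ++ iA b :: gsymw v3 =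
      gsymw (v1 ++ (m, gA_gen a) :: v2 ++ (n, gA_gen b) :: v3).
    by rewrite !map_cat /= !map_cat /= !gsymA.
  have hv : homw hgen (v1 ++ (m, gA_gen a) :: v2 ++ (n, gA_gen b) :: v3).
    apply/homw_cat; split=> //; split; first exact: hgenA.
    by apply/homw_cat; split=> //; split=> //; apply: hgenA.
  rewrite Lam_gen // /phi eqxx gtn_eqF // subr0.
  rewrite tau_AA; last exact: sg_fadd hLR.
  by rewrite raddf0 addr0 lpart_cat (multiadditive0 _ _ (X_add hLR)) raddf0.
move=> s1 s2 s3 a b.
elim/(hom_ind grA): a => [m a ha|a a' Ha Ha']; last by rewrite raddfD LamA Ha Ha' addr0.
elim/(hom_ind grA): b => [n b hb|b b' Hb Hb']; last first.
  have := LamA (s1 ++ iA a :: s2) s3 (iA b) (iA b'); rewrite -!catA /= => E.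
  by rewrite raddfD E Hb Hb' addr0.
have hSa : gS m (iA a) := symdegA gL ha.
have hSb : gS n (iA b) := symdegA gL hb.
(* With the two letters of A fixed, the blocks [s1] and [s2] are made homogeneous; then [s3], [s2],
   [s1] are reduced to generators, where [phi_AA] applies. *)
apply: (@multiadditive_hom_eq0 _ _ grS _ _ LamA [::] _ (size s1)) => // w1 hw1 _ /=.
rewrite -cat_rcons.
apply: (@multiadditive_hom_eq0 _ _ grS _ _ LamA _ _ (size s2)) => // w2 hw2 _.
rewrite cat_rcons.
pose gs v := [seq (g.1, gsym g.2) | g : int * gen L <- v].
have hgs v : homw hgen v -> homw gS (gs v) by apply: gsymw_hom.
have H3 := @mder_gen_eq0 Lam (w1 ++ (m, iA a) :: rcons w2 (n, iA b)) [::] (size s3) LamA LamD.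
have E3 : unzip2 (w1 ++ (m, iA a) :: rcons w2 (n, iA b)) =
    rcons (unzip2 w1 ++ iA a :: unzip2 w2) (iA b).
  by rewrite /unzip2 map_cat /= map_rcons -rcons_cons -rcons_cat.
rewrite E3 in H3; have := H3 _ I _ s3 erefl.
rewrite cats0 cat_rcons -catA; apply; first by rewrite homw_cat /= homw_rcons.
move=> v3 hv3 _; rewrite cats0 cat_rcons -catA /=.
have H2 := @mder_gen_eq0 Lam (rcons w1 (m, iA a)) ((n, iA b) :: gs v3) (size w2) LamA LamD.
have E1 : unzip2 (rcons w1 (m, iA a)) = rcons (unzip2 w1) (iA a) by rewrite /unzip2 map_rcons.
have E2 : unzip2 ((n, iA b) :: gs v3) = iA b :: gsymw v3 by rewrite /= unzip2_gsymw.
rewrite E1 E2 in H2; have := H2 _ _ _ (unzip2 w2); rewrite cat_rcons.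
apply; rewrite ?size_map //; [exact/homw_rcons|by split; last exact: hgs|].
move=> v2 hv2 _; rewrite cat_rcons.
have H1 := @mder_gen_eq0 Lam [::] ((m, iA a) :: gs v2 ++ (n, iA b) :: gs v3) (size w1) LamA LamD I.
have E4 : unzip2 ((m, iA a) :: gs v2 ++ (n, iA b) :: gs v3) =
    iA a :: gsymw v2 ++ iA b :: gsymw v3.
  by rewrite /unzip2 /= map_cat /= -!/(unzip2 _) !unzip2_gsymw.
rewrite E4 in H1; apply: (H1 _ _ (unzip2 w1)); rewrite ?size_map //.
  split=> //; apply/homw_cat; split; first exact: hgs.
  by split=> //; apply: hgs.
by move=> v1 hv1 _; apply: (phi_AA _ _ _ m n).
Qed.
End Brackets.

(** [is_D] and [is_Lambda] are characterizations; the two existence claims keep the third part from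
    being vacuous. *)
Theorem proposition53
  (K : fieldType) (charK : [pchar K] =i pred0)
  (A : algType K) (gA : int -> A -> Prop) (hA : graded_calg gA)
  (L : lmodType A) (gL : int -> L -> Prop) (hL : graded_module gA gL)
  (X : seq L -> L) (sg : seq L -> A -> A) (hLR : LR_infty gA gL X sg)
  (De : seq L -> A -> A) (hDe : right_connection gA gL sg De)
  (hflat : flat gL X De) :
  [/\ exists D : nat -> sym gA gL -> sym gA gL, is_D X De D,
      exists Lam : seq (sym gA gL) -> sym gA gL, is_Lambda X sg Lam
    & forall (D : nat -> sym gA gL -> sym gA gL)
             (Lam : seq (sym gA gL) -> sym gA gL),
        is_D X De D -> is_Lambda X sg Lam ->
        [/\ preBV_infty (@sym_deg K A gA L gL) D,
            BV_infty (@sym_deg K A gA L gL) D <-> De [::] 1 = 0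
          & generates (@sym_deg K A gA L gL) D Lam]].
Proof.
have [Op HOp] := choice (fun k => operator_exists hA hL (phi_opdata hA hLR hDe k)).
have OpB k w : homw (hgen gA gL) w -> zmod_morphism (Op k w) by have [h _ _] := HOp k; apply: h.
have Op1 k w : homw (hgen gA gL) w -> Op k w 1 = phi gA gL X sg De k w.
  by have [_ h _] := HOp k; apply: h.
have OpM k w g u : homw (hgen gA gL) w -> hgen gA gL g.1 g.2 ->
    Op k w (gsym gA gL g.2 * u) =
    (gsym gA gL g.2 * Op k w u) *~ sgn (g.1 * (1 + deg w)) + Op k (rcons w g) u.
  by have [_ _ h] := HOp k; apply: h.
pose D0 k := Op k [::].
have HD0 : is_D X De D0 := D_is_D hA hL hLR hDe OpB Op1 OpM.
have lin k : klin (D0 k) := D_linear hA hL hLR hDe OpB Op1 OpM k.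
have ord k : dop k.+1 1 (D0 k) := D_dop hA hL OpB Op1 OpM k.
have hom k : hop 1 (D0 k) := D_deg hA hL hLR hDe OpB Op1 OpM k.
have gens k v : homw (hgen gA gL) v ->
    icomm 1 (D0 k) [seq (g.1, gsym gA gL g.2) | g <- v] 1 = phi gA gL X sg De k v.
  exact: (D_icomm Op1 OpM).
have [Lam0 [HLam0 Lam0E]] := Lambda_exists charK hA hL hLR lin hom ord gens.
split; [by exists D0|by exists Lam0|move=> D Lam HD HLam].
have DE k : (0 < k)%N -> D k = D0 k.
  by move=> k0; apply/funext => u; apply: (D_unique hA hL u HD HD0 k0).
have pre : preBV_infty (@sym_deg K A gA L gL) D.
  split; first exact: sym_graded_calg.
    move=> k k0; rewrite (DE k k0); split; [exact: lin|exact: hom|move=> d b hb u].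
    by apply: (dop_icomm hA hL (ord k)); [apply: homs_zip|rewrite size_zip !size_tuple minnn].
  move=> k k0 u.
  have E i : (1 <= i < k)%N -> gcomm 1 1 (D i) (D (k - i)%N) u =
      D0 i (D0 (k - i)%N u) + D0 (k - i)%N (D0 i u).
    by move=> /andP[i0 ik]; rewrite /gcomm !DE ?subn_gt0 //; signs.
  (* Both operators are odd, so each commutator is a sum of two products. Reversing the index
     carries one half of the total into the other, and [sq] makes both 0. *)
  rewrite big_nat (eq_bigr _ E) -big_nat big_split /=.
  have sq := D_square charK hA hL hLR hDe hflat OpB Op1 OpM k u.
  rewrite [X in _ + X]sq addr0 -[RHS]sq [RHS]big_nat_rev /= big_nat [RHS]big_nat.
  apply: eq_bigr => i /andP[i0 ik].
  have -> : (1 + k - i.+1 = k - i)%N by lia.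
  by rewrite subKn // ltnW.
split=> //.
- split=> [[_ /(_ 1%N isT)]|De1].
    rewrite DE // /D0 (D_one hLR Op1) /= => /eqP; rewrite oppr_eq0 => /eqP.
    by rewrite -(raddf0 (symA gA gL)); apply: symA_inj.
  split=> // k k0; rewrite DE // /D0 (D_one hLR Op1) De1 (raddf0 (symA gA gL)) oppr0.
  by case: eqP.
move=> k k0 d b hb; rewrite DE // (Lambda_unique charK hA hL HLam HLam0).
have := Lam0E _ (homs_zip hb).
by rewrite unzip2_zipt size_zip !size_tuple minnn.
Qed.
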